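(* Let $\lambda\in\mathcal M$ and $\mu$ be nonzero finite even Borel measures on $S^{n-1}$ not concentrated on any great subsphere. Let $G,\Psi\in\mathcal C$ with $G(\xi,t)=G(-\xi,t)$, $\Psi(\xi,t)=\Psi(-\xi,t)$ for all $(\xi,t)\in S^{n-1}\times(0,\infty)$, and $\Theta=(G,\Psi,\lambda)$. (i) If either $\Psi\in\mathcal C_d$ with $\lim_{t\to0^+}\Psi(\xi,t)=+\infty$ for each $\xi$ and $G\in\mathscr G_d$, or $G\in\mathcal C_d$ with $\lim_{t\to0^+}G(\xi,t)=+\infty$ for each $\xi$ and $\Psi\in\mathscr G_d$, then there exists $K_0\in\mathscr K^n_e$ with $\frac{\mu}{|\mu|}=\frac{C_\Theta(K_0,\cdot)}{C_\Theta(K_0,S^{n-1})}$. If in addition $\lambda$ is strictly positive on nonempty open subsets of $S^{n-1}$, then for a nonzero finite even Borel measure $\mu$, being not concentrated on any great subsphere is also necessary for this identity to hold for some $K_0\in\mathscr K^n_e$. (ii) If in addition $\mu$ vanishes on great subspheres, $\Psi\in\mathcal C_I$ and $G\in\mathscr G_d$, then there exists $K_0\in\mathscr K^n_e$ with $\frac{\mu}{|\mu|}=\frac{C_\Theta(K_0,\cdot)}{C_\Theta(K_0,S^{n-1})}$. (iii) If in addition $\mu$ vanishes on great subspheres, there is a constant $C\in(-\infty,\infty)$ with $\inf_{v\in S^{n-1}}\int_{S^{n-1}}\log|v\cdot\xi|\,d\lambda(\xi)>C$, and $\Psi\in\mathcal C_I$, then there exists $K\in\mathscr K^n_e$ with 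$\frac{\mu}{|\mu|}=\frac{J_{\Psi,\lambda}(K,\cdot)}{J_{\Psi,\lambda}(K,S^{n-1})}$.
   Context: $S^{n-1}$ unit sphere of $\mathbb R^n$, $n\ge2$, $d\xi$ spherical Lebesgue measure, $|\mu|=\mu(S^{n-1})$. Even measure: $\mu(-\omega)=\mu(\omega)$. $\mu$ is not concentrated on any great subsphere if $\mu(S^{n-1}\setminus v^\perp)>0$ for every $v\in S^{n-1}$; $\mu$ vanishes on great subspheres if $\mu(S^{n-1}\cap v^\perp)=0$ for every $v\in S^{n-1}$. $\mathscr K^n_{(o)}$: compact convex sets with the origin in their interior; $\mathscr K^n_e$: origin-symmetric members. For $K$: $\rho_K(x)=\max\{t\ge0:tx\in K\}$, $K^*=\{x:x\cdot y\le1\ \forall y\in K\}$; $\pmb\alpha_K(\xi)$ set of outer unit normals at $\rho_K(\xi)\xi$, singleton $\{\alpha_K(\xi)\}$ a.e.; $\pmb\alpha^*_K(\omega)=\{\xi:\pmb\alpha_K(\xi)\cap\omega\ne\emptyset\}$. $\mathcal C$: $G:S^{n-1}\times(0,\infty)\to\mathbb R$ with $G,G_t$ continuous; $\mathcal C_I=\{G_t>0\}$, $\mathcal C_d=\{G_t<0\}$. $\mathscr G_d$: positive $G\in\mathcal C$ with, for each $u$, $G_t(u,\cdot)<0$, $\lim_{t\to0^+}G(u,t)=\infty$, $\lim_{t\to\infty}G(u,t)=0$. $\mathcal M$: nonzero finite Borel measures absolutely continuous w.r.t. $d\xi$. $C_\Theta(K,\omega)=\int_{\pmb\alpha^*_K(\omega)}\frac{\rho_K(\xi)G_t(\xi,\rho_K(\xi))}{\rho_{K^*}(\alpha_K(\xi))\Psi_t(\alpha_K(\xi),\rho_{K^*}(\alpha_K(\xi)))}d\lambda(\xi)$;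 $J_{\Psi,\lambda}(K,\omega)=\int_{\pmb\alpha^*_K(\omega)}\frac{d\lambda(\xi)}{\rho_{K^*}(\alpha_K(\xi))\Psi_t(\alpha_K(\xi),\rho_{K^*}(\alpha_K(\xi)))}$. *)

(* Defs.v *)
From HB Require Import structures.
From mathcomp Require Import all_boot all_order all_algebra.
From mathcomp Require Import all_classical all_reals all_analysis.
Set Implicit Arguments. Unset Strict Implicit. Unset Printing Implicit Defensive.
Import Order.TTheory GRing.Theory Num.Theory.
Import numFieldNormedType.Exports.
Local Open Scope classical_set_scope.
Local Open Scope ring_scope.

Section Defs.
Variables (R : realType) (n : nat).

Definition vec := 'rV[R]_n.

Definition dot (x y : vec) : R := \sum_(i < n) x 0 i * y 0 i.
Definition enorm (x : vec) : R := Num.sqrt (dot x x).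

Definition sphere : set vec := [set x | dot x x = 1].

(** R^n equipped with its Borel sigma-algebra (generated by the open sets).
   A (finite) Borel measure on S^{n-1} is represented by a Borel measure on
   R^n which is concentrated on the (closed) set S^{n-1}. *)
Definition Rn := g_sigma_algebraType (@open 'rV[R]_n).

Definition on_sphere (mu : set Rn -> \bar R) := mu (~` sphere) = 0%E.
Definition finite_meas (mu : set Rn -> \bar R) := (mu setT < +oo)%E.
Definition nonzero_meas (mu : set Rn -> \bar R) := mu setT != 0%E.
Definition even_meas (mu : set Rn -> \bar R) :=
  forall w : set Rn, measurable w -> mu [set - x | x in (w : set vec)] = mu w.

Definition perp (v : vec) : set vec := [set x | dot v x = 0].
Definition not_concentrated (mu : set Rn -> \bar R) :=
  forall v, sphere v -> (0 < mu (sphere `\` perp v))%E.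
Definition vanishes_great (mu : set Rn -> \bar R) :=
  forall v, sphere v -> mu (sphere `&` perp v) = 0%E.

Definition box (a b : vec) : set vec := [set x | forall i, a 0 i <= x 0 i <= b 0 i].
Definition box_vol (a b : vec) : R := \prod_(i < n) Num.max 0 (b 0 i - a 0 i).
Definition leb_outer (A : set vec) : \bar R :=
  ereal_inf [set (\sum_(0 <= k <oo) (box_vol (ab.1 k) (ab.2 k))%:E)%E
            | ab in [set ab : (nat -> vec) * (nat -> vec) |
                      A `<=` \bigcup_k box (ab.1 k) (ab.2 k)]].
Definition cone (w : set vec) : set vec :=
  [set y | exists t x, 0 <= t <= 1 /\ w x /\ y = t *: x].
Definition sph_leb (w : set vec) : \bar R := (n%:R%:E * leb_outer (cone w))%E.

Definition abs_cont_sph (lam : set Rn -> \bar R) :=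
  forall w : set Rn, measurable w -> w `<=` sphere -> sph_leb w = 0%E -> lam w = 0%E.

Definition class_M (lam : set Rn -> \bar R) :=
  on_sphere lam /\ nonzero_meas lam /\ finite_meas lam /\ abs_cont_sph lam.

Definition pos_on_open (lam : set Rn -> \bar R) :=
  forall O : set vec, open O -> (sphere `&` O) !=set0 -> (0 < lam (sphere `&` O))%E.

(** Functions G : S^{n-1} x (0,oo) -> R are represented by G : vec -> R -> R,
    only values on S^{n-1} x (0,oo) matter. G_t is the t-partial derivative. *)
Definition Gt (G : vec -> R -> R) (u : vec) (t : R) : R := derive1 (G u) t.

Definition joint_cont (F : vec -> R -> R) :=
  forall u t, sphere u -> 0 < t -> forall e, 0 < e -> exists2 d, 0 < d &
    forall v s, sphere v -> 0 < s -> enorm (v - u) < d -> `|s - t| < d ->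
      `|F v s - F u t| < e.

Definition class_C (G : vec -> R -> R) :=
  (forall u t, sphere u -> 0 < t -> derivable (G u) t 1) /\
  joint_cont G /\ joint_cont (Gt G).
Definition class_CI (G : vec -> R -> R) :=
  class_C G /\ forall u t, sphere u -> 0 < t -> 0 < Gt G u t.
Definition class_Cd (G : vec -> R -> R) :=
  class_C G /\ forall u t, sphere u -> 0 < t -> Gt G u t < 0.
Definition blows_up_at0 (G : vec -> R -> R) :=
  forall u, sphere u -> G u t @[t --> 0^'+] --> +oo.
Definition class_Gd (G : vec -> R -> R) :=
  class_C G /\
  (forall u t, sphere u -> 0 < t -> 0 < G u t) /\
  (forall u t, sphere u -> 0 < t -> Gt G u t < 0) /\
  blows_up_at0 G /\
  (forall u, sphere u -> G u t @[t --> +oo] --> 0).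
Definition even_fun (G : vec -> R -> R) :=
  forall xi t, sphere xi -> 0 < t -> G xi t = G (- xi) t.

Definition convex_body_o (K : set vec) :=
  convex_set (K : set (convex_lmodType vec)) /\ compact K /\ (interior K) 0.
Definition convex_body_e (K : set vec) :=
  convex_body_o K /\ forall x, K x -> K (- x).

Definition radial (K : set vec) (x : vec) : R := sup [set t : R | 0 <= t /\ K (t *: x)].
Definition polar (K : set vec) : set vec := [set x | forall y, K y -> dot x y <= 1].
Definition normals (K : set vec) (p : vec) : set vec :=
  [set v | sphere v /\ forall y, K y -> dot v y <= dot v p].
Definition alpha_set (K : set vec) (xi : vec) : set vec := normals K (radial K xi *: xi).
(** the radial Gauss map (a choice of normal; unique for a.e. xi) *)
Definition alpha (K : set vec) (xi : vec) : vec := xget 0 (alpha_set K xi).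
Definition alpha_star (K : set vec) (w : set vec) : set vec :=
  [set xi | sphere xi /\ exists2 v, alpha_set K xi v & w v].

Definition C_Theta (G Psi : vec -> R -> R) (lam : {measure set Rn -> \bar R})
    (K : set vec) (w : set vec) : \bar R :=
  (\int[lam]_(xi in (alpha_star K w : set Rn))
     (radial K xi * Gt G xi (radial K xi) /
       (radial (polar K) (alpha K xi) *
        Gt Psi (alpha K xi) (radial (polar K) (alpha K xi))))%:E)%E.

Definition J_Psi (Psi : vec -> R -> R) (lam : {measure set Rn -> \bar R})
    (K : set vec) (w : set vec) : \bar R :=
  (\int[lam]_(xi in (alpha_star K w : set Rn))
     ((radial (polar K) (alpha K xi) *
        Gt Psi (alpha K xi) (radial (polar K) (alpha K xi)))^-1)%:E)%E.

Definition normalized_eq (mu : set Rn -> \bar R) (nu : set vec -> \bar R) :=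
  nu sphere \is a fin_num /\ nu sphere != 0%E /\
  forall w : set Rn, measurable w -> w `<=` sphere ->
    (fine (mu w) / fine (mu sphere))%:E = (nu w * ((fine (nu sphere))^-1)%:E)%E.

Definition log_abs_dot (v xi : vec) : \bar R :=
  if dot v xi == 0 then -oo%E else (ln `|dot v xi|)%:E.

End Defs.

(* Main.v *)
(* Write an origin-symmetric body K as the unit ball of a norm g, so that rho_K = 1/g and
   rho_{K^*} = 1/h with h the dual norm. Put psi(u,t) = s Psi(u,e^{-t}), with s = 1 when Psi
   decreases and s = -1 when it increases, and gam(xi,t) = G(xi,e^{-t}) (gam(xi,t) = t for (iii)).
   Both increase in t, and up to sign the densities of C_Theta and J_{Psi,lambda} are
   gam'(xi, ln g(xi)) / psi'(alpha(xi), ln h(alpha(xi))).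

   Consider P(g) = int psi(u, ln h(u)) dmu and Q(g) = int gam(xi, ln g(xi)) dlambda. A norm that
   is large somewhere is at least c|w.xi| for some w and some large c, and if it is small
   somewhere then h has such a bound; the hypotheses make P and Q coercive in this sense, so for
   suitable a and b all norms with P < a and Q < b are uniformly equivalent to the Euclidean one.
   By Tychonoff's theorem the product (a - P)(b - Q) attains its maximum on them.

   At a maximiser one compares with the Wulff shape of h e^{t phi}, phi even. Its dual norm is at
   most h e^{t phi}, and the logarithm of its norm has derivative -phi(alpha) wherever the outer
   unit normal is unique. This gives (b - Q) int psi' phi dmu = (a - P) int gam' phi(alpha) dlambda
   for even phi, hence for all phi since both measures are even, and so the equality of the two
   measures up to a constant factor. *)
Require Import Defs.
From HB Require Import structures.
From mathcomp Require Import all_boot all_order all_algebra.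
From mathcomp Require Import all_classical all_reals all_analysis.
From mathcomp Require Import measurable_realfun.
From mathcomp Require Import ring lra zify.
Set Implicit Arguments. Unset Strict Implicit. Unset Printing Implicit Defensive.
Import Order.TTheory GRing.Theory Num.Theory.
Import numFieldNormedType.Exports.
Local Open Scope classical_set_scope.
Local Open Scope ring_scope.

(** * The Euclidean structure and norms *)

Section Euclid.
Variables (R : realType) (n : nat).
Local Notation V := 'rV[R]_n.
Implicit Types (x y z u v : V) (t : R).

(** Passing to logarithms turns a multiplicative perturbation of h into an additive one and makes
    both energies integrals of increasing functions on the whole line. Monotonicity is what makes
    the one-sided estimate for the dual of a Wulff shape usable: P of the Wulff shape is at most the
    energy of the perturbed function, so the variation is an inequality valid for t > 0, and only
    the pair phi, -phi gives an equation. The norm of the Wulff shape is differentiated only where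
    the outer normal is unique, so the remaining points must be null for the spherical measure; they
    are caught by second differences of g and counted in the cells of a grid. Coercivity is
    asymmetric. In (i) the function of class G_d is positive, so its energy bounds one side of the
    norm without any prior estimate, and this bound keeps the other energy from going to -oo. In
    (ii) and (iii) psi may be bounded above, so the level a must exceed the Euclidean value of P but
    cannot be taken arbitrarily large. *)

Lemma dotC x y : dot x y = dot y x.
Proof. by apply: eq_bigr => i _; rewrite mulrC. Qed.

Lemma dotDl x y z : dot (x + y) z = dot x z + dot y z.
Proof. by rewrite /dot -big_split; apply: eq_bigr => i _; rewrite mxE mulrDl. Qed.

Lemma dotZl t x y : dot (t *: x) y = t * dot x y.
Proof. by rewrite /dot mulr_sumr; apply: eq_bigr => i _; rewrite mxE mulrA. Qed.

Lemma dotNl x y : dot (- x) y = - dot x y.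
Proof. by rewrite -scaleN1r dotZl mulN1r. Qed.

Lemma dotDr x y z : dot z (x + y) = dot z x + dot z y.
Proof. by rewrite dotC dotDl !(dotC z). Qed.

Lemma dotZr t x y : dot x (t *: y) = t * dot x y.
Proof. by rewrite dotC dotZl dotC. Qed.

Lemma dotNr x y : dot x (- y) = - dot x y.
Proof. by rewrite dotC dotNl dotC. Qed.

Lemma dot0l x : dot 0 x = 0.
Proof. by rewrite -(scale0r x) dotZl mul0r. Qed.

Lemma dot0r x : dot x 0 = 0.
Proof. by rewrite dotC dot0l. Qed.

Lemma dot_ge0 x : 0 <= dot x x.
Proof. by apply: sumr_ge0 => i _; rewrite -expr2 sqr_ge0. Qed.

Lemma enorm_ge0 x : 0 <= enorm x.
Proof. exact: sqrtr_ge0. Qed.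

Lemma enorm_sqr x : enorm x ^+ 2 = dot x x.
Proof. by rewrite sqr_sqrtr// dot_ge0. Qed.

Lemma coord_le_enorm x i : `|x 0 i| <= enorm x.
Proof.
rewrite -(@ler_pXn2r _ 2)// ?nnegrE ?enorm_ge0// enorm_sqr real_normK ?num_real//.
rewrite /dot (bigD1 i)//= -expr2 lerDl; apply: sumr_ge0 => j _.
by rewrite -expr2 sqr_ge0.
Qed.

Lemma enorm_eq0 x : enorm x = 0 -> x = 0.
Proof.
move=> x0; apply/rowP => i; rewrite mxE; apply/eqP; rewrite -normr_eq0.
by rewrite -normr_le0 normr_id -x0 coord_le_enorm.
Qed.

Lemma enorm_gt0 x : x != 0 -> 0 < enorm x.
Proof.
by move=> x0; rewrite lt_def enorm_ge0 andbT; apply: contra_neq x0; exact: enorm_eq0.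
Qed.

Lemma enorm0 : enorm (0 : V) = 0.
Proof. by rewrite /enorm dot0l sqrtr0. Qed.

Lemma enormZ t x : enorm (t *: x) = `|t| * enorm x.
Proof. by rewrite /enorm dotZl dotZr mulrA -expr2 sqrtrM ?sqr_ge0// sqrtr_sqr. Qed.

Lemma enormN x : enorm (- x) = enorm x.
Proof. by rewrite -scaleN1r enormZ normrN1 mul1r. Qed.

Lemma cauchy_schwarz x y : `|dot x y| <= enorm x * enorm y.
Proof.
have [->|y0] := eqVneq y 0; first by rewrite dot0r normr0 enorm0 mulr0.
have yy : 0 < dot y y by rewrite -enorm_sqr exprn_gt0// enorm_gt0.
rewrite -(@ler_pXn2r _ 2)// ?nnegrE ?mulr_ge0 ?enorm_ge0//.
rewrite exprMn !enorm_sqr real_normK ?num_real//.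
have := dot_ge0 (x - (dot x y / dot y y) *: y).
rewrite dotDl !dotDr !dotNl !dotNr !dotZl !dotZr (dotC y x).
set a := dot x y; set b := dot y y in yy *; set c := dot x x => h.
have e : c + - (a / b * a) + (- (a / b * a) + - - (a / b * (a / b * b))) = c - a ^+ 2 / b.
  by field; rewrite gt_eqF.
by move: h; rewrite e subr_ge0 ler_pdivrMr.
Qed.

Lemma dot_le_enorm x y : dot x y <= enorm x * enorm y.
Proof. exact: le_trans (ler_norm _) (cauchy_schwarz x y). Qed.

Lemma enormD x y : enorm (x + y) <= enorm x + enorm y.
Proof.
rewrite -(@ler_pXn2r _ 2)// ?nnegrE ?addr_ge0 ?enorm_ge0//.
rewrite sqrrD !enorm_sqr dotDl !dotDr (dotC y x).
have := dot_le_enorm x y; lra.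
Qed.

Lemma enormB x y : enorm (x - y) = enorm (y - x).
Proof. by rewrite -enormN opprB. Qed.

Lemma mxnorm_le_enorm x : `|x| <= enorm x.
Proof.
rewrite [leLHS]/Num.norm/= mx_normrE; apply/bigmax_leP; split; first exact: enorm_ge0.
by move=> [i j] _ /=; rewrite (ord1 i) coord_le_enorm.
Qed.

(** The constant [n.+1] is not sharp; it is positive for every [n], so it can be divided by. *)
Lemma enorm_le_mxnorm x : enorm x <= n.+1%:R * `|x|.
Proof.
have xi i : `|x 0 i| <= `|x|.
  rewrite [leRHS]/Num.norm/= mx_normrE.
  exact: (@le_bigmax_cond _ _ _ _ (0, i) predT (fun i => `|x i.1 i.2|)).
rewrite -(@ler_pXn2r _ 2)// ?nnegrE ?mulr_ge0 ?enorm_ge0// enorm_sqr.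
apply: (@le_trans _ _ (\sum_(i < n) `|x| ^+ 2)).
  apply: ler_sum => i _; rewrite -expr2 -real_normK ?num_real//.
  by rewrite ler_pXn2r ?nnegrE.
rewrite sumr_const card_ord exprMn -[leLHS]mulr_natl; apply: ler_wpM2r; first exact: sqr_ge0.
by rewrite -natrX ler_nat expnS expn1 (leq_trans (leqnSn n))// leq_pmulr.
Qed.

(* Continuity and compactness are stated by the library for the sup norm of row vectors. *)
Lemma enorm_nbhs x e : 0 < e -> \forall y \near x, enorm (y - x) < e.
Proof.
move=> e0; have d0 : 0 < e / n.+1%:R by exact: divr_gt0.
have := nbhsx_ballx x _ d0; apply: filterS => y; rewrite -ball_normE/= => xy.
apply: le_lt_trans (enorm_le_mxnorm _) _.
by rewrite mulrC -ltr_pdivlMr// -normrN opprB.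
Qed.

Lemma continuous_enormP (f : V -> R) :
  (forall x e, 0 < e -> exists2 d, 0 < d & forall y, enorm (y - x) < d -> `|f y - f x| < e) ->
  continuous f.
Proof.
move=> fc x; apply/(@cvgrPdist_lt _ _ _ _ (nbhs_filter x)) => e e0; have [d d0 fd] := fc x e e0.
have := enorm_nbhs x d0; apply: filterS => y; rewrite distrC; exact: fd.
Qed.

Lemma dot_continuous u : continuous (dot u : V -> R).
Proof.
apply: continuous_enormP => x e e0.
have c0 : 0 < enorm u + 1 by rewrite ltr_wpDl ?enorm_ge0.
exists (e / (enorm u + 1)); first exact: divr_gt0.
move=> y; rewrite ltr_pdivlMr// => ye; rewrite -dotNr -dotDr.
apply: le_lt_trans (cauchy_schwarz _ _) _; apply: le_lt_trans ye.
by rewrite mulrC ler_wpM2l ?enorm_ge0// lerDl.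
Qed.

Lemma nbhs_enormP x (A : set V) :
  nbhs x A <-> exists2 e, 0 < e & forall y, enorm (y - x) < e -> A y.
Proof.
split=> [/nbhs_ballP[e /= e0 eA]|[e e0 eA]]; last first.
  by have := enorm_nbhs x e0; apply: filterS.
exists e => // y yx; apply: eA; rewrite -ball_normE/=.
by apply: le_lt_trans (mxnorm_le_enorm _) _; rewrite enormB.
Qed.

Lemma open_enormP (A : set V) :
  open A <-> forall x, A x -> exists2 e, 0 < e & forall y, enorm (y - x) < e -> A y.
Proof.
by rewrite openE; split=> h x /h /nbhs_enormP.
Qed.

Lemma enorm_continuous : continuous (@enorm R n).
Proof.
apply: continuous_enormP => x e e0; exists e => // y; apply: le_lt_trans.
have h1 := enormD (y - x) x; have h2 := enormD (x - y) y.
rewrite !subrK (enormB x y) in h1 h2.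
by apply/ler_normlP; split; lra.
Qed.

Local Notation S := (@sphere R n).

Lemma sphere_enorm x : S x <-> enorm x = 1.
Proof.
rewrite /sphere/=; split=> h; last by rewrite -enorm_sqr h expr1n.
by rewrite /enorm h sqrtr1.
Qed.

Lemma sphereN x : S x -> S (- x).
Proof. by rewrite /sphere/= dotNl dotNr opprK. Qed.

Lemma sphere_normalize x : x != 0 -> S ((enorm x)^-1 *: x).
Proof.
move=> x0; apply/sphere_enorm; rewrite enormZ gtr0_norm ?invr_gt0 ?enorm_gt0//.
by rewrite mulVf// gt_eqF// enorm_gt0.
Qed.

Lemma sphere_neq0 x : S x -> x != 0.
Proof. by rewrite /sphere/=; apply: contraPneq => ->; rewrite dot0l => /eqP; rewrite eq_sym oner_eq0. Qed.

Lemma closed_sphere : closed S.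
Proof.
rewrite (_ : S = @enorm R n @^-1` [set 1]); last first.
  by apply/seteqP; split=> x /=; rewrite sphere_enorm.
by apply: closed_comp => [x _|]; [exact: enorm_continuous|exact: closed_eq].
Qed.

Lemma bounded_enorm_compact (A : set V) M :
  closed A -> (forall x, A x -> enorm x <= M) -> compact A.
Proof.
move=> cA AM; apply: bounded_closed_compact => //.
exists M; split; first exact: num_real.
move=> N MN x /AM xM; apply: le_trans (mxnorm_le_enorm _) _.
exact: le_trans xM (ltW MN).
Qed.

Lemma compact_sphere : compact S.
Proof. by apply: (@bounded_enorm_compact _ 1 closed_sphere) => x /sphere_enorm ->. Qed.

Lemma abs_dot_sphere u x : S u -> `|dot u x| <= enorm x.
Proof. by move=> /sphere_enorm u1; have := cauchy_schwarz u x; rewrite u1 mul1r. Qed.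

Lemma sphere_delta (i : 'I_n) : S (delta_mx 0 i).
Proof.
rewrite /sphere/= /dot (bigD1 i)//= big1 ?mxE ?eqxx ?mulr1 ?addr0// => j ji.
by rewrite !mxE (negbTE ji) mulr0.
Qed.

Lemma dot_delta x (i : 'I_n) : dot x (delta_mx 0 i) = x 0 i.
Proof.
rewrite /dot (bigD1 i)//= big1 ?mxE ?eqxx ?mulr1 ?addr0// => j ji.
by rewrite !mxE (negbTE ji) mulr0.
Qed.

(** The constants are part of the notion because norms with fixed [c1] and [c2] form a compact
    family, and because duality maps the pair [c1], [c2] to [c2^-1], [c1^-1]. *)
Definition is_norm (c1 c2 : R) (g : V -> R) :=
  [/\ 0 < c1 <= c2, forall x y, g (x + y) <= g x + g y,
      forall t x, g (t *: x) = `|t| * g x &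
      forall x, c1 * enorm x <= g x <= c2 * enorm x].

Section Norm.
Variables (c1 c2 : R) (g : V -> R).
Hypothesis gN : is_norm c1 c2 g.

Lemma is_norm_gt0 : 0 < c1. Proof. by case: gN => /andP[]. Qed.
Lemma is_norm_gt0r : 0 < c2.
Proof. by case: gN => /andP[a b] _ _ _; exact: lt_le_trans a b. Qed.
Lemma is_normD x y : g (x + y) <= g x + g y. Proof. by case: gN. Qed.
Lemma is_normZ t x : g (t *: x) = `|t| * g x. Proof. by case: gN. Qed.
Lemma is_norm_ge x : c1 * enorm x <= g x. Proof. by case: gN => _ _ _ /(_ x)/andP[]. Qed.
Lemma is_norm_le x : g x <= c2 * enorm x. Proof. by case: gN => _ _ _ /(_ x)/andP[]. Qed.
Lemma is_norm_ge0 x : 0 <= g x.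
Proof. by apply: le_trans (is_norm_ge x); rewrite mulr_ge0 ?enorm_ge0 ?ltW ?is_norm_gt0. Qed.
Lemma is_norm0 : g 0 = 0.
Proof. by rewrite -(scale0r 0) is_normZ normr0 mul0r. Qed.
Lemma is_normN x : g (- x) = g x.
Proof. by rewrite -scaleN1r is_normZ normrN1 mul1r. Qed.
Lemma is_norm_pos x : x != 0 -> 0 < g x.
Proof.
by move=> x0; apply: lt_le_trans (is_norm_ge x); rewrite mulr_gt0 ?enorm_gt0 ?is_norm_gt0.
Qed.
Lemma is_norm_sphere x : S x -> c1 <= g x <= c2.
Proof.
by move=> /sphere_enorm x1; have := is_norm_ge x; have := is_norm_le x; rewrite x1 !mulr1 => -> ->.
Qed.
Lemma is_norm_sphere_gt0 x : S x -> 0 < g x.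
Proof. by move=> /sphere_neq0; exact: is_norm_pos. Qed.

Lemma is_norm_dist x y : `|g x - g y| <= c2 * enorm (x - y).
Proof.
have h1 := is_normD (y - x) x; have h2 := is_normD (x - y) y.
have h3 := is_norm_le (x - y); have h4 := is_norm_le (y - x).
rewrite !subrK (enormB y) in h1 h2 h4.
by apply/ler_normlP; split; lra.
Qed.

Lemma is_norm_continuous : continuous g.
Proof.
apply: continuous_enormP => x e e0.
have c20 : 0 < `|c2| + 1 by rewrite ltr_wpDl.
exists (e / (`|c2| + 1)); first exact: divr_gt0.
move=> y; rewrite ltr_pdivlMr// => ye; apply: le_lt_trans (is_norm_dist _ _) _.
apply: le_lt_trans ye; rewrite mulrC ler_wpM2l ?enorm_ge0//.
by rewrite (le_trans (ler_norm _))// lerDl.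
Qed.
End Norm.

End Euclid.

(** * Support functions, dual norms and Wulff shapes *)

Section Duality.
Variables (R : realType) (n : nat).
Local Notation V := 'rV[R]_n.
Local Notation S := (@sphere R n).
Implicit Types (x y z u v : V) (t : R) (K : set V) (f g : V -> R).

(** The epsilon-delta form of continuity within the sphere (see [sph_contP]): values off the sphere
    are arbitrary, and distances are Euclidean. *)
Definition sph_cont f := forall x e, S x -> 0 < e ->
  exists2 d, 0 < d & forall y, S y -> enorm (y - x) < d -> `|f y - f x| < e.

Lemma continuous_enorm f x e : {for x, continuous f} -> 0 < e ->
  exists2 d, 0 < d & forall y, enorm (y - x) < d -> `|f y - f x| < e.
Proof.
move=> fc e0.
have /(@cvgrPdist_lt _ _ _ _ (nbhs_filter x))/(_ _ e0)/nbhs_enormP[d d0 h] := fc.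
by exists d => // y /h; rewrite distrC.
Qed.

Lemma continuous_sph f : continuous f -> sph_cont f.
Proof.
move=> fc x e _ e0; have [d d0 h] := continuous_enorm (fc x) e0.
by exists d => // y _ /h.
Qed.

Lemma dot_continuousl x : continuous ((dot (n := n))^~ x : V -> R).
Proof.
rewrite (_ : (dot (n := n))^~ x = dot x); first exact: dot_continuous.
by apply/funext => u; rewrite dotC.
Qed.

Lemma sph_contP f : sph_cont f <-> {within S, continuous f}.
Proof.
rewrite subspace_continuousP; split=> h x.
  move=> Sx; apply/(@cvgrPdist_lt _ _ _ _ (within_filter _ (nbhs_filter x))) => e e0.
  have [d d0 hd] := h x e Sx e0; rewrite near_withinE.
  by have := enorm_nbhs x d0; apply: filterS => y yx Sy; rewrite distrC; exact: hd.
move=> e Sx e0.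
have /(@cvgrPdist_lt _ _ _ _ (within_filter _ (nbhs_filter x)))/(_ _ e0) := h x Sx.
rewrite near_withinE => /nbhs_enormP[d d0 hd].
by exists d => // y Sy /hd/(_ Sy); rewrite distrC.
Qed.

Lemma sph_cont_max f (A : set V) : sph_cont f -> closed A -> A `<=` S -> A !=set0 ->
  exists2 x, A x & forall y, A y -> f y <= f x.
Proof.
move=> fc cA AS A0.
have [||x xA h] := @compact_EVT_max _ R f A A0.
- exact: subclosed_compact cA (@compact_sphere R n) AS.
- by apply: continuous_subspaceW AS _; exact/sph_contP.
by exists x; [move: xA; rewrite inE|move=> y Ay; apply: h; rewrite inE].
Qed.

Lemma sph_cont_min f (A : set V) : sph_cont f -> closed A -> A `<=` S -> A !=set0 ->
  exists2 x, A x & forall y, A y -> f x <= f y.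
Proof.
move=> fc cA AS A0.
have [||x xA h] := @compact_EVT_min _ R f A A0.
- exact: subclosed_compact cA (@compact_sphere R n) AS.
- by apply: continuous_subspaceW AS _; exact/sph_contP.
by exists x; [move: xA; rewrite inE|move=> y Ay; apply: h; rewrite inE].
Qed.

Definition support K u := sup [set dot u x | x in K].

Definition ball_between (r1 r2 : R) K :=
  [/\ 0 < r1 <= r2, forall x, enorm x <= r1 -> K x, forall x, K x -> enorm x <= r2 &
      forall x, K x -> K (- x)].

Section Support.
Variables (r1 r2 : R) (K : set V).
Hypothesis Kr : ball_between r1 r2 K.

Lemma ball_between0 : K 0.
Proof. by case: Kr => /andP[/ltW r0 _] h _ _; apply: h; rewrite enorm0. Qed.

Lemma support_ge u x : K x -> dot u x <= support K u.
Proof.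
move=> Kx; apply: ub_le_sup; last by exists x.
exists (enorm u * r2) => _ [y Ky <-]; apply: le_trans (dot_le_enorm _ _) _.
by rewrite ler_wpM2l ?enorm_ge0//; case: Kr => _ _ /(_ _ Ky).
Qed.

Lemma support_ge_abs u x : K x -> `|dot u x| <= support K u.
Proof.
move=> Kx; apply/ler_normlP; split; last exact: support_ge.
by rewrite -dotNr; apply: support_ge; case: Kr => _ _ _ /(_ _ Kx).
Qed.

Lemma support_le u c : (forall x, K x -> dot u x <= c) -> support K u <= c.
Proof.
move=> h; apply: ge_sup; first by exists (dot u 0), 0 => //; exact: ball_between0.
by move=> _ [x Kx <-]; exact: h.
Qed.

Lemma support_norm : is_norm r1 r2 (support K).
Proof.
split=> [|u v|t u|u]; first by case: Kr.
- by apply: support_le => x Kx; rewrite dotDl lerD// support_ge.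
- have le s w : support K (s *: w) <= `|s| * support K w.
    apply: support_le => x Kx; rewrite dotZl (le_trans (ler_norm _))// normrM.
    by rewrite ler_wpM2l// support_ge_abs.
  apply/eqP; rewrite eq_le le/=.
  have [->|t0] := eqVneq t 0.
    by rewrite normr0 mul0r scale0r -[leLHS](dot0r (0 : V)) support_ge//; exact: ball_between0.
  have := le t^-1 (t *: u); rewrite scalerA mulVf// scale1r.
  by rewrite normfV -ler_pdivrMl ?invr_gt0 ?normr_gt0// invrK.
- case: Kr => /andP[r0 _] K1 K2 _; apply/andP; split.
    have [->|u0] := eqVneq u 0.
      by rewrite enorm0 mulr0 -[leLHS](dot0r (0 : V)) support_ge//; exact: ball_between0.
    have ue := enorm_gt0 u0.
    have -> : r1 * enorm u = dot u ((r1 / enorm u) *: u).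
      by rewrite dotZr -enorm_sqr expr2 mulrA divfK// gt_eqF.
    apply/support_ge/K1; rewrite enormZ gtr0_norm ?divr_gt0// divfK//.
    by rewrite gt_eqF.
  apply: support_le => x Kx; apply: le_trans (dot_le_enorm _ _) _.
  by rewrite mulrC ler_wpM2r ?enorm_ge0// K2.
Qed.
End Support.

(** The gauge of the symmetric Wulff shape, that is, of the intersection of the slabs
    [|dot u x| <= f u]. *)
Definition wulff f x := sup [set `|dot u x| / f u | u in S].

Lemma sphere_nonempty x : x != 0 -> S !=set0.
Proof. by move=> x0; exists ((enorm x)^-1 *: x); exact: sphere_normalize. Qed.

Section Wulff.
Variables (c1 c2 : R) (f : V -> R).
Hypothesis c1f : 0 < c1 <= c2.
Hypothesis fc : forall u, S u -> c1 <= f u <= c2.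

Let fpos u : S u -> 0 < f u.
Proof.
by move=> /fc/andP[h _]; case/andP: c1f => c _; exact: lt_le_trans h.
Qed.

Let wulff_bound u x : S u -> `|dot u x| / f u <= c1^-1 * enorm x.
Proof.
move=> Su; rewrite mulrC; apply: ler_pM; rewrite ?invr_ge0//.
- exact/ltW/fpos.
- by rewrite lef_pV2 ?posrE ?fpos//; [case/andP: (fc Su)|case/andP: c1f].
- exact: abs_dot_sphere.
Qed.

Lemma wulff_ge u x : S u -> `|dot u x| / f u <= wulff f x.
Proof.
move=> Su; apply: ub_le_sup; last by exists u.
by exists (c1^-1 * enorm x) => _ [v Sv <-]; exact: wulff_bound.
Qed.

Lemma wulff_le x c : 0 <= c -> (forall u, S u -> `|dot u x| <= c * f u) -> wulff f x <= c.
Proof.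
(* For [n = 0] the sphere is empty and the supremum takes its default value 0; this is where
   [0 <= c] enters. *)
move=> c0 h; have [S0|/set0P S0] := eqVneq S set0.
  by rewrite /wulff S0 image_set0 sup0.
apply: ge_sup => [|_ [u Su <-]]; first by case: S0 => u Su; exists (`|dot u x| / f u), u.
by rewrite ler_pdivrMr ?fpos// h.
Qed.

Lemma wulff_ge0 x : 0 <= wulff f x.
Proof.
have [S0|/set0P[u Su]] := eqVneq S set0; first by rewrite /wulff S0 image_set0 sup0.
by apply: le_trans (wulff_ge x Su); rewrite divr_ge0// ltW ?fpos.
Qed.

Lemma abs_dot_wulff u x : S u -> `|dot u x| <= wulff f x * f u.
Proof. by move=> Su; rewrite -ler_pdivrMr ?fpos// wulff_ge. Qed.

Lemma wulff_norm : is_norm c2^-1 c1^-1 (wulff f).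
Proof.
case/andP: (c1f) => c10 c12; have c20 : 0 < c2 by exact: lt_le_trans c12.
split=> [|x y|t x|x].
- by rewrite invr_gt0 c20/= lef_pV2 ?posrE.
- apply: wulff_le => [|u Su]; first by rewrite addr_ge0// wulff_ge0.
  rewrite dotDr mulrDl (le_trans (ler_normD _ _))// lerD// abs_dot_wulff//.
- have le s y : wulff f (s *: y) <= `|s| * wulff f y.
    apply: wulff_le => [|u Su]; first by rewrite mulr_ge0// wulff_ge0.
    by rewrite dotZr normrM -mulrA ler_wpM2l// abs_dot_wulff.
  apply/eqP; rewrite eq_le le/=.
  have [->|t0] := eqVneq t 0; first by rewrite normr0 mul0r wulff_ge0.
  have := le t^-1 (t *: x); rewrite scalerA mulVf// scale1r.
  by rewrite normfV -ler_pdivrMl ?invr_gt0 ?normr_gt0// invrK.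
- apply/andP; split; last first.
    apply: wulff_le => [|u Su]; first by rewrite mulr_ge0 ?enorm_ge0// invr_ge0 ltW.
    by rewrite -ler_pdivrMr ?fpos// wulff_bound.
  have [->|x0] := eqVneq x 0; first by rewrite enorm0 mulr0 wulff_ge0.
  have Sx := sphere_normalize x0; have ex := enorm_gt0 x0.
  apply: le_trans (wulff_ge x Sx); rewrite dotZl -enorm_sqr expr2 mulrA mulVf ?gt_eqF//.
  rewrite mul1r ger0_norm ?enorm_ge0// mulrC ler_wpM2l ?enorm_ge0//.
  by rewrite lef_pV2 ?posrE ?fpos//; case/andP: (fc Sx).
Qed.

Lemma wulff_max x : sph_cont f -> x != 0 -> exists2 u, S u & `|dot u x| = wulff f x * f u.
Proof.
move=> fcont x0.
have qc : sph_cont (fun u => `|dot u x| / f u).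
  apply/sph_contP; apply/subspace_continuousP => u Su.
  apply: (@cvgM _ _ _ (within_filter _ (nbhs_filter u))).
    apply: cvg_norm; apply: cvg_within_filter.
    exact: dot_continuousl.
  apply: cvgV; first by rewrite gt_eqF// fpos.
  by move/sph_contP/subspace_continuousP : fcont; exact.
have [u Su h] := sph_cont_max qc (@closed_sphere R n) (@subset_refl _ _) (sphere_nonempty x0).
exists u => //; apply/eqP; rewrite eq_le abs_dot_wulff//=.
rewrite -ler_pdivlMr ?fpos//; apply: wulff_le => [|v Sv].
  by rewrite divr_ge0// ltW ?fpos.
by rewrite -ler_pdivrMr ?fpos// h.
Qed.

End Wulff.

Definition convex_closed K := forall x y t, K x -> K y -> 0 <= t <= 1 -> K (t *: x + (1 - t) *: y).

(** Let p be the point of K nearest to x. The functional [x - p] separates, since a point y of K on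
    the far side of p would let one move from p towards y and come closer to x. *)
Lemma separation K x : compact K -> K !=set0 -> convex_closed K -> ~ K x ->
  exists u c, (forall y, K y -> dot u y <= c) /\ c < dot u x.
Proof.
move=> cK K0 convK Kx.
have dc : continuous (fun y => enorm (y - x)).
  apply: continuous_enormP => y e e0.
  have h : {for y - x, continuous (@enorm R n)} by exact: enorm_continuous.
  have [d d0 hd] := continuous_enorm h e0; exists d => // z zy; apply: hd.
  by rewrite opprB addrA subrK.
have [|p pK hp] := @compact_EVT_min _ R (fun y => enorm (y - x)) K K0 cK.
  exact: continuous_subspaceT.
move: pK; rewrite inE => Kp.
exists (x - p), (dot (x - p) p); split=> [y Ky|]; last first.
  rewrite -subr_gt0 -dotNr -dotDr -enorm_sqr exprn_gt0// enorm_gt0// subr_eq0.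
  by apply: contra_notN Kx => /eqP ->.
rewrite leNgt; apply/negP => h.
set a := dot (x - p) (y - p); set b := dot (y - p) (y - p).
have a0 : 0 < a by rewrite /a dotDr dotNr subr_gt0.
have b0 : 0 <= b := dot_ge0 _.
(* Moving by [t] changes the squared distance by t^2 b - 2 t a. This [t] is in (0, 1] whatever the
   sizes of [a] and [b], and t b = a - t a < 2 a makes the change negative. *)
pose t := a / (a + b).
have t0 : 0 < t by rewrite divr_gt0// ltr_pwDl.
have t1 : t <= 1 by rewrite ler_pdivrMr ?ltr_pwDl// mul1r lerDl.
have Kz : K (t *: y + (1 - t) *: p) by apply: convK => //; rewrite t1 ltW.
have := hp _ (mem_set Kz); rewrite -(@ler_pXn2r _ 2)// ?nnegrE ?enorm_ge0// !enorm_sqr.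
have -> : t *: y + (1 - t) *: p - x = t *: (y - p) - (x - p).
  by rewrite scalerBr scalerBl scale1r; apply/rowP => i; rewrite !mxE; ring.
rewrite -(opprB x p); set w := x - p.
rewrite dotDl !dotDr !dotNl !dotNr !dotZl !dotZr (dotC _ w) -/a -/b.
have : t * (a + b) = a by rewrite /t divfK// gt_eqF// ltr_pwDl.
nra.
Qed.

(** The bipolar theorem for symmetric bodies: a point outside K is separated from K by some u, and
    after normalisation u violates the slab condition. *)
Lemma wulff_support K r1 r2 x : ball_between r1 r2 K -> compact K -> convex_closed K ->
  K x <-> wulff (support K) x <= 1.
Proof.
move=> Kr cK convK; have hN := support_norm Kr; have [r0 K1 K2 K3] := Kr.
have hS u : S u -> r1 <= support K u <= r2 by move=> Su; exact: (is_norm_sphere hN Su).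
split=> [Kx|h].
  apply: (wulff_le r0 hS) => // u Su; rewrite mul1r.
  exact: support_ge_abs Kr _ _ Kx.
apply: contrapT => Kx.
have K0 : K !=set0 by exists 0; exact: ball_between0 Kr.
have [u [c [uc cu]]] := separation cK K0 convK Kx.
have hu : support K u < dot u x.
  by apply: le_lt_trans cu; exact: (support_le Kr).
have u0 : u != 0.
  by apply: contraTneq hu => ->; rewrite (is_norm0 hN) dot0l ltxx.
have := abs_dot_wulff r0 hS x (sphere_normalize u0).
rewrite dotZl (is_normZ hN) normrM leNgt mulrCA ltr_pM2l ?normr_gt0 ?invr_eq0 ?gt_eqF ?enorm_gt0//.
move=> /negP; apply; apply: le_lt_trans (_ : support K u < _).
  by rewrite ler_piMl// (is_norm_ge0 hN).
exact: lt_le_trans hu (ler_norm _).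
Qed.

Definition unit_ball g := [set x : V | g x <= 1].
Definition dual g := support (unit_ball g).

Section Dual.
Variables (c1 c2 : R) (g : V -> R).
Hypothesis gN : is_norm c1 c2 g.

Lemma ball_between_unit : ball_between c2^-1 c1^-1 (unit_ball g).
Proof.
have c10 := is_norm_gt0 gN; have c20 := is_norm_gt0r gN.
split=> [|x x1|x x1|x]; rewrite /unit_ball/=.
- by rewrite invr_gt0 c20/= lef_pV2 ?posrE//; case: gN => /andP[].
- apply: le_trans (is_norm_le gN x) _.
  by rewrite -ler_pdivlMl// mulr1.
- by rewrite -[leRHS]mulr1 ler_pdivlMl// (le_trans (is_norm_ge gN x)).
- by rewrite (is_normN gN).
Qed.

Lemma compact_unit_ball : compact (unit_ball g).
Proof.
apply: (@bounded_enorm_compact _ _ _ c1^-1); last by case: ball_between_unit.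
rewrite (_ : unit_ball g = g @^-1` [set t | t <= 1])//; apply: closed_comp => [x _|].
  exact: (is_norm_continuous gN).
exact: closed_le.
Qed.

Lemma convex_unit_ball : convex_closed (unit_ball g).
Proof.
move=> x y t x1 y1 /andP[t0 t1]; apply: le_trans (is_normD gN _ _) _.
rewrite !(is_normZ gN) !ger0_norm ?subr_ge0//.
move: x1 y1; rewrite /unit_ball/=; nra.
Qed.

Lemma dual_norm : is_norm c2^-1 c1^-1 (dual g).
Proof. exact/support_norm/ball_between_unit. Qed.

Lemma abs_dot_dual u x : `|dot u x| <= dual g u * g x.
Proof.
have [->|x0] := eqVneq x 0; first by rewrite dot0r (is_norm0 gN) normr0 mulr0.
have gx := is_norm_pos gN x0.
have := @support_ge_abs _ _ _ ball_between_unit u ((g x)^-1 *: x).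
rewrite /unit_ball/= (is_normZ gN) gtr0_norm ?invr_gt0// mulVf ?gt_eqF// => /(_ (lexx _)).
by rewrite dotZr normrM gtr0_norm ?invr_gt0// ler_pdivrMl// mulrC.
Qed.

(** Biduality of norms. For the inequality that needs convexity, x is scaled to the boundary of the
    Wulff shape of [dual g], which [wulff_support] identifies with the unit ball of g. *)
Lemma wulff_dual x : wulff (dual g) x = g x.
Proof.
have dS u : S u -> c2^-1 <= dual g u <= c1^-1 by move=> Su; exact: (is_norm_sphere dual_norm Su).
have r0 : 0 < c2^-1 <= c1^-1 by case: ball_between_unit.
apply/eqP; rewrite eq_le; apply/andP; split.
  apply: (wulff_le r0 dS); first exact: is_norm_ge0 gN _.
  by move=> u Su; rewrite mulrC abs_dot_dual.
have wN := wulff_norm r0 dS.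
have [->|x0] := eqVneq x 0; first by rewrite (is_norm0 gN) (is_norm0 wN).
have wx := is_norm_pos wN x0.
have := @wulff_support _ _ _ ((wulff (dual g) x)^-1 *: x) ball_between_unit
  compact_unit_ball convex_unit_ball.
rewrite -/(dual g) /unit_ball/= (is_normZ gN) (is_normZ wN) gtr0_norm ?invr_gt0//.
rewrite mulVf ?gt_eqF// => -[_ /(_ (lexx _))].
by rewrite ler_pdivrMl// mulr1.
Qed.

(** Existence of an outer unit normal at every boundary point. By biduality a maximiser of |u.x| /
    h(u) on the compact sphere attains g(x), and its sign can be changed. *)
Lemma dual_attained x : x != 0 -> exists2 u, S u & dot u x = dual g u * g x.
Proof.
move=> x0.
have dS u : S u -> c2^-1 <= dual g u <= c1^-1 by move=> Su; exact: (is_norm_sphere dual_norm Su).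
have r0 : 0 < c2^-1 <= c1^-1 by case: ball_between_unit.
have [u Su] := wulff_max r0 dS (continuous_sph (is_norm_continuous dual_norm)) x0.
rewrite wulff_dual mulrC => e; have [ux|ux] := leP 0 (dot u x).
  by exists u => //; rewrite -e ger0_norm.
by exists (- u); [exact: sphereN|rewrite (is_normN dual_norm) dotNl -e ltr0_norm].
Qed.

End Dual.

(** The Wulff shape lies in each slab that defines it. Equality can fail, since [f] need not be a
    support function; this is why the first variation is one-sided. *)
Lemma dual_wulff_le c1 c2 f u : 0 < c1 <= c2 -> (forall u, S u -> c1 <= f u <= c2) ->
  S u -> dual (wulff f) u <= f u.
Proof.
move=> c10 fc Su; have wN := wulff_norm c10 fc.
apply: (support_le (ball_between_unit wN)) => x x1.
apply: le_trans (ler_norm _) _; apply: le_trans (abs_dot_wulff c10 fc _ Su) _.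
have /andP[h _] := fc _ Su; case/andP: c10 => c10 _.
by rewrite ler_piMl// (le_trans _ h)// ltW.
Qed.

End Duality.

(** * The norm of a Wulff shape under a perturbation of the dual norm *)

Section Variation.
Variables (R : realType) (n : nat).
Local Notation V := 'rV[R]_n.
Local Notation S := (@sphere R n).
Implicit Types (x y z u v : V) (t : R) (f g phi : V -> R).

Lemma sph_cont_closed f a : sph_cont f -> closed [set x | S x /\ a <= f x].
Proof.
move=> fc; rewrite -[X in closed X]setCK; apply: open_closedC; apply/open_enormP => x.
move=> nx; have [Sx|Sx] := pselect (S x); last first.
  have /open_enormP/(_ x Sx)[e e0 he] : open (~` S) by exact/closed_openC/closed_sphere.
  by exists e => // y /he Sy [].
have fx : f x < a by rewrite ltNge; apply/negP => fx; exact: nx.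
have [|d d0 hd] := fc x (a - f x) Sx; first by rewrite subr_gt0.
exists d => // y yx [Sy]; have := hd y Sy yx; rewrite ltr_norml => /andP[_].
rewrite ltrBrDr subrK => h1 h2; have := le_lt_trans h2 h1; by rewrite ltxx.
Qed.

Lemma sph_cont_dist f a : sph_cont f -> sph_cont (fun x => `|f x - a|).
Proof.
move=> fc x e Sx e0; have [d d0 hd] := fc x e Sx e0; exists d => // y Sy yx.
apply: le_lt_trans (ler_dist_dist _ _) _.
by rewrite opprB addrA subrK hd.
Qed.

Section Perturbation.
Variables (c1 c2 : R) (g : V -> R) (phi : V -> R) (M : R).
Hypothesis gN : is_norm c1 c2 g.
Hypothesis phic : sph_cont phi.
Hypothesis phiM : forall u, S u -> `|phi u| <= M.
Hypothesis phiN : forall u, S u -> phi (- u) = phi u.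

Let h := dual g.

Definition perturb t u := dual g u * expR (t * phi u).

Let hN : is_norm c2^-1 c1^-1 h. Proof. exact: dual_norm gN. Qed.
Let hpos u : S u -> 0 < h u. Proof. exact: is_norm_sphere_gt0 hN u. Qed.

Let expB t u : 0 <= t -> S u -> expR (- (t * M)) <= expR (t * phi u) <= expR (t * M).
Proof.
move=> t0 /phiM; rewrite ler_norml => /andP[a b]; rewrite !ler_expR; nra.
Qed.

(** The comparison of the two constants is read off at a point of the sphere, hence the alternative
    [S = set0]. *)
Lemma perturb_bounds t : 0 <= t ->
  0 < c2^-1 * expR (- (t * M)) <= c1^-1 * expR (t * M) /\
  (forall u, S u -> c2^-1 * expR (- (t * M)) <= perturb t u <= c1^-1 * expR (t * M)) \/ S = set0.
Proof.
move=> t0; have [->|/set0P[u0 Su0]] := eqVneq S set0; [by right|left].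
have c10 := is_norm_gt0 gN; have c20 := is_norm_gt0r gN.
have B u : S u -> c2^-1 * expR (- (t * M)) <= perturb t u <= c1^-1 * expR (t * M).
  move=> Su; have /andP[a b] := is_norm_sphere hN Su.
  have /andP[c d] := expB t0 Su.
  by apply/andP; split; apply: ler_pM; rewrite ?expR_ge0 ?invr_ge0 ?(ltW c10) ?(ltW c20) ?(ltW (hpos Su)).
split=> //; rewrite mulr_gt0 ?expR_gt0 ?invr_gt0//=.
by have /andP[p q] := B _ Su0; exact: le_trans p q.
Qed.

(** From below, the supremum is tested at an outer normal of x; from above, every term is estimated
    by the duality inequality. *)
Lemma wulff_perturb_bounds t x : 0 <= t -> x != 0 ->
  expR (- (t * M)) * g x <= wulff (perturb t) x <= expR (t * M) * g x.
Proof.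
move=> t0 x0; have [u0 Su0] := sphere_nonempty x0.
have [[r0 B]|E] := perturb_bounds t0; last by move: Su0; rewrite E.
have gx := is_norm_pos gN x0.
apply/andP; split.
  have [u Su e] := dual_attained gN x0.
  apply: le_trans (wulff_ge r0 B x Su); rewrite e ger0_norm; last first.
    by rewrite mulr_ge0 ?ltW//; exact: hpos.
  rewrite /perturb -/h invfM mulrACA divff ?gt_eqF ?hpos// mul1r mulrC ler_pM2l//.
  rewrite -expRN ler_expR lerN2.
  by have /andP[_] := expB t0 Su; rewrite ler_expR.
apply: (wulff_le r0 B) => [|u Su]; first by rewrite mulr_ge0 ?expR_ge0 ?ltW.
apply: le_trans (abs_dot_dual gN u x) _; rewrite /perturb -/h.
rewrite [leRHS](_ : _ = h u * g x * (expR (t * M) * expR (t * phi u))); last by ring.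
rewrite -expRD ler_peMr ?mulr_ge0 ?(ltW gx) ?(ltW (hpos Su))//.
rewrite -[leLHS]expR0 ler_expR.
by have := phiM Su; rewrite ler_norml => /andP[]; nra.
Qed.

Lemma ln_wulff_perturb_bound t x : 0 <= t -> x != 0 ->
  `|ln (wulff (perturb t) x) - ln (g x)| <= t * M.
Proof.
move=> t0 x0; have gx := is_norm_pos gN x0.
have /andP[a b] := wulff_perturb_bounds t0 x0.
have wx : 0 < wulff (perturb t) x by apply: lt_le_trans a; rewrite mulr_gt0// expR_gt0.
have la : - (t * M) + ln (g x) <= ln (wulff (perturb t) x).
  by rewrite -[X in X + _]expRK -lnM ?posrE ?expR_gt0// ler_ln ?posrE// mulr_gt0 ?expR_gt0.
have lb : ln (wulff (perturb t) x) <= t * M + ln (g x).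
  by rewrite -[X in X + _]expRK -lnM ?posrE ?expR_gt0// ler_ln ?posrE// mulr_gt0 ?expR_gt0.
by apply/ler_normlP; split; lra.
Qed.

(** For small t only directions close in [phi] to the normal v can compete in the supremum: by
    compactness the others keep |u.x| / h(u) away from its maximum g(x). The maximum is attained at
    v and -v alone, and [phi] is even, so the supremum behaves like g(x) e^{- t phi(v)}. *)
Lemma ln_wulff_perturb_deriv x v e : x != 0 -> S v -> dot v x = h v * g x ->
  (forall u, S u -> dot u x = h u * g x -> u = v) -> 0 < e ->
  exists2 d, 0 < d & forall t, 0 < t < d ->
    `|(ln (wulff (perturb t) x) - ln (g x)) / t + phi v| <= e.
Proof.
move=> x0 Sv vx vuniq e0; have gx := is_norm_pos gN x0.
have M0 : 0 <= M by exact: le_trans (phiM Sv).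
have sgn u : S u -> `|dot u x| = h u * g x -> phi u = phi v.
  move=> Su; have [ux|ux] := leP 0 (dot u x) => ue.
    by rewrite (vuniq u)// -ue ger0_norm.
  rewrite -(phiN Su) (vuniq (- u))//; first exact: sphereN.
  by rewrite dotNl (is_normN hN) -ue ltr0_norm.
(* The directions to be excluded. They form a closed set containing neither v nor -v, so |u.x| /
   h(u) has a maximum [m] below [g x] there, and the gap beats the factor e^{-2tM} for small t. *)
pose A := [set u | S u /\ e <= `|phi u - phi v|].
have [d d0 hd] : exists2 d, 0 < d & forall t u, 0 < t < d -> A u ->
    `|dot u x| <= g x * h u * expR (- (2 * t * M)).
  have [A0|/set0P A0] := eqVneq A set0.
    by exists 1 => // t u _; rewrite A0.
  have Acl : closed A by exact/sph_cont_closed/sph_cont_dist.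
  have qc : sph_cont (fun u => `|dot u x| / h u).
    apply/sph_contP; apply/subspace_continuousP => u Su.
    apply: (@cvgM _ _ _ (within_filter _ (nbhs_filter u))).
      by apply: cvg_norm; apply: cvg_within_filter; exact: dot_continuousl.
    apply: cvgV; first by rewrite gt_eqF// hpos.
    apply: cvg_within_filter; exact: (is_norm_continuous hN).
  have [|u0 [Su0 fu0] hmax] := sph_cont_max qc Acl _ A0; first by move=> u [].
  set m := (`|dot u0 x| / h u0) in hmax.
  have mg : m < g x.
    rewrite ltr_pdivrMr ?hpos// (mulrC (g x)) lt_neqAle (abs_dot_dual gN) andbT.
    apply/eqP => /(sgn _ Su0) E; move: fu0; rewrite E subrr normr0.
    by rewrite leNgt e0.
  (* [t * D < g x - m] yields m <= g(x) (1 - 2 t M) <= g(x) e^{-2tM}; the summand 1 makes [D]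
     positive. *)
  pose D := 2 * M * g x + 1.
  have D0 : 0 < D by rewrite ltr_wpDl// !mulr_ge0// ltW.
  exists ((g x - m) / D) => [|t u /andP[t0 td] Au]; first by rewrite divr_gt0// subr_gt0.
  have [Su _] := Au; have := hmax u Au; rewrite ler_pdivrMr ?hpos// => /le_trans; apply.
  rewrite [leRHS]mulrAC ler_pM2r ?hpos//.
  have E : 1 - 2 * t * M <= expR (- (2 * t * M)) by have := expR_ge1Dx (- (2 * t * M)).
  apply: (@le_trans _ _ (g x * (1 - 2 * t * M))); last by rewrite ler_pM2l.
  have : t * D < g x - m by rewrite -ltr_pdivlMr.
  by rewrite /D; nra.
exists d => // t td; have /andP[t0 _] := td.
have [[r0 B]|E] := perturb_bounds (ltW t0); last by move: Sv; rewrite E.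
have /andP[wlo _] := wulff_perturb_bounds (ltW t0) x0.
have wx : 0 < wulff (perturb t) x by apply: lt_le_trans wlo; rewrite mulr_gt0// expR_gt0.
have lo : ln (g x) - t * phi v <= ln (wulff (perturb t) x).
  rewrite -[X in _ - X]expRK -ln_div ?posrE ?expR_gt0//.
  rewrite ler_ln ?posrE ?divr_gt0 ?expR_gt0//.
  apply: le_trans (wulff_ge r0 B x Sv); rewrite vx ger0_norm; last first.
    by rewrite mulr_ge0 ?(ltW gx) ?(ltW (hpos Sv)).
  by rewrite /perturb -/h invfM mulrACA divff ?gt_eqF ?hpos// mul1r.
have up : ln (wulff (perturb t) x) <= ln (g x) + t * (e - phi v).
  rewrite -[X in _ + X]expRK -lnM ?posrE ?expR_gt0//.
  rewrite ler_ln ?posrE ?mulr_gt0 ?expR_gt0//.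
  apply: (wulff_le r0 B) => [|u Su]; first by rewrite mulr_ge0 ?expR_ge0 ?ltW.
  rewrite /perturb -/h mulrACA -expRD.
  (* On [A] the factor e^{-2tM} compensates the largest possible difference of [t * phi] at u and v;
     off [A] that difference is at most [t * e]. *)
  have [pe|pe] := leP e `|phi u - phi v|.
    apply: le_trans (hd t u td _) _ => //.
    rewrite ler_pM2l ?mulr_gt0 ?hpos// ler_expR.
    have := phiM Su; have := phiM Sv; rewrite !ler_norml => /andP[? ?] /andP[? ?]; nra.
  apply: le_trans (abs_dot_dual gN u x) _; rewrite -/h (mulrC (h u)).
  rewrite ler_peMr ?mulr_ge0 ?(ltW gx) ?(ltW (hpos Su))// -expR0 ler_expR ltW//.
  move: pe; rewrite ltr_norml => /andP[? ?]; nra.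
have -> : (ln (wulff (perturb t) x) - ln (g x)) / t + phi v =
  (ln (wulff (perturb t) x) - ln (g x) + t * phi v) / t.
  by field; rewrite gt_eqF.
rewrite normrM normfV (gtr0_norm t0) ler_pdivrMr// ger0_norm; nra.
Qed.

End Perturbation.

End Variation.

(** * Non-smooth boundary points form a null set *)

Section FiniteCover.
Variables (R : realType) (n : nat).
Local Notation V := 'rV[R]_n.

(** The finite family is padded to a sequence by the box from 0 to 0, whose volume is an empty
    product, hence 1, if [n = 0]. *)
Lemma leb_outer_fin (T : finType) (a b : T -> V) (A : set V) :
  (0 < n)%N -> A `<=` \bigcup_t box (a t) (b t) ->
  (leb_outer A <= (\sum_t box_vol (a t) (b t))%:E)%E.
Proof.
move=> n0 Aab.
pose c (F : T -> V) (k : nat) : V :=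
  if insub k is Some o then F (@enum_val T predT o) else 0.
have vge0 (x y : V) : 0 <= box_vol x y.
  by apply: prodr_ge0 => i _; rewrite le_max lexx.
have v00 : box_vol (0 : V) 0 = 0.
  rewrite /box_vol (bigD1 (Ordinal n0))//= !mxE subrr.
  by rewrite /Num.max ltxx mul0r.
apply: (@le_trans _ _ (\sum_(0 <= k <oo) (box_vol (c a k) (c b k))%:E)%E).
  apply: ereal_inf_lbound; exists (c a, c b) => //= x /Aab[t _ xt].
  by exists (enum_rank t) => //; rewrite /c valK enum_rankK.
rewrite (@nneseries_split _ _ 0 #|T|) => [|k _]; last by rewrite lee_fin.
rewrite eseries0 ?adde0 => [|k /=]; last first.
  by rewrite add0n => kT _; rewrite /c insubF ?v00// ltnNge kT.
rewrite add0n big_mkord sumEFin lee_fin (reindex (@enum_val T predT))/=; last first.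
  by apply: onW_bij; exact: enum_val_bij.
by apply: ler_sum => i _; rewrite /c valK.
Qed.

End FiniteCover.

Section Singular.
Variables (R : realType) (n : nat).
Local Notation V := 'rV[R]_n.
Local Notation S := (@sphere R n).
Local Notation e_ := (delta_mx 0 : 'I_n -> V).
Implicit Types (x y z u v : V) (s t : R).

Definition second_diff (g : V -> R) x z := g (x + z) + g (x - z) - 2 * g x.

(* The jump of the i-th partial derivative of g at y is at least 1/(k+1). *)
Definition singular (g : V -> R) (i : 'I_n) (k : nat) : set V :=
  [set y | forall s, 0 < s -> s / k.+1%:R <= second_diff g y (s *: e_ i)].

Variables (c1 c2 : R) (g : V -> R).
Hypothesis gN : is_norm c1 c2 g.

Lemma second_diff_ge0 x z : 0 <= second_diff g x z.
Proof.
rewrite /second_diff; have := is_normD gN (x + z) (x - z).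
rewrite addrACA subrr addr0 -mulr2n -scaler_nat (is_normZ gN) ger0_norm//; lra.
Qed.

Lemma second_diff_lip x y z : second_diff g x z <= second_diff g y z + 4 * c2 * enorm (x - y).
Proof.
have d (a b : V) : g a <= g b + c2 * enorm (a - b).
  by have := is_norm_dist gN a b; rewrite ler_norml => /andP[_]; lra.
rewrite /second_diff; have := d (x + z) (y + z); have := d (x - z) (y - z).
have := d y x; rewrite (enormB y x).
rewrite (_ : x + z - (y + z) = x - y); last by apply/rowP => j; rewrite !mxE; ring.
rewrite (_ : x - z - (y - z) = x - y); last by apply/rowP => j; rewrite !mxE; ring.
lra.
Qed.

Lemma closed_singular i k : closed (singular g i k).
Proof.
rewrite -[X in closed X]setCK; apply: open_closedC; apply/open_enormP => x nx.
have [s s0 hs] : exists2 s : R, 0 < s & second_diff g x (s *: e_ i) < s / k.+1%:R.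
  apply: contrapT => h; apply: nx => s s0; rewrite leNgt; apply/negP => hs.
  by apply: h; exists s.
have c20 := is_norm_gt0r gN.
exists ((s / k.+1%:R - second_diff g x (s *: e_ i)) / (4 * c2)).
  by rewrite divr_gt0 ?subr_gt0 ?mulr_gt0.
move=> y; rewrite ltr_pdivlMr ?mulr_gt0// => yx /(_ s s0); apply/negP.
rewrite -ltNge; have := second_diff_lip y x (s *: e_ i); rewrite (mulrC (4 * c2)).
by move=> h; apply: le_lt_trans h _; rewrite -ltrBrDl.
Qed.

(** Needed for the cone over the singular points of the sphere. For a positive factor it is
    homogeneity, with [s] rescaled; the apex follows by letting the factor tend to 0. *)
Lemma singularZ i k y t : 0 <= t -> singular g i k y -> singular g i k (t *: y).
Proof.
move=> t0 yk s s0.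
have pos r : 0 < r -> s / k.+1%:R <= second_diff g (r *: y) (s *: e_ i).
  move=> r0; have := yk (s / r) (divr_gt0 s0 r0); rewrite -(ler_pM2l r0).
  rewrite mulrA (mulrC r) divfK ?gt_eqF// => /le_trans; apply.
  rewrite /second_diff mulrBr mulrDr.
  have E w : r * g w = g (r *: w) by rewrite (is_normZ gN) gtr0_norm.
  rewrite !E mulrCA E scalerDr scalerBr scalerA (mulrC r) divfK ?gt_eqF//.
move: t0; rewrite le_eqVlt => /predU1P[<-|]; last exact: pos.
rewrite scale0r; apply/ler_addgt0Pl => e e0.
have c20 := is_norm_gt0r gN.
pose r := e / (4 * c2 * (enorm y + 1)).
have d0 : 0 < 4 * c2 * (enorm y + 1) by rewrite !mulr_gt0// ltr_wpDl ?enorm_ge0.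
have r0 : 0 < r by rewrite divr_gt0.
have := pos r r0; have := second_diff_lip (r *: y) 0 (s *: e_ i).
rewrite subr0 enormZ gtr0_norm//.
have : 4 * c2 * (r * enorm y) <= e.
  rewrite mulrCA /r mulrAC ler_pdivrMr// ler_pM2l// ler_pM2l ?mulr_gt0//.
  by rewrite lerDl.
by move: (k.+1%:R^-1) => K; lra.
Qed.

(** v / h(v) and w / h(w) are distinct subgradients of g at x. In a coordinate where they differ,
    the larger one bounds the forward slope from below and the smaller one the backward slope from
    above, so the partial derivative jumps. *)
Lemma normals_singular x v w : S v -> S w -> v != w ->
  dot v x = dual g v * g x -> dot w x = dual g w * g x ->
  exists i k, singular g i k x.
Proof.
move=> Sv Sw vw xv xw; have hN := dual_norm gN.
have hv := is_norm_sphere_gt0 hN Sv; have hw := is_norm_sphere_gt0 hN Sw.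
pose p := (dual g v)^-1 *: v; pose q := (dual g w)^-1 *: w.
have pg z : dot p z <= g z.
  by rewrite dotZl ler_pdivrMl// (le_trans (ler_norm _))// (abs_dot_dual gN).
have qg z : dot q z <= g z.
  by rewrite dotZl ler_pdivrMl// (le_trans (ler_norm _))// (abs_dot_dual gN).
have px : dot p x = g x by rewrite dotZl xv mulKf// gt_eqF.
have qx : dot q x = g x by rewrite dotZl xw mulKf// gt_eqF.
have pq : p != q.
  apply: contra_neq vw => pq.
  have E : enorm p = enorm q by rewrite pq.
  move: E; rewrite !enormZ !gtr0_norm ?invr_gt0//.
  move/sphere_enorm : Sv => ->; move/sphere_enorm : Sw => ->; rewrite !mulr1 => E.
  move: pq; rewrite /p /q E => /(congr1 (fun z => dual g w *: z)).
  by rewrite !scalerA mulfV ?gt_eqF// !scale1r.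
have [i pqi] : exists i, p 0 i != q 0 i.
  apply: contrapT => h; move/eqP : pq; apply; apply/rowP => i; apply: contrapT => /eqP pi.
  by apply: h; exists i.
have key (a b : V) : (forall z, dot a z <= g z) -> (forall z, dot b z <= g z) ->
    dot a x = g x -> dot b x = g x -> b 0 i < a 0 i -> exists i k, singular g i k x.
  move=> ag bg ax bx ab; exists i.
  have ab0 : 0 < a 0 i - b 0 i by rewrite subr_gt0.
  (* This index makes 1 / (k + 1) at most the gap between the two coordinates. *)
  exists (Num.trunc (a 0 i - b 0 i)^-1) => s s0.
  have ki : (Num.trunc (a 0 i - b 0 i)^-1).+1%:R^-1 <= a 0 i - b 0 i.
    rewrite -[leRHS]invrK lef_pV2 ?posrE ?invr_gt0 ?ltr0n// ltW//.
    by have /andP[] := truncn_itv (ltW (etrans (invr_gt0 _) ab0)).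
  have := ag (x + s *: e_ i); have := bg (x - s *: e_ i).
  rewrite !dotDr dotNr !dotZr !dot_delta ax bx /second_diff.
  have := ler_wpM2l (ltW s0) ki; move: (_.+1%:R^-1) => K; lra.
have [h|h] : p 0 i < q 0 i \/ q 0 i < p 0 i by apply/orP; rewrite -neq_lt.
  exact: key qg pg qx px h.
exact: key pg qg px qx h.
Qed.

(** Each second difference is [D (j + m) - D j], where [D] is the increment of g over m mesh steps.
    The sum collapses to m differences of increments, each controlled by the Lipschitz constant, so
    the bound is independent of N. *)
Lemma column_bound x i (s : R) (m N : nat) : 0 < s ->
  \sum_(j < N) second_diff g (x + (j%:R * s) *: e_ i) ((m%:R * s) *: e_ i) <=
  2 * m%:R * (c2 * (m%:R * s)).
Proof.
move=> s0.
pose F (j : nat) := g (x + ((j%:R - m%:R) * s) *: e_ i).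
pose D (j : nat) := F (j + m)%N - F j.
have DB j : `|D j| <= c2 * (m%:R * s).
  apply: le_trans (is_norm_dist gN _ _) _.
  rewrite (_ : _ - _ = (m%:R * s) *: e_ i); last first.
    by apply/rowP => l; rewrite !mxE natrD; ring.
  rewrite enormZ ger0_norm ?mulr_ge0 ?(ltW s0)//.
  by have /sphere_enorm -> := sphere_delta R i; rewrite mulr1.
have E (j : nat) : second_diff g (x + (j%:R * s) *: e_ i) ((m%:R * s) *: e_ i) = D (j + m)%N - D j.
  rewrite /second_diff /D /F.
  rewrite (_ : x + (j%:R * s) *: e_ i + (m%:R * s) *: e_ i =
               x + (((j + m + m)%N)%:R - m%:R) * s *: e_ i); last first.
    by apply/rowP => l; rewrite !mxE !natrD; ring.
  rewrite (_ : x + (j%:R * s) *: e_ i - (m%:R * s) *: e_ i =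
               x + ((j%:R - m%:R) * s) *: e_ i); last first.
    by apply/rowP => l; rewrite !mxE; ring.
  rewrite (_ : x + (j%:R * s) *: e_ i = x + (((j + m)%N)%:R - m%:R) * s *: e_ i); last first.
    by apply/rowP => l; rewrite !mxE !natrD; ring.
  ring.
under eq_bigr do rewrite E.
(* Exchange of roles: N differences at distance m have the same sum as m differences at distance
   N. *)
have -> : \sum_(j < N) (D (j + m)%N - D j) = \sum_(j < m) (D (j + N)%N - D j).
  elim: N => [|N IH]; first by rewrite big_ord0 big1// => j _; rewrite addn0 subrr.
  rewrite big_ord_recr/= IH.
  have := @telescope_sumr _ 0 m (fun j => D (j + N)%N) (leq0n m).
  rewrite big_mkord add0n (addnC m) => <-; rewrite -big_split/=.
  by apply: eq_bigr => j _; rewrite addnS addSn; ring.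
apply: (@le_trans _ _ (\sum_(j < m) (2 * (c2 * (m%:R * s))))).
  apply: ler_sum => j _; have := DB (j + N)%N; have := DB j.
  by rewrite !ler_norml => /andP[? ?] /andP[? ?]; lra.
by rewrite sumr_const card_ord -mulr_natl; rewrite le_eqVlt; apply/orP; left; apply/eqP; ring.
Qed.

(* Second differences of step m * d, with m fixed and d the mesh of a grid, have a sum along a
   line which telescopes to O(d), while each cell of the grid which meets the singular set
   contributes at least a multiple of d; so a line meets a bounded number of such cells. *)
Lemma leb_outer_singular i k : exists2 C : R, 0 <= C &
  forall N : nat, (0 < N)%N ->
  (leb_outer (singular g i k `&` [set y : V | forall l, `|y 0 l|%R <= 1]%R) <= (C / N%:R)%:E)%E.
Proof.
have c20 := is_norm_gt0r gN.
pose K : R := k.+1%:R; have K0 : 0 < K by rewrite ltr0n.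
(* A point of a cell is within [n.+1 * d] of its corner, which changes a second difference by at
   most [4 * c2 * n.+1 * d]. This [m] makes that at most half of the lower bound [m * d / K], so the
   corner keeps the other half. *)
pose m := (Num.trunc (8 * c2 * n.+1%:R * K)).+1.
have hm : 8 * c2 * n.+1%:R * K <= m%:R.
  by apply/ltW; have /andP[] := @truncn_itv R (8 * c2 * n.+1%:R * K) (ltac:(by rewrite !mulr_ge0// ltW)).
have m0 : 0 < m%:R :> R by rewrite ltr0n.
pose C := 4 * K * c2 * m%:R.
have C0 : 0 <= C by rewrite /C !mulr_ge0// ltW.
exists (C * 4 ^+ n) => [|N N0]; first by rewrite mulr_ge0// exprn_ge0.
have n0 : (0 < n)%N by case: i => i /=; case: (n).
have N0R : 0 < N%:R :> R by rewrite ltr0n.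
pose d : R := 2 / N%:R; have d0 : 0 < d by rewrite divr_gt0.
(* The coordinates other than [i] select a column of cells, the last component a cell of the column.
   There are [N.+1] indices because a coordinate equal to 1 has index N. *)
pose T := ({ffun {l : 'I_n | l != i} -> 'I_N.+1} * 'I_N.+1)%type.
pose idx (t : T) (l : 'I_n) : nat := if insub l is Some l' then t.1 l' else t.2.
pose corner (t : T) : V := \row_l (-1 + (idx t l)%:R * d).
pose P (t : T) := `[< exists y, singular g i k y /\ forall l, corner t 0 l <= y 0 l <= corner t 0 l + d >].
(* Cells that miss the singular set are collapsed to their corner and have volume 0. *)
pose b (t : T) : V := if P t then \row_l (corner t 0 l + d) else corner t.
have vol (t : T) : box_vol (corner t) (b t) = (P t)%:R * d ^+ n.
  rewrite /box_vol /b; case: ifP => _; last first.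
    rewrite mul0r (bigD1 (Ordinal n0))//= subrr.
    by rewrite /Num.max ltxx mul0r.
  rewrite mul1r (eq_bigr (fun=> d)) => [|l _]; first by rewrite prodr_const card_ord.
  by rewrite mxE addrAC subrr add0r; apply/max_idPr/ltW.
have cover : singular g i k `&` [set y : V | forall l, `|y 0 l|%R <= 1]%R `<=` \bigcup_t box (corner t) (b t).
  move=> y [ys y1].
  pose c l := Num.trunc ((y 0 l + 1) / d).
  have yl l : 0 <= (y 0 l + 1) / d.
    by have := y1 l; rewrite ler_norml => /andP[h _]; rewrite divr_ge0// ?(ltW d0)//; lra.
  have cN l : (c l < N.+1)%N.
    rewrite ltnS -(ler_nat R); have /andP[h _] := truncn_itv (yl l).
    apply: le_trans h _; rewrite ler_pdivrMr// /d mulrCA divff ?gt_eqF// mulr1.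
    by have := y1 l; rewrite ler_norml => /andP[_ ?]; lra.
  pose t : T := ([ffun l' => inord (c (val l'))], inord (c i)).
  have it l : idx t l = c l.
    rewrite /idx; case: insubP => [l' _ <-|] /=; first by rewrite ffunE inordK.
    by rewrite negbK => /eqP ->; rewrite inordK.
  have yt l : corner t 0 l <= y 0 l <= corner t 0 l + d.
    rewrite mxE it; have /andP[h1 h2] := truncn_itv (yl l).
    move: h1 h2; rewrite ler_pdivlMr// ltr_pdivrMr// -/(c l) -natr1 mulrDl mul1r.
    by move=> h1 h2; apply/andP; split; lra.
  have Pt : P t by apply/asboolP; exists y.
  by exists t => // l; move: (yt l); rewrite /b Pt !mxE.
apply: le_trans (leb_outer_fin n0 cover) _; rewrite lee_fin.
under eq_bigr do rewrite vol.
rewrite -mulr_suml.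
have column (c : {ffun {l : 'I_n | l != i} -> 'I_N.+1}) : \sum_(j < N.+1) (P (c, j))%:R <= C.
  pose x := corner (c, ord0).
  have xj j : corner (c, j) = x + (j%:R * d) *: e_ i.
    apply/rowP => l; rewrite !mxE /idx/= -addrA; congr (_ + _).
    case: insubP => [l' li vl|].
      by rewrite (negbTE li) mulr0 addr0.
    by rewrite negbK => ->; rewrite mulr1 mul0r add0r.
  have K20 : 0 < 2 * K by rewrite mulr_gt0.
  have md0 : 0 < m%:R * d / (2 * K) by exact: divr_gt0 (mulr_gt0 m0 d0) K20.
  rewrite -(ler_pM2r md0) mulr_suml.
  apply: (@le_trans _ _ (2 * m%:R * (c2 * (m%:R * d)))); last first.
    rewrite le_eqVlt; apply/orP; left; apply/eqP; rewrite /C; field.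
    by rewrite gt_eqF.
  apply: le_trans (column_bound x i m N.+1 d0); apply: ler_sum => j _.
  rewrite -xj; have [/asboolP[y [ys yc]]|_] := boolP (P (c, j)); last first.
    by rewrite mul0r second_diff_ge0.
  rewrite mul1r; have h1 := ys _ (mulr_gt0 m0 d0).
  have h2 := second_diff_lip y (corner (c, j)) ((m%:R * d) *: e_ i).
  have h3 : enorm (y - corner (c, j)) <= n.+1%:R * d.
    apply: le_trans (enorm_le_mxnorm _) _; rewrite ler_pM2l ?ltr0n//.
    rewrite [leLHS]/Num.norm/= mx_normrE; apply/bigmax_leP; split; first exact: ltW.
    move=> [r l] _ /=; rewrite (ord1 r) mxE [X in _ + X]mxE.
    by have /andP[? ?] := yc l; apply/ler_normlP; split; lra.
  have h4 : 4 * c2 * (n.+1%:R * d) <= m%:R * d / (2 * K).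
    rewrite ler_pdivlMr ?mulr_gt0//; have := ler_wpM2r (ltW d0) hm; lra.
  have h5 : 4 * c2 * enorm (y - corner (c, j)) <= 4 * c2 * (n.+1%:R * d).
    by rewrite ler_pM2l// mulr_gt0.
  have h6 : m%:R * d / K = m%:R * d / (2 * K) + m%:R * d / (2 * K).
    by field; rewrite gt_eqF.
  move: h1; rewrite -/K h6 => h1; move: h1 h2 h4 h5; move: (m%:R * d / (2 * K)) => A; lra.
apply: (@le_trans _ _ ((\sum_(c : {ffun {l : 'I_n | l != i} -> 'I_N.+1}) C) * d ^+ n)).
  rewrite ler_pM2r ?exprn_gt0//.
  rewrite (eq_bigr (fun t : T => (P (t.1, t.2))%:R)) => [|[c j] _//].
  rewrite -(pair_bigA _ (fun c j => (P (c, j))%:R))/=.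
  by apply: ler_sum => c _; exact: column.
have cardl : #|{: {l : 'I_n | l != i}}| = n.-1.
  by rewrite card_sig -[in RHS](card_ord n) -(cardC1 i); exact: eq_card.
rewrite sumr_const card_ffun card_ord cardl -[X in X * _ <= _]mulr_natl natrX.
rewrite mulrAC mulrC -[leRHS]mulrA ler_wpM2l//.
(* With d = 2 / N, the at most (2N)^(n-1) columns absorb n - 1 of the n factors d into 4^(n-1); the
   last factor gives the decay 1 / N. *)
apply: (@le_trans _ _ ((2 * N%:R) ^+ n.-1 * d ^+ n)).
  rewrite ler_pM2r ?exprn_gt0//; apply: lerXn2r; rewrite ?nnegrE ?mulr_ge0//.
  by rewrite -natrM ler_nat; lia.
rewrite -(prednK n0) [in leLHS]exprS mulrCA -exprMn /d.
rewrite (_ : 2 * N%:R * (2 / N%:R) = 4); last by field; rewrite gt_eqF.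
rewrite exprS mulrAC ler_pM2r ?invr_gt0// ler_pM2r ?exprn_gt0//; lra.
Qed.

(** The cone over the singular points of the sphere lies in the singular part of the cube, whose
    outer measure is at most C / N for every N. *)
Lemma sph_leb_singular i k : sph_leb (singular g i k `&` S) = 0%E.
Proof.
have n0 : (0 < n)%N by case: i => i /=; case: (n).
rewrite /sph_leb; have -> : leb_outer (cone (singular g i k `&` S)) = 0%E; last by rewrite mule0.
apply/eqP; rewrite eq_le; apply/andP; split; last first.
  apply: le_ereal_inf_tmp => _ [ab _ <-]; apply: nneseries_ge0 => j _ _; rewrite lee_fin.
  by apply: prodr_ge0 => l _; rewrite le_max lexx.
apply/lee_addgt0Pr => e e0; rewrite add0e.
have [C C0 hC] := leb_outer_singular i k.
pose N := (Num.trunc (C / e)).+1.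
apply: (@le_trans _ _ (C / N%:R)%:E); last first.
  rewrite lee_fin ler_pdivrMr ?ltr0n// mulrC -ler_pdivrMr//.
  by apply/ltW; have /andP[] := truncn_itv (divr_ge0 C0 (ltW e0)).
apply: le_trans (hC N (ltn0Sn _)).
apply: ereal_inf_le_tmp => _ [ab h <-]; exists ab => //; apply: subset_trans h.
move=> _ [t [x [/andP[t0 t1] [[xs Sx] ->]]]]; split; first exact: singularZ.
move=> l /=; apply: le_trans (coord_le_enorm _ _) _; rewrite enormZ ger0_norm//.
by have /sphere_enorm -> := Sx; rewrite mulr1.
Qed.

End Singular.

(** * Integral functionals on the sphere *)

Section SphereAnalysis.
Variables (R : realType) (n : nat).
Local Notation V := 'rV[R]_n.
Local Notation S := (@sphere R n).
Implicit Types (x y z u v w : V) (s t : R).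

Lemma sphere_cluster (w : nat -> V) : (forall k, S (w k)) ->
  exists2 v, S v & forall e, 0 < e -> forall N : nat,
    exists2 k, (N <= k)%N & enorm (w k - v) < e.
Proof.
move=> Sw.
have wS : (w @ \oo) S by exists 0%N => // k _; exact: Sw.
have [v [Sv cv]] := @compact_sphere R n (w @ \oo) _ wS.
exists v => // e e0 N.
have [||y [[k /= Nk wk] ve]] := cv (w @` [set k | (N <= k)%N]) [set y | enorm (y - v) < e].
- by exists N => // k Nk; exists k.
- exact: enorm_nbhs.
by exists k => //; rewrite wk.
Qed.

(** The counterpart of [joint_cont] for a variable on the whole line, where it lives after the
    substitution of e^{-t}. *)
Definition jcont (F : V -> R -> R) := forall u t e, S u -> 0 < e ->
  exists2 d, 0 < d & forall v s, S v -> enorm (v - u) < d -> `|s - t| < d ->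
    `|F v s - F u t| < e.

Definition incr_C1 (F F' : V -> R -> R) :=
  [/\ jcont F, jcont F', forall u t, S u -> is_derive t 1 (F u) (F' u t) &
      forall u t, S u -> 0 < F' u t].

Lemma jcont_comp F (l : V -> R) : jcont F -> sph_cont l -> sph_cont (fun x => F x (l x)).
Proof.
move=> Fc lc x e Sx e0; have [d d0 hd] := Fc x (l x) e Sx e0.
have [d' d'0 hd'] := lc x d Sx d0.
exists (Num.min d d') => [|y Sy]; first by rewrite lt_min d0.
by rewrite lt_min => /andP[h1 h2]; apply: hd => //; exact: hd'.
Qed.

Lemma jcont_max F (a b : R) : jcont F -> S !=set0 -> a <= b ->
  exists x t, [/\ S x, a <= t <= b & forall y s, S y -> a <= s <= b -> F y s <= F x t].
Proof.
move=> Fc [x0 Sx0] ab.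
pose A : set (V * R) := S `*` `[a, b].
have A0 : A !=set0 by exists (x0, a); split => //=; rewrite in_itv/= lexx.
have cA : compact A by apply: compact_setX; [exact: compact_sphere|exact: segment_compact].
have [|[x t] xtA h] := @compact_EVT_max _ R (fun p => F p.1 p.2) A A0 cA.
  apply/subspace_continuousP => -[x t] [/= Sx tab].
  apply/(@cvgrPdist_lt _ _ _ _ (within_filter _ (nbhs_filter (x, t)))) => e e0.
  have [d d0 hd] := Fc x t e Sx e0; rewrite near_withinE.
  exists ([set y | enorm (y - x) < d], [set s | `|s - t| < d]).
    split; first exact: enorm_nbhs.
    by have := nbhsx_ballx t _ d0; apply: filterS => s; rewrite /ball/= distrC.
  by move=> [y s] [/= yx st] [/= Sy _]; rewrite distrC hd.
move: xtA; rewrite inE => -[/= Sx]; rewrite in_itv/= => tab.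
exists x, t; split => // y s Sy sab; apply: (h (y, s)); by rewrite inE; split.
Qed.

Lemma jcontN F : jcont F -> jcont (fun x t => - F x t).
Proof.
move=> Fc u t e Su e0; have [d d0 hd] := Fc u t e Su e0; exists d => // v s Sv vu st.
by rewrite -opprD normrN hd.
Qed.

Lemma jcont_min F (a b : R) : jcont F -> S !=set0 -> a <= b ->
  exists x t, [/\ S x, a <= t <= b & forall y s, S y -> a <= s <= b -> F x t <= F y s].
Proof.
move=> /jcontN Fc S0 ab; have [x [t [Sx tab h]]] := jcont_max Fc S0 ab.
by exists x, t; split => // y s Sy sab; rewrite -lerN2 h.
Qed.

Lemma jcont_bounded F (M : R) : jcont F ->
  exists2 B, 0 <= B & forall y s, S y -> `|s| <= M -> `|F y s| <= B.
Proof.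
move=> Fc; have [S0|/set0P S0] := eqVneq S set0.
  by exists 0 => // y s; rewrite S0.
have [M0|M0] := ltP M 0.
  by exists 0 => // y s _ /(le_trans (normr_ge0 _)); rewrite leNgt M0.
have MM : - M <= M by rewrite (le_trans _ M0)// oppr_le0.
have [x [t [Sx _ h1]]] := jcont_max Fc S0 MM.
have [x' [t' [Sx' _ h2]]] := jcont_min Fc S0 MM.
exists (`|F x t| + `|F x' t'|) => [|y s Sy]; first by rewrite addr_ge0.
rewrite ler_norml => sM; have a := h1 y s Sy sM; have b := h2 y s Sy sM.
have := ler_norm (F x t); have := ler_norm (- F x' t'); rewrite normrN => c d.
have e := normr_ge0 (F x t); have f := normr_ge0 (F x' t').
by apply/ler_normlP; split; lra.
Qed.

Section Increasing.
Variables F F' : V -> R -> R.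
Hypothesis FC : incr_C1 F F'.

Let Fc : jcont F. Proof. by case: FC. Qed.
Let F'c : jcont F'. Proof. by case: FC. Qed.

Lemma incr_MVT x s t : S x -> s <= t ->
  exists2 c, s <= c <= t & F x t - F x s = F' x c * (t - s).
Proof.
move=> Sx st; have [_ _ dF _] := FC.
have [||c] := @MVT_segment R (F x) (F' x) s t st.
- by move=> y _; exact: dF.
- apply: derivable_within_continuous => y _; have := dF x y Sx.
  by case.
by rewrite in_itv/= => cs h; exists c.
Qed.

Lemma incr_le x s t : S x -> s <= t -> F x s <= F x t.
Proof.
move=> Sx st; have [c _ h] := incr_MVT Sx st; rewrite -subr_ge0 h.
by rewrite mulr_ge0 ?subr_ge0// ltW//; case: FC => _ _ _ /(_ x c Sx).
Qed.

Lemma incr_lt x s t : S x -> s < t -> F x s < F x t.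
Proof.
move=> Sx st; have [c _ h] := incr_MVT Sx (ltW st); rewrite -subr_gt0 h.
by rewrite mulr_gt0 ?subr_gt0//; case: FC => _ _ _ /(_ x c Sx).
Qed.

Lemma incr_lipschitz (M : R) : exists2 L, 0 <= L & forall x s t, S x ->
  `|s| <= M -> `|t| <= M -> `|F x s - F x t| <= L * `|s - t|.
Proof.
have [L L0 h] := jcont_bounded M F'c; exists L => // x s t Sx sM tM.
wlog st : s t sM tM / t <= s.
  move=> W; have [/W|/ltW/W] := leP t s; first exact.
  by rewrite distrC (distrC s); exact.
have [c /andP[tc cs] ->] := incr_MVT Sx st; rewrite normrM ler_wpM2r//; apply: h => //.
move: sM tM; rewrite !ler_norml => /andP[? ?] /andP[? ?]; apply/andP; split; lra.
Qed.

Lemma incr_linearization x t e : S x -> 0 < e ->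
  exists2 d, 0 < d & forall s, `|s - t| < d ->
    `|F x s - F x t - F' x t * (s - t)| <= e * `|s - t|.
Proof.
move=> Sx e0; have [d d0 hd] := F'c t Sx e0; exists d => // s st.
have key a b : a <= b -> `|a - t| < d -> `|b - t| < d ->
    `|F x b - F x a - F' x t * (b - a)| <= e * `|b - a|.
  move=> ab ad bd; have [c /andP[ac cb] ->] := incr_MVT Sx ab.
  rewrite -mulrBl normrM ler_wpM2r// ltW// hd//.
    by rewrite subrr enorm0.
  move: ad bd; rewrite !ltr_norml => /andP[? ?] /andP[? ?]; apply/andP; split; lra.
have tt : `|t - t| < d by rewrite subrr normr0.
have [ts|/ltW ts] := leP t s; first exact: key.
have := key s t ts st tt; rewrite (distrC s t) -[X in `|X| <= _]opprK normrN.
by congr (`| _ | <= _); ring.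
Qed.

(* Dini: pointwise divergence of a monotone family is uniform on the compact sphere. *)
Lemma incr_uniform_infty :
  (forall u, S u -> forall A, exists T, A <= F u T) ->
  forall A, exists T, forall u t, S u -> T <= t -> A <= F u t.
Proof.
move=> Finf A; apply: contrapT => h.
have hk (k : nat) : exists u, S u /\ F u k%:R < A.
  apply: contrapT => hk; apply: h; exists k%:R => u t Su kt; rewrite leNgt; apply/negP => FA.
  by apply: hk; exists u; split => //; apply: le_lt_trans FA; exact: incr_le.
have [u hu] := choice hk.
have [v Sv cv] := sphere_cluster (fun k => (hu k).1).
have [T hT] := Finf v Sv (A + 1).
have [d d0 hd] := Fc T Sv ltr01.
have [k kT kv] := cv d d0 (Num.trunc `|T|).+1.
have [Su FA] := hu k.
have tt : `|T - T| < d by rewrite subrr normr0.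
have := hd _ _ Su kv tt; rewrite ltr_norml => /andP[F1 _].
have : F (u k) T <= F (u k) k%:R.
  apply: incr_le => //; apply: le_trans (ler_norm _) _.
  have /andP[_ h2] := truncn_itv (normr_ge0 T); apply: ltW; apply: lt_le_trans h2 _.
  by rewrite ler_nat.
lra.
Qed.

End Increasing.

End SphereAnalysis.

(** * Energies on the sphere and their derivatives *)

Section SphereMeasure.
Variables (R : realType) (n : nat).
Local Notation V := 'rV[R]_n.
Local Notation S := (@sphere R n).
Local Notation SB := (@sphere R n : set (Rn R n)).
Implicit Types (x y z u v w : V) (s t : R).

Lemma open_Rn (A : set V) : open A -> measurable (A : set (Rn R n)).
Proof. by move=> oA; exact: sub_sigma_algebra. Qed.

Lemma closed_Rn (A : set V) : closed A -> measurable (A : set (Rn R n)).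
Proof.
move=> cA; rewrite -[A]setCK; apply: measurableC; apply: open_Rn; exact: closed_openC.
Qed.

Lemma measurable_sphere : measurable SB.
Proof. by apply: closed_Rn; exact: closed_sphere. Qed.

Lemma sph_cont_measurable (f : V -> R) : sph_cont f ->
  measurable_fun SB (f : Rn R n -> R).
Proof.
move=> fc mS; apply: (measurability _ (RGenCInfty.measurableE R)) => //.
move=> _ [_ [a ->] <-]; apply: closed_Rn.
rewrite (_ : _ `&` _ = [set x | S x /\ a <= f x]); first exact: sph_cont_closed.
by apply/seteqP; split=> x /= -[Sx]; rewrite in_itv/= andbT.
Qed.

Variable nu : {measure set (Rn R n) -> \bar R}.
Hypothesis nufin : finite_meas nu.

Lemma finite_measE (A : set (Rn R n)) : measurable A -> nu A = (fine (nu A))%:E.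
Proof.
move=> mA; rewrite fineK// ge0_fin_numE//; apply: le_lt_trans nufin.
by apply: le_measure => //; rewrite inE.
Qed.

Lemma finite_meas_lty (A : set (Rn R n)) : measurable A -> (nu A < +oo)%E.
Proof. by move=> mA; rewrite finite_measE// ltry. Qed.

Lemma fine_meas_ge0 (A : set (Rn R n)) : 0 <= fine (nu A).
Proof. exact: fine_ge0. Qed.

Lemma fine_meas_le (A B : set (Rn R n)) : measurable A -> measurable B -> A `<=` B ->
  fine (nu A) <= fine (nu B).
Proof.
move=> mA mB AB; rewrite -lee_fin -!finite_measE//; apply: le_measure => //; by rewrite inE.
Qed.

Lemma bounded_int (A : set (Rn R n)) (f : Rn R n -> R) (B : R) : measurable A ->
  measurable_fun A f -> (forall x, A x -> `|f x| <= B) -> nu.-integrable A (EFin \o f).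
Proof.
move=> mA mf fB; apply: measurable_bounded_integrable => //; first exact: finite_meas_lty.
exists B; split; first exact: num_real.
by move=> M BM x Ax; apply: le_trans (fB x Ax) (ltW BM).
Qed.

Lemma sph_cont_bounded (f : V -> R) : sph_cont f -> exists2 B, 0 <= B & forall x, S x -> `|f x| <= B.
Proof.
move=> fc; have [|B B0 h] := @jcont_bounded R n (fun x _ => f x) 0.
  move=> u t e Su e0; have [d d0 hd] := fc u e Su e0.
  by exists d => // v s Sv vu _; exact: hd.
by exists B => // x Sx; apply: (h x 0) => //; rewrite normr0.
Qed.

Lemma sph_cont_int (A : set (Rn R n)) (f : V -> R) : measurable A -> A `<=` S -> sph_cont f ->
  nu.-integrable A (EFin \o (f : Rn R n -> R)).
Proof.
move=> mA AS fc; have [B _ hB] := sph_cont_bounded fc.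
apply: (@bounded_int A f B mA) => [|x /AS]; last exact: hB.
exact: measurable_funS measurable_sphere AS (sph_cont_measurable fc).
Qed.

Definition energy (F : V -> R -> R) (l : V -> R) : R := \int[nu]_(x in SB) F x (l x).

Lemma energy_int F (l : V -> R) : jcont F -> sph_cont l ->
  nu.-integrable SB (EFin \o ((fun x => F x (l x)) : Rn R n -> R)).
Proof.
by move=> Fc lc; apply: sph_cont_int => //; [exact: measurable_sphere|exact: jcont_comp].
Qed.

Section Energy.
Variables F F' : V -> R -> R.
Hypothesis FC : incr_C1 F F'.

Let Fc : jcont F. Proof. by case: FC. Qed.
Let mS := measurable_sphere.

Lemma energy_lipschitz (M : R) : exists2 L, 0 <= L & forall (l l' : V -> R) (eta : R),
  sph_cont l -> sph_cont l' ->
  (forall x, S x -> [/\ `|l x| <= M, `|l' x| <= M & `|l x - l' x| <= eta]) ->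
  `|energy F l - energy F l'| <= L * eta.
Proof.
have [L L0 hL] := incr_lipschitz FC M.
exists (L * fine (nu S)) => [|l l' eta lc l'c h]; first by rewrite mulr_ge0// fine_meas_ge0.
have i1 := energy_int Fc lc; have i2 := energy_int Fc l'c.
rewrite /energy -RintegralB//.
have ib := integrableB mS i1 i2.
apply: le_trans (le_normr_Rintegral mS ib) _.
rewrite mulrAC -Rintegral_cst//; apply: le_Rintegral => //.
- exact: integrable_norm.
- by apply: (@bounded_int _ _ `|L * eta|) => // x _.
- move=> x Sx; have [a b c] := h x Sx; apply: le_trans (hL x _ _ Sx a b) _.
  by rewrite ler_wpM2l.
Qed.

(** Dominated convergence, hence a sequence of parameters instead of a real one. The quotients are
    bounded by a Lipschitz constant times [M]; the null set [N] makes room for the points with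
    several normals. *)
Lemma energy_deriv (l : V -> R) (lj : nat -> V -> R) (tj : nat -> R) (w : V -> R) (M : R)
    (N : set (Rn R n)) :
  sph_cont l -> (forall j, sph_cont (lj j)) -> (forall j, 0 < tj j <= 1) ->
  tj j @[j --> \oo] --> 0 ->
  (forall j x, S x -> `|lj j x - l x| <= tj j * M) ->
  measurable N -> nu N = 0%E ->
  (forall x, S x -> ~ N x -> (lj j x - l x) / tj j @[j --> \oo] --> w x) ->
  (energy F (lj j) - energy F l) / tj j @[j --> \oo] -->
    \int[nu]_(x in SB `\` N) (F' x (l x) * w x).
Proof.
move=> lc ljc tj01 tj0 ljM mN N0 lw.
have [B B0 hB] := sph_cont_bounded lc.
have M0 x : S x -> 0 <= M.
  move=> Sx; have := le_trans (normr_ge0 _) (ljM 0%N x Sx).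
  by have /andP[t0 _] := tj01 0%N; rewrite pmulr_rge0.
have [L L0 hL] := incr_lipschitz FC (B + M).
pose D := SB `\` N; have mD : measurable D by exact: measurableD.
pose q j x := (F x (lj j x) - F x (l x)) / tj j.
have bd j x : S x -> `|q j x| <= L * M.
  move=> Sx; have /andP[t0 t1] := tj01 j.
  rewrite normrM normfV (gtr0_norm t0) ler_pdivrMr//.
  have h1 := ljM j x Sx; have h2 := hB x Sx; have h3 := M0 x Sx.
  apply: le_trans (hL x _ _ Sx _ _) _.
  - have := ler_normD (lj j x - l x) (l x); rewrite subrK; nra.
  - by lra.
  - by rewrite -mulrA ler_wpM2l// mulrC.
have qc j : sph_cont (q j).
  move=> x e Sx e0; have /andP[t0 t1] := tj01 j.
  have et : 0 < e * tj j / 2 by rewrite divr_gt0// mulr_gt0.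
  have [d d0 hd] := jcont_comp Fc (ljc j) Sx et.
  have [d' d'0 hd'] := jcont_comp Fc lc Sx et.
  exists (Num.min d d') => [|y Sy]; first by rewrite lt_min d0.
  rewrite lt_min => /andP[/(hd y Sy) h1 /(hd' y Sy) h2].
  rewrite /q -mulrBl normrM normfV (gtr0_norm t0) ltr_pdivrMr//.
  by move: h1 h2; rewrite !ltr_norml => /andP[? ?] /andP[? ?]; apply/andP; split; lra.
have qw x : D x -> q j x @[j --> \oo] --> F' x (l x) * w x.
  move=> [Sx Nx]; apply/cvgrPdist_le => e e0.
  have wx := lw x Sx Nx.
  pose A := `|F' x (l x)| + 1; have A0 : 0 < A by rewrite ltr_wpDl.
  pose C := `|M| + 1; have C0 : 0 < C by rewrite ltr_wpDl.
  have e1 : 0 < e / 2 / C by rewrite !divr_gt0.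
  have [d d0 hd] := incr_linearization FC (l x) Sx e1.
  have e2 : 0 < e / 2 / A by rewrite !divr_gt0.
  have d1 : 0 < d / C by rewrite divr_gt0.
  have near1 : \forall j \near \oo, `|w x - (lj j x - l x) / tj j| <= e / 2 / A.
    by move/cvgrPdist_le : wx; apply.
  have near2 : \forall j \near \oo, `|tj j| < d / C.
    by move/cvgr0Pnorm_lt : tj0; apply.
  near=> j.
  have /andP[t0 t1] := tj01 j.
  have h1 : `|w x - (lj j x - l x) / tj j| <= e / 2 / A by near: j.
  have h2 : `|tj j| < d / C by near: j.
  have h3 := ljM j x Sx.
  have h4 : tj j * M <= tj j * C.
    by rewrite ler_pM2l// /C (le_trans (ler_norm M))// lerDl.
  have h5 : `|lj j x - l x| < d.
    apply: le_lt_trans h3 _; apply: le_lt_trans h4 _.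
    by rewrite -ltr_pdivlMr// (le_lt_trans (ler_norm _)).
  have h6 := hd _ h5.
  (* The error consists of the error in the derivative of [l] and the linearisation error of [F];
     each is given half of [e]. *)
  have E : F' x (l x) * w x - q j x =
      F' x (l x) * (w x - (lj j x - l x) / tj j) -
      (F x (lj j x) - F x (l x) - F' x (l x) * (lj j x - l x)) / tj j.
    by rewrite /q; field; rewrite gt_eqF.
  rewrite E (splitr e); apply: le_trans (ler_normB _ _) _; apply: lerD.
    rewrite normrM; apply: (@le_trans _ _ (A * (e / 2 / A))).
      by apply: ler_pM => //; rewrite /A lerDl.
    by rewrite mulrC divfK// gt_eqF.
  rewrite normrM normfV (gtr0_norm t0) ler_pdivrMr//; apply: le_trans h6 _.
  apply: (@le_trans _ _ (e / 2 / C * (tj j * C))).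
    by rewrite ler_pM2l// (le_trans h3).
  by rewrite (_ : e / 2 / C * (tj j * C) = e / 2 * tj j)//; field; rewrite gt_eqF.
have DS : D `<=` S by move=> x [].
have key := @dominated_cvg _ _ _ nu D mD (fun j x => (q j x)%:E)
  (fun x => (F' x (l x) * w x)%:E) (fun x => (L * M)%:E).
have mq j : measurable_fun D (q j : Rn R n -> R).
  exact: measurable_funS measurable_sphere DS (sph_cont_measurable (qc j)).
have iLM : nu.-integrable D (fun _ => (L * M)%:E).
  by apply: (@bounded_int _ (fun _ => L * M) `|L * M|).
have {}key : (\int[nu]_(x in D) (q j x)%:E)%E @[j --> \oo] -->
    (\int[nu]_(x in D) (F' x (l x) * w x)%:E)%E.
  apply: key => //.
  - by move=> j; apply/measurable_EFinP.
  - by move=> x Dx; apply: cvg_EFin; [exact: nearW|exact: qw].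
  - by move=> j x /DS Sx; rewrite lee_fin bd.
(* No measurability of [w] is assumed; the limit is measurable as a pointwise limit of the
   quotients. *)
have mw : measurable_fun D ((fun x => F' x (l x) * w x) : Rn R n -> R).
  by apply: (@measurable_fun_cvg _ (Rn R n) R D (q : nat -> Rn R n -> R)) => // x Dx; exact: qw.
have fin : (\int[nu]_(x in D) (F' x (l x) * w x)%:E)%E \is a fin_num.
  apply: integrable_fin_num => //; apply: (@bounded_int _ _ (L * M)) => // x Dx.
  have h : `|q j x| @[j --> \oo] --> `|F' x (l x) * w x| by apply: cvg_norm; exact: qw.
  by apply: (@cvgr_to_le _ _ _ _ _ _ (L * M) h); apply: nearW => j; apply: bd; case: Dx.
have E j : (energy F (lj j) - energy F l) / tj j = fine (\int[nu]_(x in D) (q j x)%:E)%E.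
  have /andP[t0 _] := tj01 j.
  have i1 := energy_int Fc (ljc j); have i2 := energy_int Fc lc.
  rewrite /energy -RintegralB// -RintegralZr//; last exact: (integrableB mS i1 i2).
  rewrite /Rintegral (negligible_integral mN)//.
  exact: (sph_cont_int mS (@subset_refl _ _) (qc j)).
under eq_cvg do rewrite E.
by apply: fine_cvg; rewrite fineK.
Unshelve. all: by end_near. Qed.

End Energy.
End SphereMeasure.

(** * Slabs around great subspheres and coercivity *)

Section Coercivity.
Variables (R : realType) (n : nat).
Local Notation V := 'rV[R]_n.
Local Notation S := (@sphere R n).
Local Notation SB := (@sphere R n : set (Rn R n)).
Implicit Types (x y z u v w : V) (s t : R).

(** The integral of a nonnegative function is a supremum over the simple functions below it, so
    monotonicity holds without measurability. This serves integrals over [alpha_star] and of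
    [log_abs_dot]. *)
Lemma le_integral_nonmeasurable d (T : measurableType d) (m : {measure set T -> \bar R})
    (A B : set T) (f g : T -> \bar R) :
  (forall x : T, 0 <= (f \_ A) x)%E -> (forall x : T, (f \_ A) x <= (g \_ B) x)%E ->
  (\int[m]_(x in A) f x <= \int[m]_(x in B) g x)%E.
Proof.
move=> f0 fg; rewrite integral_mkcond [leRHS]integral_mkcond !ge0_integralTE//.
  apply: ereal_sup_le => _ [h hf <-]; exists h => // x; exact: le_trans (hf x) (fg x).
by move=> x; exact: le_trans (f0 x) (fg x).
Qed.

Lemma sph_cont_max0 (f : V -> R) : sph_cont f -> sph_cont (fun x => Num.max (f x) 0).
Proof.
move=> fc x e Sx e0; have [d d0 hd] := fc x e Sx e0; exists d => // y Sy yx.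
apply: le_lt_trans (hd y Sy yx).
by rewrite /Num.max; case: ltP => ?; case: ltP => ?; rewrite ?subrr// ler_norml;
  case: (ler0P (f y - f x)) => ?; apply/andP; split; lra.
Qed.

Definition slab w (d : R) : set V := [set u | S u /\ `|dot w u| < d].

Lemma sph_cont_abs_dot w : sph_cont (fun u => `|dot w u|).
Proof.
apply: continuous_sph => x; apply: (@cvg_norm _ _ _ _ (nbhs_filter x)); exact: dot_continuous.
Qed.

Lemma closed_coslab w d : closed [set u : V | S u /\ d <= `|dot w u|].
Proof. exact: sph_cont_closed (sph_cont_abs_dot w). Qed.

Lemma coslabE w d : [set u : V | S u /\ d <= `|dot w u|] = S `\` slab w d.
Proof.
apply/seteqP; split=> u /= [Su h]; split => //; first by rewrite /slab/= => -[_]; rewrite ltNge h.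
by rewrite leNgt; apply/negP => h'; apply: h.
Qed.

Lemma measurable_slab w d : measurable (slab w d : set (Rn R n)).
Proof.
have -> : slab w d = S `\` [set u : V | S u /\ d <= `|dot w u|].
  rewrite coslabE setDD; apply/seteqP; split=> u; first by move=> h; split => //; case: h.
  by case.
by apply: measurableD; [exact: measurable_sphere|apply: closed_Rn; exact: closed_coslab].
Qed.

Variable nu : {measure set (Rn R n) -> \bar R}.
Hypothesis nufin : finite_meas nu.

Let mS := @measurable_sphere R n.

Lemma meas_setT : on_sphere nu -> nu setT = nu SB.
Proof.
move=> nuS; rewrite -(setUv SB) measureU//; [|exact: measurableC|by rewrite setICr].
by rewrite [X in (_ + X)%E](nuS : nu (~` SB) = 0%E) adde0.
Qed.

Lemma sphere_meas_gt0 : on_sphere nu -> nonzero_meas nu -> 0 < fine (nu SB).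
Proof.
move=> nuS nu0; rewrite lt_neqAle fine_meas_ge0 andbT eq_sym; apply: contra_neq nu0 => h.
by rewrite meas_setT// finite_measE// h.
Qed.

(** If it failed, slabs of width tending to 0 around some w_k would keep almost mass kappa; around a
    cluster point v of the w_k they fit into slabs of v, and continuity from above would give the
    great subsphere of v at least mass kappa. The same [d] serves as width and as margin. *)
Lemma slab_small (kappa : R) :
  (forall w, S w -> fine (nu (S `&` perp w)) < kappa) ->
  exists2 d, 0 < d & forall w, S w -> fine (nu (slab w d)) + d <= kappa.
Proof.
move=> h; apply: contrapT => no.
have hk (k : nat) : exists w, S w /\ kappa < fine (nu (slab w k.+1%:R^-1)) + k.+1%:R^-1.
  apply: contrapT => hk; apply: no; exists k.+1%:R^-1; first by rewrite invr_gt0.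
  by move=> w Sw; rewrite leNgt; apply/negP => hw; apply: hk; exists w.
have [w hw] := choice hk.
have [v Sv cv] := sphere_cluster (fun k => (hw k).1).
have big (m : nat) : kappa - m.+1%:R^-1 <= fine (nu (slab v m.+1%:R^-1)).
  have m1 : (0 : R) < m.+1%:R^-1 by rewrite invr_gt0.
  have m2 : (0 : R) < m.+1%:R^-1 / 2 by rewrite divr_gt0.
  have [k kN kv] := cv _ m2 (2 * m.+1)%N; have [Sw hk'] := hw k.
  have k2 : k.+1%:R^-1 <= m.+1%:R^-1 / 2 :> R.
    by rewrite -invfM -natrM lef_pV2 ?posrE ?ltr0n// ler_nat mulnC leqW.
  (* Half of the width of the larger slab pays for the distance from [w k] to [v], the other half
     for the width of the smaller slab; hence the bound [2 * m.+1] on the index. *)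
  have sub : slab (w k) k.+1%:R^-1 `<=` slab v m.+1%:R^-1.
    move=> u [Su uk]; split => //.
    rewrite (splitr m.+1%:R^-1) -[v](subrK (w k)) dotDl.
    apply: le_lt_trans (ler_normD _ _) _; apply: ltrD; last exact: lt_le_trans uk k2.
    apply: le_lt_trans (cauchy_schwarz _ _) _.
    by have /sphere_enorm -> := Su; rewrite mulr1 enormB.
  have := fine_meas_le nufin (measurable_slab _ _) (measurable_slab _ _) sub.
  move: k2 m1 hk'; move: (k.+1%:R^-1) (m.+1%:R^-1) => a b; lra.
have cap : S `&` perp v = \bigcap_m slab v m.+1%:R^-1.
  apply/seteqP; split=> u.
    by move=> [Su pu] m _; split => //; rewrite pu normr0 invr_gt0.
  move=> hu; have [Su _] := hu 0%N I; split => //; rewrite /perp/=.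
  apply/eqP; rewrite -normr_le0; apply/ler_addgt0Pl => e e0; rewrite addr0.
  have [_ hm] := hu (Num.trunc e^-1) I; apply/ltW; apply: lt_le_trans hm _.
  rewrite -[leRHS]invrK lef_pV2 ?posrE ?invr_gt0 ?ltr0n//.
  by have /andP[_ /ltW] := truncn_itv (ltW (etrans (invr_gt0 e) e0)).
have mcap : measurable (\bigcap_m (slab v m.+1%:R^-1 : set (Rn R n))).
  by apply: bigcapT_measurable => m; exact: measurable_slab.
have := @nonincreasing_cvg_mu _ _ _ nu (fun m => slab v m.+1%:R^-1).
rewrite -cap; move=> /(_ (finite_meas_lty nufin (measurable_slab _ _))).
move=> /(_ (fun m => measurable_slab v m.+1%:R^-1)); rewrite cap => /(_ mcap).
have hom : {homo (fun m => slab v m.+1%:R^-1 : set (Rn R n)) : a b / (a <= b)%N >-> (b <= a)%O}.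
  move=> a b ab; apply/subsetPset => u [Su uk]; split => //; apply: lt_le_trans uk _.
  by rewrite lef_pV2 ?posrE ?ltr0n// ler_nat.
move=> /(_ hom) cvg.
have {}cvg : fine (nu (slab v m.+1%:R^-1)) @[m --> \oo] --> fine (nu (S `&` perp v)).
  apply: (@fine_cvg _ _ _ _ (fun m => nu (slab v m.+1%:R^-1))).
  by rewrite -(finite_measE nufin) cap//; exact: cvg.
have := h v Sv; rewrite ltNge => /negP; apply.
have c1 : kappa - m.+1%:R^-1 @[m --> \oo] --> kappa.
  rewrite -[X in _ --> X]subr0; apply: cvgB; first exact: cvg_cst.
  exact: cvg_harmonic.
apply: (ler_cvg_to c1 cvg); exact: nearW.
Qed.

Lemma not_concentrated_slab : not_concentrated nu ->
  exists2 d, 0 < d & forall w, S w -> d <= fine (nu (S `\` slab w d)).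
Proof.
move=> nc; have [|d d0 hd] := @slab_small (fine (nu S)).
  move=> w Sw; have mp : measurable (S `&` perp w : set (Rn R n)).
    rewrite (_ : _ `&` _ = [set u | S u /\ 0 <= - `|dot w u|]).
      apply: closed_Rn; apply: (@sph_cont_closed _ _ (fun u => - `|dot w u|)).
      move=> x e Sx e0; have [d d0 hd] := sph_cont_abs_dot w Sx e0.
      by exists d => // y Sy yx; rewrite -opprD normrN hd.
    apply/seteqP; split=> u /= [Su pu]; split => //; rewrite /perp/= in pu *.
      by rewrite pu normr0 oppr0.
    by apply/eqP; rewrite -normr_le0 -oppr_ge0.
  have := nc w Sw; rewrite (_ : S `\` perp w = S `\` (S `&` perp w)); last first.
    by rewrite setDIr setDv set0U.
  rewrite measureD//; last exact: finite_meas_lty.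
  rewrite (_ : S `&` (S `&` perp w) = S `&` perp w) ?setIA ?setIid//.
  by rewrite sube_gt0 -lte_fin -!(finite_measE nufin).
exists d => // w Sw; have := hd w Sw.
rewrite measureD//; [|exact: measurable_slab|exact: finite_meas_lty].
rewrite setIC setIidl; last by move=> u [].
have fn (A : set (Rn R n)) : measurable A -> nu A \is a fin_num.
  by move=> mA; rewrite ge0_fin_numE// finite_meas_lty.
rewrite fineB ?fn//; [lra|exact: measurable_slab].
Qed.

Section Increasing.
Variables F F' : V -> R -> R.
Hypothesis FC : incr_C1 F F'.
Let Fc : jcont F. Proof. by case: FC. Qed.

(** Off a slab of fixed width d the function [l] is at least T + ln d, and by
    [not_concentrated_slab] that region has mass at least d whatever w is. The lower bound [- B]
    controls the slab itself. *)
Lemma coercive_of_blowup (B : R) : not_concentrated nu ->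
  (forall u, S u -> forall A, exists T, A <= F u T) ->
  forall b, exists T, forall w (l : V -> R), S w -> sph_cont l ->
    (forall u, S u -> dot w u != 0 -> ln `|dot w u| + T <= l u) ->
    (forall u, S u -> - B <= F u (l u)) -> b <= energy nu F l.
Proof.
move=> nc Finf b; have [d d0 hd] := not_concentrated_slab nc.
(* At this level [F + B] times the mass [d] already reaches [b + B * fine (nu S)]; below, [- ln d]
   compensates the factor [|dot w u| >= d]. *)
have [TA hTA] := incr_uniform_infty FC Finf (`|b + B * fine (nu S)| / d - B).
exists (TA - ln d) => w l Sw lc lT lB.
pose E := S `\` slab w d.
have mE : measurable (E : set (Rn R n)) by apply: measurableD => //; exact: measurable_slab.
have ES : E `<=` S by move=> u [].
have i1 := energy_int nufin Fc lc.
have iB : nu.-integrable SB (EFin \o ((fun=> B) : Rn R n -> R)).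
  by apply: (@bounded_int _ _ _ nufin _ (fun=> B) `|B|).
rewrite -(lerD2r (B * fine (nu S))) /energy -Rintegral_cst// -RintegralD//.
apply: (@le_trans _ _ (\int[nu]_(x in (E : set (Rn R n))) (`|b + B * fine (nu S)| / d))).
  rewrite Rintegral_cst// Rintegral_cst// mulrAC ler_pdivlMr//.
  apply: (@le_trans _ _ (`|b + B * fine (nu S)| * d)); first by rewrite ler_pM2r// ler_norm.
  by rewrite ler_wpM2l// hd.
have iD := integrableD mS i1 iB.
have iDE : nu.-integrable (E : set (Rn R n)) (EFin \o ((fun x => F x (l x) + B) : Rn R n -> R)).
  exact: integrableS mS mE ES iD.
apply: (@le_trans _ _ (\int[nu]_(x in (E : set (Rn R n))) (F x (l x) + B))).
  apply: le_Rintegral => //.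
    by apply: (@bounded_int _ _ _ nufin _ (fun=> _) (`| (`|b + B * fine (nu S)| / d) |)).
  move=> u [Su nu_]; rewrite -lerBlDr; apply: hTA => //.
  have du : d <= `|dot w u| by rewrite leNgt; apply/negP => h; apply: nu_.
  have u0 : dot w u != 0 by rewrite -normr_gt0 (lt_le_trans d0).
  apply: le_trans (lT u Su u0); rewrite addrCA lerDl subr_ge0.
  by rewrite ler_ln ?posrE// normr_gt0.
rewrite /Rintegral fine_le//.
- exact: integrable_fin_num.
- exact: integrable_fin_num.
apply: ge0_subset_integral => //.
- by case/integrableP : iD.
- by move=> u Su; rewrite lee_fin -lerBlDr sub0r lB.
Qed.

(** [F] may be bounded, so the energy need not tend to infinity. Still, [F] gains a uniform amount k
    > 0 between 0 and 1, and since great subspheres are null the region where [l < 1] can be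
    confined to a slab so thin that the loss there costs at most half of the total gain. *)
Lemma coercive_of_vanishing (m : R) : on_sphere nu -> nonzero_meas nu -> vanishes_great nu ->
  exists a T, energy nu F (fun=> 0) < a /\ forall w (l : V -> R), S w -> sph_cont l ->
    (forall u, S u -> dot w u != 0 -> ln `|dot w u| + T <= l u) ->
    (forall u, S u -> m <= l u) -> a <= energy nu F l.
Proof.
move=> nuS nu0 nv.
have nuSpos := sphere_meas_gt0 nuS nu0.
have S0 : S !=set0.
  by apply/set0P; apply: contraTneq nuSpos => ->; rewrite measure0 ltxx.
have cc (c : R) : sph_cont (fun _ : V => c).
  by move=> x e Sx e0; exists 1 => // y _ _; rewrite subrr normr0.
have dc : sph_cont (fun u => F u 1 - F u 0).
  apply/sph_contP; apply/subspace_continuousP => u Su.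
  apply: (@cvgB _ _ _ _ (within_filter _ (nbhs_filter u))).
    by have /sph_contP/subspace_continuousP := jcont_comp Fc (cc 1); exact.
  by have /sph_contP/subspace_continuousP := jcont_comp Fc (cc 0); exact.
have [u0 Su0 hu0] := sph_cont_min dc (@closed_sphere R n) (@subset_refl _ _) S0.
pose k := F u0 1 - F u0 0.
have k0 : 0 < k by rewrite subr_gt0; apply: (incr_lt FC).
have [B B0 hB] := jcont_bounded (Num.max `|m| 0) Fc.
have Bm u : S u -> F u 0 - 2 * B <= F u m.
  move=> Su; have := hB u m Su; have := hB u 0 Su.
  rewrite !le_max normr0 !lexx orbT => /(_ isT) h1 /(_ isT) h2.
  by move: h1 h2; rewrite !ler_norml => /andP[? ?] /andP[? ?]; lra.
(* On the slab the gain [k] is missing and up to [2 * B] is lost relative to [F u 0], so [D] times a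
   slab mass below [kap] is at most half of [k * fine (nu S)]. *)
pose D := k + 2 * B; have D0 : 0 < D by rewrite ltr_pwDl// mulr_ge0.
pose kap := k * fine (nu S) / 2 / D.
have kap0 : 0 < kap by rewrite !divr_gt0// mulr_gt0.
have [|d d0 hd] := @slab_small kap.
  by move=> w Sw; rewrite nv.
exists (energy nu F (fun=> 0) + k * fine (nu S) / 2), (1 - ln d); split.
  by rewrite ltrDl divr_gt0// mulr_gt0.
move=> w l Sw lc lT lm.
pose A : set (Rn R n) := slab w d.
have mA : measurable A by exact: measurable_slab.
have AS : A `<=` S by move=> u [].
have i1 := energy_int nufin Fc lc.
have i0 := energy_int nufin Fc (cc 0).
pose g (u : Rn R n) : R := k - D * \1_A u.
have ik : nu.-integrable SB (EFin \o ((fun=> k) : Rn R n -> R)).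
  by apply: (@bounded_int _ _ _ nufin _ (fun=> k) `|k|).
have m1 : measurable_fun SB (\1_A : Rn R n -> R) by exact: measurable_indic.
have iA1 : nu.-integrable SB (EFin \o (\1_A : Rn R n -> R)).
  apply: (@bounded_int _ _ _ nufin _ _ 1) => // x _; rewrite indicE.
  by case: (_ \in _); rewrite ?normr1 ?normr0.
have iA : nu.-integrable SB (EFin \o ((fun u => D * \1_A u) : Rn R n -> R)).
  exact: (integrableZl mS D iA1).
have ig := integrableB mS ik iA.
have Eg : \int[nu]_(u in SB) g u = k * fine (nu S) - D * fine (nu A).
  rewrite /g RintegralB// Rintegral_cst// RintegralZl//; congr (_ - _ * _).
  rewrite /Rintegral integral_indic//; congr (fine (nu _)); exact/setIidl.
apply: (@le_trans _ _ (energy nu F (fun=> 0) + \int[nu]_(u in SB) g u)).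
  rewrite Eg lerD2l.
  have : D * fine (nu A) <= D * kap by rewrite ler_pM2l// (le_trans _ (hd w Sw))// lerDl ltW.
  by rewrite (_ : D * kap = k * fine (nu S) / 2); [lra|rewrite /kap mulrC divfK ?gt_eqF].
rewrite /energy -RintegralD//; apply: le_Rintegral => //; first exact: (integrableD mS i0 ig).
move=> u Su; rewrite /g indicE; have [uA|uA] := boolP (u \in A).
  rewrite mulr1 /D; have := Bm u Su; have := incr_le FC Su (lm u Su); lra.
rewrite mulr0 subr0.
have du : d <= `|dot w u|.
  by rewrite leNgt; apply/negP => h; move/negP : uA; apply; rewrite inE.
have wu : dot w u != 0 by rewrite -normr_gt0 (lt_le_trans d0).
have l1 : 1 <= l u.
  apply: le_trans (lT u Su wu); rewrite addrCA lerDl subr_ge0.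
  by rewrite ler_ln ?posrE// normr_gt0.
have := incr_le FC Su l1; have := hu0 u Su; rewrite -/k; lra.
Qed.

End Increasing.

(* The bound on the logarithmic potential is what replaces divergence of F at infinity
   for the linear integrand F u t = t. *)
Lemma coercive_log (C : R) : on_sphere nu -> nonzero_meas nu ->
  (C%:E < ereal_inf [set (\int[nu]_(xi in SB) log_abs_dot v xi)%E | v in S])%E ->
  forall b, exists T, forall w (l : V -> R), S w -> sph_cont l ->
    (forall u, S u -> dot w u != 0 -> ln `|dot w u| + T <= l u) -> b <= energy nu (fun=> id) l.
Proof.
move=> nuS nu0 hC b.
have nuSpos := sphere_meas_gt0 nuS nu0.
pose T := (b - C) / fine (nu S).
exists T => w l Sw lc lT.
have il := sph_cont_int nufin mS (@subset_refl _ _) lc.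
have hw : (C%:E <= \int[nu]_(xi in SB) log_abs_dot w xi)%E.
  by apply: le_trans (ltW hC) _; apply: ereal_inf_lbound; exists w.
(* [l >= T - g], and 0 <= g <= -ln |w.u| bounds the integral of g by [- C]. Hence the integral of l
   is at least T nu(S) + C, which the choice of [T] makes equal to b. *)
pose g u := Num.max (T - l u) 0.
have gc : sph_cont g.
  apply: sph_cont_max0 => x e Sx e0; have [d d0 hd] := lc x e Sx e0.
  exists d => // y Sy yx; rewrite (_ : T - l y - (T - l x) = - (l y - l x)); last by ring.
  by rewrite normrN hd.
have g0 u : 0 <= g u by rewrite /g le_max lexx orbT.
have ig := sph_cont_int nufin mS (@subset_refl _ _) gc.
have gC : \int[nu]_(u in SB) g u <= - C.
  rewrite -lee_fin /Rintegral fineK; last exact: integrable_fin_num.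
  have log0 u : S u -> (0 <= - log_abs_dot w u)%E.
    move=> Su; rewrite /log_abs_dot; case: ifPn => // wu.
    rewrite -EFinN lee_fin oppr_ge0 ln_le0//; have := abs_dot_sphere u Sw.
    by have /sphere_enorm -> := Su.
  have E : (\int[nu]_(u in SB) log_abs_dot w u = - \int[nu]_(u in SB) - log_abs_dot w u)%E.
    by rewrite -integral_ge0N//; apply: eq_integral => u _; rewrite oppeK.
  move: hw; rewrite E leeNr -EFinN => /(le_trans _); apply.
  apply: le_integral_nonmeasurable => u; rewrite !patchE; case: ifPn => // /set_mem Su.
    by rewrite lee_fin.
  rewrite /log_abs_dot; case: ifPn => [_|wu]; first by rewrite leey.
  rewrite -EFinN lee_fin /g ge_max; apply/andP; split.
    by have := lT u Su wu; lra.
  rewrite oppr_ge0 ln_le0//; have := abs_dot_sphere u Sw.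
  by have /sphere_enorm -> := Su.
have iT : nu.-integrable SB (EFin \o ((fun=> T) : Rn R n -> R)).
  by apply: (@bounded_int _ _ _ nufin _ (fun=> T) `|T|).
apply: (@le_trans _ _ (\int[nu]_(u in SB) (T - g u))).
  rewrite RintegralB// Rintegral_cst// /T divfK ?gt_eqF//; lra.
apply: le_Rintegral => //; first exact: (integrableB mS iT ig).
by move=> u Su; rewrite lerBlDr -lerBlDl /g le_max lexx.
Qed.

End Coercivity.

(** * Existence of a maximiser *)

Section Compactness.
Variables (R : realType) (n : nat).
Local Notation V := 'rV[R]_n.
Local Notation S := (@sphere R n).
Implicit Types (x y z u v w : V) (s t : R).

Lemma sphere_net (r : R) : 0 < r ->
  exists s : seq V, forall x, S x -> exists2 y, y \in s & enorm (x - y) < r.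
Proof.
move=> r0; have := @compact_sphere R n; rewrite compact_cover.
move=> /(_ V S (fun y => [set x | enorm (x - y) < r])) [||D _ hD].
- move=> y _; apply/open_enormP => x xy; exists (r - enorm (x - y)); first by rewrite subr_gt0.
  move=> z; rewrite ltrBrDr => h; apply: le_lt_trans h.
  by rewrite (le_trans _ (enormD _ _))// addrA subrK.
- by move=> x Sx; exists x => //=; rewrite subrr enorm0.
by exists (finmap.enum_fset D) => x /hD[y /= yD xy]; exists y.
Qed.

(** Blaschke selection for norms. Tychonoff's theorem on the intervals [c1 |x|, c2 |x|] yields a
    pointwise cluster point; the norm axioms involve at most three points and pass to it, and the
    common Lipschitz constant makes closeness on a finite net uniform on the sphere. *)
Lemma norm_cluster (c1 c2 : R) (g : nat -> V -> R) : (forall k, is_norm c1 c2 (g k)) ->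
  exists2 f, is_norm c1 c2 f & forall e, 0 < e -> forall N : nat,
    exists2 k, (N <= k)%N & forall x, S x -> `|g k x - f x| < e.
Proof.
move=> gN; have c10 := is_norm_gt0 (gN 0%N); have c20 := is_norm_gt0r (gN 0%N).
pose A (x : V) : set R := `[c1 * enorm x, c2 * enorm x]%classic.
have cA := @tychonoff V (fun=> R) A (fun x => @segment_compact R _ _).
have gA : (g @ \oo) [set f : forall x : V, R | forall x, A x (f x)].
  exists 0%N => // k _ x; rewrite /A/= in_itv/=.
  by rewrite (is_norm_ge (gN k)) (is_norm_le (gN k)).
have [f [fA fcl]] := cA (g @ \oo) _ gA.
(* A neighbourhood in the product topology controls finitely many points at once. *)
have pts (s : seq V) (e : R) (N : nat) : 0 < e ->
    exists2 k, (N <= k)%N & forall x, x \in s -> `|g k x - f x| < e.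
  move=> e0.
  have nU : nbhs f [set h : forall x : V, R | forall x, x \in s -> `|h x - f x| < e].
    elim: s => [|x s IH]; first exact: filterS filterT.
    have nx : nbhs f [set h : forall x : V, R | `|h x - f x| < e].
      have fx : nbhs (f x : R) [set r : R | `|r - f x| < e].
        by have := nbhsx_ballx (f x : R) _ e0; apply: filterS => r; rewrite /ball/= distrC.
      exact: (@proj_continuous V (fun=> R) x f _ fx).
    apply: filterS (filterI nx IH) => h [h1 h2] y; rewrite inE => /predU1P[->|/h2] //.
  have [|h [[k Nk <-] hU]] := fcl (g @` [set k | (N <= k)%N]) _ _ nU.
    by exists N => // k Nk; exists k.
  by exists k.
have fN : is_norm c1 c2 f.
  split.
  - by case: (gN 0%N).
  - move=> x y; apply/ler_addgt0Pl => e e0.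
    have e3 : 0 < e / 3 by rewrite divr_gt0.
    have [k _ hk] := pts [:: x; y; x + y] (e / 3) 0%N e3.
    have := hk x; have := hk y; have := hk (x + y); rewrite !inE !eqxx !orbT => /(_ isT) h1 /(_ isT) h2 /(_ isT) h3.
    have := is_normD (gN k) x y.
    by move: h1 h2 h3; rewrite !ltr_norml => /andP[? ?] /andP[? ?] /andP[? ?]; lra.
  - move=> t x; apply/eqP; rewrite -subr_eq0 -normr_le0; apply/ler_addgt0Pl => e e0.
    have t1 : 0 < 1 + `|t| by rewrite ltr_pwDl.
    have e3 : 0 < e / (1 + `|t|) by rewrite divr_gt0.
    have [k _ hk] := pts [:: x; t *: x] _ 0%N e3.
    have := hk x; have := hk (t *: x); rewrite !inE !eqxx !orbT => /(_ isT) h1 /(_ isT) h2.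
    rewrite addr0 (_ : f (t *: x) - `|t| * f x = `|t| * (g k x - f x) - (g k (t *: x) - f (t *: x))).
      apply: le_trans (ler_normB _ _) _; rewrite normrM normr_id.
      rewrite (_ : e = `|t| * (e / (1 + `|t|)) + e / (1 + `|t|)); last first.
        by field; rewrite gt_eqF.
      by apply: lerD; [rewrite ler_wpM2l// ltW|exact: ltW].
    by rewrite (is_normZ (gN k)); ring.
  - by move=> x; have := fA x; rewrite /A/= in_itv.
exists f => // e e0 N.
(* Mesh e / (4 c2): passing to a net point costs e / 4 for each of the two norms, and the error at
   the net point is below e / 2. *)
have c3 : 0 < 4 * c2 by rewrite mulr_gt0.
have [s hs] := sphere_net (divr_gt0 e0 c3).
have [k Nk hk] := pts s _ N (divr_gt0 e0 (ltr0n R 2 : 0 < 2)).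
exists k => // x Sx; have [y ys xy] := hs x Sx.
have h1 := hk y ys; have h2 := is_norm_dist (gN k) x y; have h3 := is_norm_dist fN x y.
move: xy; rewrite ltr_pdivlMr// => xy.
move: h1 h2 h3; rewrite ltr_norml !ler_norml => /andP[? ?] /andP[? ?] /andP[? ?].
by rewrite ltr_norml; apply/andP; split; lra.
Qed.

End Compactness.

Section Maximiser.
Variables (R : realType) (n : nat).
Local Notation V := 'rV[R]_n.
Local Notation S := (@sphere R n).
Implicit Types (x y z u v w : V) (s t : R) (f g : V -> R).

Lemma sph_cont_ln f : sph_cont f -> (forall x, S x -> 0 < f x) -> sph_cont (fun x => ln (f x)).
Proof.
move=> fc f0 x e Sx e0; have /cvgrPdist_lt/(_ e e0) := continuous_ln (f0 x Sx).
move=> /nbhs_ballP[d /= d0 hd]; have [d' d'0 hd'] := fc x d Sx d0.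
exists d' => // y Sy yx; rewrite distrC; apply: hd; rewrite /ball/= distrC; exact: hd'.
Qed.

Lemma sph_cont_ln_norm c1 c2 g : is_norm c1 c2 g -> sph_cont (fun x => ln (g x)).
Proof.
move=> gN; apply: sph_cont_ln; first exact/continuous_sph/(is_norm_continuous gN).
exact: is_norm_sphere_gt0 gN.
Qed.

Lemma ln_norm_bound c1 c2 g x : is_norm c1 c2 g -> S x -> `|ln (g x)| <= `|ln c1| + `|ln c2|.
Proof.
move=> gN Sx; have /andP[a b] := is_norm_sphere gN Sx.
have c10 := is_norm_gt0 gN; have c20 := is_norm_gt0r gN; have g0 := is_norm_sphere_gt0 gN Sx.
have h1 : ln c1 <= ln (g x) by rewrite ler_ln.
have h2 : ln (g x) <= ln c2 by rewrite ler_ln.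
have h3 := ler_norm (- ln c1); have h4 := ler_norm (ln c2); rewrite normrN in h3.
have h5 := normr_ge0 (ln c1); have h6 := normr_ge0 (ln c2).
by apply/ler_normlP; split; lra.
Qed.

Lemma ln_le_scale (a b eta : R) : 0 < a -> 0 < b -> 0 <= eta -> a <= (1 + eta) * b ->
  ln a - ln b <= eta.
Proof.
move=> a0 b0 eta0 ab; have e1 : 0 < 1 + eta by rewrite ltr_pwDl.
have : ln a <= ln ((1 + eta) * b) by rewrite ler_ln ?posrE// mulr_gt0.
rewrite lnM ?posrE//; have : ln (1 + eta) <= eta.
  by apply: le_ln1Dx; rewrite (lt_le_trans _ eta0).
lra.
Qed.

(** As the norms are at least [c1] on the sphere, the error [eta * c1] amounts to a factor
    [1 + eta]. Such factors pass to the dual norms with the roles exchanged, and ln (1 + eta) <=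
    eta. *)
Lemma norm_close c1 c2 f g eta : is_norm c1 c2 f -> is_norm c1 c2 g -> 0 <= eta ->
  (forall x, S x -> `|g x - f x| <= eta * c1) ->
  forall u, S u -> `|ln (g u) - ln (f u)| <= eta /\ `|ln (dual g u) - ln (dual f u)| <= eta.
Proof.
move=> fN gN eta0 gf.
have e1 : 0 <= 1 + eta by rewrite addr_ge0.
have scale p q : is_norm c1 c2 p -> is_norm c1 c2 q ->
    (forall x, S x -> `|p x - q x| <= eta * c1) -> forall x, p x <= (1 + eta) * q x.
  move=> pN qN pq x; have [->|x0] := eqVneq x 0; first by rewrite (is_norm0 pN) (is_norm0 qN) mulr0.
  have Sx := sphere_normalize x0; have ex := enorm_gt0 x0.
  have := pq _ Sx; have /andP[q1 _] := is_norm_sphere qN Sx.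
  rewrite (is_normZ pN) (is_normZ qN) in q1 *; rewrite gtr0_norm ?invr_gt0// in q1 *.
  rewrite ler_norml => /andP[_ h].
  rewrite -(ler_pM2l (_ : 0 < (enorm x)^-1)) ?invr_gt0// mulrCA mulrDl mul1r.
  have := ler_wpM2l eta0 q1; lra.
have fg x : S x -> `|f x - g x| <= eta * c1 by move=> Sx; rewrite distrC gf.
have dscale p q : is_norm c1 c2 p -> is_norm c1 c2 q ->
    (forall x, p x <= (1 + eta) * q x) -> forall u, dual q u <= (1 + eta) * dual p u.
  move=> pN qN pq u; apply: (support_le (ball_between_unit qN)) => x qx.
  apply: le_trans (ler_norm _) _; apply: le_trans (abs_dot_dual pN u x) _.
  rewrite mulrC; apply: ler_wpM2r; first exact: is_norm_ge0 (dual_norm pN) u.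
  by apply: le_trans (pq x) _; rewrite ler_piMr.
move=> u Su.
have f0 := is_norm_sphere_gt0 fN Su; have g0 := is_norm_sphere_gt0 gN Su.
have df0 := is_norm_sphere_gt0 (dual_norm fN) Su.
have dg0 := is_norm_sphere_gt0 (dual_norm gN) Su.
have h1 := scale f g fN gN fg; have h2 := scale g f gN fN gf.
have h3 := dscale g f gN fN h2 u; have h4 := dscale f g fN gN h1 u.
by split; apply/ler_normlP; split; rewrite ?opprB; apply: ln_le_scale.
Qed.

Variables lam mu : {measure set (Rn R n) -> \bar R}.
Hypothesis lamfin : finite_meas lam.
Hypothesis mufin : finite_meas mu.
Variables psi psi' gam gam' : V -> R -> R.
Hypothesis psiC : incr_C1 psi psi'.
Hypothesis gamC : incr_C1 gam gam'.

Definition dual_energy g := energy mu psi (fun u => ln (dual g u)).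
Definition radial_energy g := energy lam gam (fun x => ln (g x)).
Local Notation P := dual_energy.
Local Notation Q := radial_energy.

Lemma energies_close c1 c2 : exists2 L, 0 <= L & forall f g eta,
  is_norm c1 c2 f -> is_norm c1 c2 g -> 0 <= eta ->
  (forall x, S x -> `|g x - f x| <= eta * c1) ->
  `|P g - P f| <= L * eta /\ `|Q g - Q f| <= L * eta.
Proof.
have [L1 L10 h1] := energy_lipschitz mufin psiC (`|ln c2^-1| + `|ln c1^-1|).
have [L2 L20 h2] := energy_lipschitz lamfin gamC (`|ln c1| + `|ln c2|).
exists (L1 + L2) => [|f g eta fN gN eta0 gf]; first exact: addr_ge0.
have cl := norm_close fN gN eta0 gf; split.
  apply: (@le_trans _ _ (L1 * eta)); last by rewrite ler_wpM2r// lerDl.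
  apply: h1; [exact: sph_cont_ln_norm (dual_norm gN)|exact: sph_cont_ln_norm (dual_norm fN)|].
  move=> x Sx; split; [exact: ln_norm_bound (dual_norm gN) Sx|exact: ln_norm_bound (dual_norm fN) Sx|].
  by have [] := cl x Sx.
apply: (@le_trans _ _ (L2 * eta)); last by rewrite ler_wpM2r// lerDr.
apply: h2; [exact: sph_cont_ln_norm gN|exact: sph_cont_ln_norm fN|].
move=> x Sx; split; [exact: ln_norm_bound gN Sx|exact: ln_norm_bound fN Sx|].
by have [] := cl x Sx.
Qed.

Lemma energies_bounded c1 c2 : exists2 C, 0 <= C & forall g, is_norm c1 c2 g ->
  `|P g| <= C /\ `|Q g| <= C.
Proof.
have [L1 L10 h1] := energy_lipschitz mufin psiC (`|ln c2^-1| + `|ln c1^-1|).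
have [L2 L20 h2] := energy_lipschitz lamfin gamC (`|ln c1| + `|ln c2|).
set M1 := (_ + _) in h1; set M2 := (_ + _) in h2.
have M10 : 0 <= M1 by rewrite addr_ge0.
have M20 : 0 <= M2 by rewrite addr_ge0.
have cc : sph_cont (fun _ : V => 0 : R).
  by move=> x e Sx e0; exists 1 => // y _ _; rewrite subrr normr0.
exists ((L1 * M1 + `|energy mu psi (fun=> 0)|) + (L2 * M2 + `|energy lam gam (fun=> 0)|)).
  by rewrite !addr_ge0// mulr_ge0.
move=> g gN; split.
  have := h1 (fun u => ln (dual g u)) (fun=> 0) M1 (sph_cont_ln_norm (dual_norm gN)) cc.
  move=> h; apply: (@le_trans _ _ (L1 * M1 + `|energy mu psi (fun=> 0)|)); last first.
    by rewrite lerDl addr_ge0// mulr_ge0.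
  rewrite -lerBlDr; apply: le_trans (lerB_dist _ _) _; apply: h => x Sx.
  by rewrite subr0 normr0; split => //; exact: ln_norm_bound (dual_norm gN) Sx.
have := h2 (fun u => ln (g u)) (fun=> 0) M2 (sph_cont_ln_norm gN) cc.
move=> h; apply: (@le_trans _ _ (L2 * M2 + `|energy lam gam (fun=> 0)|)); last first.
  by rewrite lerDr addr_ge0// mulr_ge0.
rewrite -lerBlDr; apply: le_trans (lerB_dist _ _) _; apply: h => x Sx.
by rewrite subr0 normr0; split => //; exact: ln_norm_bound gN Sx.
Qed.

Variables (a b c1 c2 : R).
Hypothesis bounds : forall d1 d2 g, is_norm d1 d2 g -> P g < a -> Q g < b -> is_norm c1 c2 g.

(* Maximising a product keeps both constraints strict at the maximiser, so no Lagrange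
   multiplier rule is needed. *)
Lemma maximiser_exists d1 d2 g1 : is_norm d1 d2 g1 -> P g1 < a -> Q g1 < b ->
  exists g0, [/\ is_norm c1 c2 g0, P g0 < a, Q g0 < b &
    forall d1 d2 g, is_norm d1 d2 g -> P g < a -> Q g < b ->
      (a - P g) * (b - Q g) <= (a - P g0) * (b - Q g0)].
Proof.
move=> g1N' g1a g1b; have g1N := bounds g1N' g1a g1b.
have c10 := is_norm_gt0 g1N.
have [C C0 hC] := energies_bounded c1 c2.
have [L L0 hL] := energies_close c1 c2.
pose feas g := [/\ is_norm c1 c2 g, P g < a & Q g < b].
pose W g := (a - P g) * (b - Q g).
pose D := `|a| + `|b| + C + 1.
have D0 : 0 < D by rewrite ltr_wpDl// !addr_ge0.
have bd g : feas g -> [/\ 0 < a - P g, a - P g <= D, 0 < b - Q g & b - Q g <= D].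
  move=> [gN ga gb]; rewrite !subr_gt0; have [h1 h2] := hC g gN.
  have h3 := ler_norm a; have h4 := ler_norm b.
  have h5 := normr_ge0 a; have h6 := normr_ge0 b.
  move: h1 h2; rewrite !ler_norml => /andP[? ?] /andP[? ?]; rewrite /D; split => //; lra.
pose A := [set W g | g in feas].
have supA : has_sup A.
  split; first by exists (W g1), g1.
  exists (D * D) => _ [g /bd[h1 h2 h3 h4] <-]; apply: ler_pM => //; exact: ltW.
pose M := sup A.
have M0 : 0 < M.
  apply: (@lt_le_trans _ _ (W g1)); first by rewrite mulr_gt0 ?subr_gt0.
  by apply: ub_le_sup; [case: supA|exists g1].
have hj (j : nat) : exists g, feas g /\ M - j.+1%:R^-1 < W g.
  have j0 : (0 : R) < j.+1%:R^-1 by rewrite invr_gt0.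
  by have [_ [g fg <-] h] := sup_adherent j0 supA; exists g.
have [g hg] := choice hj.
have gN j : is_norm c1 c2 (g j) by have [[]] := hg j.
have [f fN hf] := norm_cluster gN.
have L1 : 0 < L + 1 by rewrite ltr_wpDl.
have near (d : R) (N : nat) : 0 < d -> exists2 j, (N <= j)%N &
    `|P (g j) - P f| <= d /\ `|Q (g j) - Q f| <= d.
  move=> d0; have e0 : 0 < d / (L + 1) by rewrite divr_gt0.
  have [j Nj h] := hf _ (mulr_gt0 e0 c10) N; exists j => //.
  have [|h1 h2] := hL f (g j) _ fN (gN j) (ltW e0); first by move=> x Sx; exact/ltW/h.
  have E : L * (d / (L + 1)) <= d.
    rewrite mulrA ler_pdivrMr// mulrC ler_pM2l//; lra.
  by split; [exact: le_trans h1 E|exact: le_trans h2 E].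
have fa : P f <= a.
  apply/ler_addgt0Pl => d d0; have [j _ [h _]] := near d 0%N d0.
  by have [[_ ? _] _] := hg j; move: h; rewrite ler_norml => /andP[? ?]; lra.
have fb : Q f <= b.
  apply/ler_addgt0Pl => d d0; have [j _ [_ h]] := near d 0%N d0.
  by have [[_ _ ?] _] := hg j; move: h; rewrite ler_norml => /andP[? ?]; lra.
have WM : M <= W f.
  apply/ler_addgt0Pl => e e0.
  (* The error is split: 1 / (j + 1) <= e / 2 comes from the supremum, and 2 d D = e / 2 from
     changing both factors, each at most [D], by at most d = e / (4 D). *)
  pose N := Num.trunc (2 / e).
  have d0 : 0 < e / (4 * D) by rewrite divr_gt0// mulr_gt0.
  have [j Nj [h1 h2]] := near _ N d0.
  have [fg hW] := hg j; have [p1 p2 p3 p4] := bd _ fg.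
  have jN : j.+1%:R^-1 <= e / 2.
    rewrite -[leRHS]invrK lef_pV2 ?posrE ?invr_gt0 ?divr_gt0 ?ltr0n// invf_div.
    have /andP[_ h] := truncn_itv (ltW (divr_gt0 (ltr0n R 2 : 0 < 2) e0)).
    by apply: ltW; apply: lt_le_trans h _; rewrite ler_nat.
  have E : e / (4 * D) * D = e / 4 by field; rewrite gt_eqF.
  move: hW jN; move: (j.+1%:R^-1) => r hW jN.
  move: h1 h2 d0 E; set d := e / (4 * D); rewrite !ler_norml => /andP[h1 h1'] /andP[h2 h2'] d0 E.
  have q1 : 0 <= a - P f by rewrite subr_ge0.
  have q2 : 0 <= b - Q f by rewrite subr_ge0.
  have key : W (g j) <= W f + 2 * (d * D).
    rewrite /W; move: p1 p2 p3 p4 q1 q2 h1 h1' h2 h2' d0 D0; clear.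
    move: (P (g j)) (Q (g j)) (P f) (Q f) => x y z t.
    move=> p1 p2 p3 p4 q1 q2 h1 h1' h2 h2' d0 D0.
    (* If a factor is at most [d], the product is at most [d * D]. Otherwise both factors stay
       positive after subtracting [d], and the products can be compared factor by factor. *)
    have [xd|xd] := leP (a - x) d.
      have : (a - x) * (b - y) <= d * D by apply: ler_pM => //; exact: ltW.
      have : 0 <= (a - z) * (b - t) by rewrite mulr_ge0.
      have : 0 <= d * D by exact: mulr_ge0 (ltW d0) (ltW D0).
      lra.
    have [yd|yd] := leP (b - y) d.
      have : (b - y) * (a - x) <= d * D by apply: ler_pM => //; exact: ltW.
      have : 0 <= (a - z) * (b - t) by rewrite mulr_ge0.
      have : 0 <= d * D by exact: mulr_ge0 (ltW d0) (ltW D0).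
      rewrite (mulrC (b - y)); lra.
    have : (a - x - d) * (b - y - d) <= (a - z) * (b - t) by apply: ler_pM; lra.
    have : d * (a - x) <= d * D by rewrite ler_pM2l.
    have : d * (b - y) <= d * D by rewrite ler_pM2l.
    have := sqr_ge0 d; rewrite expr2; lra.
  lra.
have Wf : 0 < W f by exact: lt_le_trans WM.
(* The constraints pass to the limit only as weak inequalities; positivity of the maximal product
   makes them strict. *)
have [fa' fb'] : P f < a /\ Q f < b.
  split.
    rewrite lt_neqAle fa andbT; apply: contraTneq Wf => E.
    by rewrite /W E subrr mul0r ltxx.
  rewrite lt_neqAle fb andbT; apply: contraTneq Wf => E.
  by rewrite /W E subrr mulr0 ltxx.
exists f; split => // e1 e2 h hN ha hb; apply: le_trans WM.
apply: ub_le_sup; first by case: supA.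
by exists h => //; split => //; exact: bounds hN ha hb.
Qed.

End Maximiser.

(** * The first-order condition *)

Section FirstOrder.
Variables (R : realType) (n : nat).
Local Notation V := 'rV[R]_n.
Local Notation S := (@sphere R n).
Local Notation SB := (@sphere R n : set (Rn R n)).
Implicit Types (x y z u v w : V) (s t : R).

(** The outer unit normals of the unit ball at x / g(x), as [alpha_set_unit_ball] shows, written as
    the equality case of the duality inequality. *)
Definition norming (g : V -> R) x : set V := [set v | S v /\ dot v x = dual g v * g x].
Definition gauss (g : V -> R) x : V := xget 0 (norming g x).

(** The pairs (i, k) are coded by natural numbers so that the union is a countable one over
    [nat]. *)
Definition singular_piece (g : V -> R) (j : nat) : set V :=
  if unpickle j is Some (i, k) then singular g i k `&` S else set0.
Definition singular_set (g : V -> R) : set V := \bigcup_j singular_piece g j.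
Definition regular (g : V -> R) : set (Rn R n) := SB `\` singular_set g.

Section Gauss.
Variables (c1 c2 : R) (g : V -> R).
Hypothesis gN : is_norm c1 c2 g.

Lemma measurable_singular_piece j : measurable (singular_piece g j : set (Rn R n)).
Proof.
rewrite /singular_piece; case: unpickle => [[i k]|]; last exact: measurable0.
by apply: closed_Rn; apply: closedI; [exact: closed_singular gN i k|exact: closed_sphere].
Qed.

Lemma measurable_singular_set : measurable (singular_set g : set (Rn R n)).
Proof. by apply: bigcupT_measurable => j; exact: measurable_singular_piece. Qed.

Lemma measurable_regular : measurable (regular g).
Proof. exact: measurableD (@measurable_sphere R n) measurable_singular_set. Qed.

Lemma singular_set_null (lam : {measure set (Rn R n) -> \bar R}) :
  abs_cont_sph lam -> lam (singular_set g) = 0%E.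
Proof.
move=> ac; apply/eqP; rewrite eq_le measure_ge0 andbT.
apply: le_trans (measure_sigma_subadditive lam measurable_singular_piece
  measurable_singular_set (@subset_refl _ _)) _.
rewrite eseries0// => j _ _.
have := measurable_singular_piece j; rewrite /singular_piece.
case: unpickle => [[i k]|] mj; last exact: measure0.
by apply: ac => //; exact: sph_leb_singular gN i k.
Qed.

Lemma norming_gauss x : x != 0 -> norming g x (gauss g x).
Proof.
move=> x0; apply: xgetPex; have [u Su e] := dual_attained gN x0.
by exists u.
Qed.

Lemma norming_uniq x v w : ~ singular_set g x -> S x ->
  norming g x v -> norming g x w -> v = w.
Proof.
move=> nx Sx [Sv xv] [Sw xw]; apply: contrapT => /eqP vw; apply: nx.
have [i [k h]] := normals_singular gN Sv Sw vw xv xw.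
by exists (pickle (i, k)) => //; rewrite /singular_piece pickleK; split.
Qed.

Lemma gauss_uniq x v : regular g x -> norming g x v -> v = gauss g x.
Proof.
move=> [Sx nx] xv; apply: norming_uniq xv (norming_gauss _) => //; exact: sphere_neq0.
Qed.

Lemma gauss_sphere x : S x -> S (gauss g x).
Proof. by move=> /sphere_neq0 /norming_gauss[]. Qed.

Lemma regularN x : regular g x -> regular g (- x).
Proof.
have sN y : singular_set g y -> singular_set g (- y).
  move=> [j _]; rewrite /singular_piece; case E : (unpickle j) => [[i k]|//] [ys Sy].
  exists j => //; rewrite /singular_piece E; split; last exact: sphereN.
  move=> s s0; have := ys s s0; rewrite /second_diff.
  rewrite (_ : - y + s *: _ = - (y - s *: delta_mx 0 i)); last by rewrite opprB addrC.
  rewrite (_ : - y - s *: _ = - (y + s *: delta_mx 0 i)); last by rewrite opprD.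
  by rewrite !(is_normN gN) [g (y - _) + _]addrC.
by move=> [Sx nx]; split; [exact: sphereN|move=> /sN; rewrite opprK].
Qed.

Lemma gaussN x : regular g x -> gauss g (- x) = - gauss g x.
Proof.
move=> rx; have [Sx _] := rx; apply/esym; apply: gauss_uniq; first exact: regularN.
have [Sv xv] := norming_gauss (sphere_neq0 Sx); split; first exact: sphereN.
by rewrite dotNl dotNr opprK (is_normN gN) (is_normN (dual_norm gN)).
Qed.

Lemma measurable_gauss : measurable_fun (regular g) (gauss g : Rn R n -> Rn R n).
Proof.
have dc := dual_norm gN.
pose T (F : set V) : set V := [set x | S x /\ exists2 v, F v & norming g x v].
have Tcl F : closed F -> closed (T F).
  move=> cF; rewrite -[X in closed X]setCK; apply: open_closedC; apply/open_enormP => x nx.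
  apply: contrapT => no.
  have hk (k : nat) : exists p : V * V, enorm (p.1 - x) < k.+1%:R^-1 /\
      [/\ S p.1, F p.2 & norming g p.1 p.2].
    apply: contrapT => hk; apply: no; exists k.+1%:R^-1; first by rewrite invr_gt0.
    by move=> y yx [Sy [v Fv yv]]; apply: hk; exists (y, v).
  have [p hp] := choice hk.
  have Sp k : S (p k).2 by have [_ [_ _ []]] := hp k.
  have [v Sv cv] := sphere_cluster Sp.
  have close (e : R) : 0 < e -> exists k, enorm ((p k).1 - x) < e /\ enorm ((p k).2 - v) < e.
    move=> e0; have [k Nk kv] := cv e e0 (Num.trunc e^-1); exists k; split => //.
    have [h _] := hp k; apply: lt_le_trans h _.
    rewrite -[leRHS]invrK lef_pV2 ?posrE ?invr_gt0 ?ltr0n//.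
    have /andP[_ /ltW h] := truncn_itv (ltW (etrans (invr_gt0 e) e0)).
    by apply: le_trans h _; rewrite ler_nat.
  have Sx : S x.
    apply: contrapT => nSx.
    have /open_enormP/(_ x nSx)[e e0 he] : open (~` S) by exact/closed_openC/closed_sphere.
    by have [k [/he h _]] := close e e0; have [_ [/h]] := hp k.
  have Fv : F v.
    apply: contrapT => nFv.
    have /open_enormP/(_ v nFv)[e e0 he] : open (~` F) by exact/closed_openC.
    by have [k [_ /he h]] := close e e0; have [_ [_ /h]] := hp k.
  apply: nx; split => //; exists v => //; split => //.
  apply/eqP; rewrite -subr_eq0 -normr_le0; apply/ler_addgt0Pl => e e0; rewrite addr0.
  (* [C] majorises the sum of the coefficients of [d] in the four estimates [a1] to [a4]. *)
  pose C := 2 + (c1^-1 + 1) * c2 + c1^-1 * c2.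
  have c10 := is_norm_gt0 gN; have c20 := is_norm_gt0r gN.
  have i0 : 0 < c1^-1 by rewrite invr_gt0.
  have C0 : 0 < C by rewrite /C !addr_gt0// mulr_gt0// addr_gt0.
  have [k [h1 h2]] := close (e / C) (divr_gt0 e0 C0).
  have [_ [Sy _ [Sw yw]]] := hp k.
  move: h1 h2 Sy Sw yw; move: (p k) => [y w] /= h1 h2 Sy Sw yw.
  set d := e / C in h1 h2.
  have E : dot v x - dual g v * g x = dot (v - w) x + dot w (x - y)
      + (dual g w - dual g v) * g y + dual g v * (g y - g x).
    rewrite dotDl dotNl dotDr dotNr yw; ring.
  have a1 : `|dot (v - w) x| <= d.
    apply: le_trans (cauchy_schwarz _ _) _; have /sphere_enorm -> := Sx.
    by rewrite mulr1 enormB ltW.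
  have a2 : `|dot w (x - y)| <= d.
    apply: le_trans (cauchy_schwarz _ _) _; have /sphere_enorm -> := Sw.
    by rewrite mul1r enormB ltW.
  have /andP[_ gy] := is_norm_sphere gN Sy; have gy0 := is_norm_ge0 gN y.
  have /andP[_ dv] := is_norm_sphere dc Sv; have dv0 := is_norm_ge0 dc v.
  have d0 : 0 <= d by exact: le_trans (enorm_ge0 _) (ltW h1).
  have a3 : `|(dual g w - dual g v) * g y| <= c1^-1 * d * c2.
    rewrite normrM (ger0_norm gy0); apply: ler_pM => //.
    by apply: le_trans (is_norm_dist dc _ _) _; rewrite ler_pM2l// ltW.
  have a4 : `|dual g v * (g y - g x)| <= c1^-1 * (c2 * d).
    rewrite normrM (ger0_norm dv0); apply: ler_pM => //.
    by apply: le_trans (is_norm_dist gN _ _) _; rewrite ler_pM2l// ltW.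
  have CE : C * d = e by rewrite /d mulrC divfK// gt_eqF.
  rewrite E; apply: le_trans (ler_normD _ _) _.
  have b1 := ler_normD (dot (v - w) x + dot w (x - y)) ((dual g w - dual g v) * g y).
  have b2 := ler_normD (dot (v - w) x) (dot w (x - y)).
  have cd : 0 <= c2 * d by rewrite mulr_ge0 ?(ltW c20).
  rewrite -CE /C; move: a1 a2 a3 a4 b1 b2 cd.
  move: `|_ * _| `|_ * _| `|_ + _| `|_ + _| `|_| `|_| => q1 q2 q3 q4 q5 q6.
  by lra.
move=> mr; move: mr; apply: (@measurability _ _ (Rn R n) (Rn R n) (regular g) (gauss g) (@open V) erefl).
move=> _ [U oU <-]; have mr := measurable_regular.
rewrite (_ : _ `&` _ = regular g `\` T (~` U)).
  apply: measurableD => //; apply: closed_Rn; apply: Tcl; exact: open_closedC.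
apply/seteqP; split=> x [rx h]; split => //.
  by move=> [_ [v nUv xv]]; apply: nUv; rewrite (gauss_uniq rx xv).
apply: contrapT => nU; apply: h; have [Sx _] := rx; split => //.
by exists (gauss g x) => //; exact: norming_gauss (sphere_neq0 Sx).
Qed.

End Gauss.
End FirstOrder.

Section EulerLagrange.
Variables (R : realType) (n : nat).
Local Notation V := 'rV[R]_n.
Local Notation S := (@sphere R n).
Local Notation SB := (@sphere R n : set (Rn R n)).
Implicit Types (x y z u v w : V) (s t : R).
Variables lam mu : {measure set (Rn R n) -> \bar R}.
Hypothesis lamfin : finite_meas lam.
Hypothesis mufin : finite_meas mu.
Hypothesis lamac : abs_cont_sph lam.
Variables psi psi' gam gam' : V -> R -> R.
Hypothesis psiC : incr_C1 psi psi'.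
Hypothesis gamC : incr_C1 gam gam'.
Local Notation P := (dual_energy mu psi).
Local Notation Q := (radial_energy lam gam).
Variables (a b c1 c2 : R) (g : V -> R).
Hypothesis gN : is_norm c1 c2 g.
Hypotheses (ga : P g < a) (gb : Q g < b).
Hypothesis gmax : forall d1 d2 f, is_norm d1 d2 f -> P f < a -> Q f < b ->
  (a - P f) * (b - Q f) <= (a - P g) * (b - Q g).

Let h := dual g.
Let hN : is_norm c2^-1 c1^-1 h. Proof. exact: dual_norm gN. Qed.

Lemma energy_mono (nu : {measure set (Rn R n) -> \bar R}) (F F' : V -> R -> R) (l l' : V -> R) :
  finite_meas nu -> incr_C1 F F' -> sph_cont l -> sph_cont l' ->
  (forall x, S x -> l x <= l' x) -> energy nu F l <= energy nu F l'.
Proof.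
move=> nufin FC lc l'c ll'; have [Fc _ _ _] := FC.
apply: le_Rintegral; first exact: measurable_sphere.
- exact: (energy_int nufin Fc lc).
- exact: (energy_int nufin Fc l'c).
- by move=> x Sx; apply: (incr_le FC Sx); exact: ll'.
Qed.

Lemma sph_cont_add (f f' : V -> R) : sph_cont f -> sph_cont f' -> sph_cont (fun x => f x + f' x).
Proof.
move=> /sph_contP/subspace_continuousP fc /sph_contP/subspace_continuousP f'c.
apply/sph_contP/subspace_continuousP => x Sx.
by apply: (@cvgD _ _ _ _ (within_filter _ (nbhs_filter x))); [exact: fc|exact: f'c].
Qed.

Lemma sph_cont_mul (f f' : V -> R) : sph_cont f -> sph_cont f' -> sph_cont (fun x => f x * f' x).
Proof.
move=> /sph_contP/subspace_continuousP fc /sph_contP/subspace_continuousP f'c.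
apply/sph_contP/subspace_continuousP => x Sx.
by apply: (@cvgM _ _ _ (within_filter _ (nbhs_filter x))); [exact: fc|exact: f'c].
Qed.

Lemma sph_cont_inv (f : V -> R) : sph_cont f -> (forall x, S x -> f x != 0) ->
  sph_cont (fun x => (f x)^-1).
Proof.
move=> /sph_contP/subspace_continuousP fc f0.
apply/sph_contP/subspace_continuousP => x Sx.
by apply: cvgV; [exact: f0|exact: fc].
Qed.

Lemma sph_cont_cst (c : R) : sph_cont (fun _ : V => c).
Proof. by move=> x e Sx e0; exists 1 => // y _ _; rewrite subrr normr0. Qed.

(** The competitors are the Wulff shapes of h e^{t phi} with t = 1 / (j + 1). With A = a - P(g), B =
    b - Q(g) and difference quotients p and q, maximality gives (A - t p) (B - t q) <= A B, that is
    t p q <= B p + A q, whose left side tends to 0. *)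
Lemma first_variation (phi : V -> R) : sph_cont phi -> (forall u, S u -> phi (- u) = phi u) ->
  0 <= (b - Q g) * \int[mu]_(u in SB) (psi' u (ln (h u)) * phi u) +
       (a - P g) * \int[lam]_(x in regular g) (gam' x (ln (g x)) * (- phi (gauss g x))).
Proof.
move=> phic phiN; have [M M0 phiM] := sph_cont_bounded phic.
have [S0|S0] := eqVneq S set0.
  have r0 : regular g = set0 by rewrite /regular S0 set0D.
  by rewrite r0 S0 !Rintegral_set0 !mulr0 addr0.
have [x0 Sx0] : S !=set0 by exact/set0P.
pose tj (j : nat) : R := j.+1%:R^-1.
have t01 j : 0 < tj j <= 1.
  by rewrite invr_gt0 ltr0n/= invf_le1 ?ltr0n// ler1n.
have t0 : tj j @[j --> \oo] --> (0 : R) by exact: cvg_harmonic.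
pose f j := perturb g phi (tj j); pose gj j := wulff (f j).
have gjN j : exists d1 d2, is_norm d1 d2 (gj j) /\ forall u, S u -> dual (gj j) u <= f j u.
  have /andP[/ltW tp _] := t01 j.
  have [[r0 B]|E] := perturb_bounds gN phiM tp; last by move: S0; rewrite E eqxx.
  exists (c1^-1 * expR (tj j * M))^-1, (c2^-1 * expR (- (tj j * M)))^-1; split.
    exact: wulff_norm r0 B.
  by move=> u Su; exact: dual_wulff_le r0 B Su.
have hc := sph_cont_ln_norm hN; have gc := sph_cont_ln_norm gN.
pose lj j u := ln (h u) + tj j * phi u.
have ljc j : sph_cont (lj j) by apply: sph_cont_add hc (sph_cont_mul (sph_cont_cst _) phic).
(* The dual norm of the Wulff shape is never differentiated: it is at most [h * expR (t * phi)], and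
   the energy of that function is differentiated instead. *)
pose Pj j := energy mu psi (lj j).
have PPj j : P (gj j) <= Pj j.
  have [d1 [d2 [dN df]]] := gjN j.
  apply: (energy_mono mufin psiC) => //; first exact: sph_cont_ln_norm (dual_norm dN).
  move=> u Su; have hu := is_norm_sphere_gt0 hN Su; rewrite /lj -[X in _ + X]expRK.
  rewrite -lnM ?posrE ?expR_gt0// ler_ln ?posrE ?mulr_gt0 ?expR_gt0//; first exact: df.
  exact: (is_norm_sphere_gt0 (dual_norm dN) Su).
have dP : (Pj j - P g) / tj j @[j --> \oo] -->
    \int[mu]_(u in SB `\` set0) (psi' u (ln (h u)) * phi u).
  apply: (@energy_deriv R n mu mufin psi psi' psiC _ lj tj phi M) => //.
  - by move=> j x Sx; rewrite /lj addrC addKr normrM gtr0_norm ?ler_pM2l ?phiM//; case/andP: (t01 j).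
  - move=> x Sx _; apply: cvg_near_cst; apply: nearW => j; rewrite /lj addrC addKr mulrC mulKf//.
    by have /andP[p _] := t01 j; rewrite gt_eqF.
rewrite setD0 in dP.
have dQ : (Q (gj j) - Q g) / tj j @[j --> \oo] -->
    \int[lam]_(x in regular g) (gam' x (ln (g x)) * (- phi (gauss g x))).
  apply: (@energy_deriv R n lam lamfin gam gam' gamC _ (fun j x => ln (gj j x)) tj
    (fun x => - phi (gauss g x)) M (singular_set g)) => //.
  - by move=> j; have [d1 [d2 [dN _]]] := gjN j; exact: sph_cont_ln_norm dN.
  - move=> j x Sx; have /andP[/ltW tp _] := t01 j.
    exact: (ln_wulff_perturb_bound gN phiM tp (sphere_neq0 Sx)).
  - exact: (measurable_singular_set gN).
  - exact: (singular_set_null gN lamac).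
  - move=> x Sx nx; have x00 := sphere_neq0 Sx; have [Sv xv] := norming_gauss gN x00.
    apply/cvgrPdist_le => e e0.
    have [|d d0 hd] := ln_wulff_perturb_deriv gN phic phiM phiN x00 Sv xv _ e0.
      by move=> u Su xu; apply: (gauss_uniq gN (conj Sx nx)).
    have : \forall j \near \oo, `|tj j| < d by move/cvgr0Pnorm_lt : t0; apply.
    apply: filterS => j tjd; have /andP[p _] := t01 j.
    rewrite -opprD normrN addrC; apply: hd; rewrite p/=.
    exact: le_lt_trans (ler_norm _) tjd.
set p := Rintegral _ _ _ in dP *; set q := Rintegral _ _ _ in dQ *.
pose A := a - P g; pose B := b - Q g.
have A0 : 0 < A by rewrite subr_gt0.
have B0 : 0 < B by rewrite subr_gt0.
pose pj j := (Pj j - P g) / tj j; pose qj j := (Q (gj j) - Q g) / tj j.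
have tp0 : tj j * pj j @[j --> \oo] --> 0 * p by apply: cvgM.
have tq0 : tj j * qj j @[j --> \oo] --> 0 * q by apply: cvgM.
rewrite mul0r in tp0; rewrite mul0r in tq0.
have lim1 : B * pj j + A * qj j @[j --> \oo] --> B * p + A * q.
  by apply: cvgD; apply: cvgM => //; exact: cvg_cst.
have lim0 : tj j * pj j * qj j @[j --> \oo] --> 0 * q by apply: cvgM.
rewrite mul0r in lim0.
apply: (ler_cvg_to lim0 lim1).
have n1 : \forall j \near \oo, `|tj j * pj j| < A by move/cvgr0Pnorm_lt : tp0; apply.
have n2 : \forall j \near \oo, `|tj j * qj j| < B by move/cvgr0Pnorm_lt : tq0; apply.
near=> j.
have h1 : `|tj j * pj j| < A by near: j.
have h2 : `|tj j * qj j| < B by near: j.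
have /andP[tp _] := t01 j.
have e1 : tj j * pj j = Pj j - P g by rewrite mulrC divfK// gt_eqF.
have e2 : tj j * qj j = Q (gj j) - Q g by rewrite mulrC divfK// gt_eqF.
have h1' := le_lt_trans (ler_norm _) h1; have h2' := le_lt_trans (ler_norm _) h2.
have [d1 [d2 [dN _]]] := gjN j.
have Pa : P (gj j) < a by move: h1' (PPj j); rewrite e1 /A; lra.
have Qb : Q (gj j) < b by move: h2'; rewrite e2 /B; lra.
have := gmax dN Pa Qb; rewrite -/A -/B => gm.
(* Replacing [P (gj j)] by the larger [Pj j] shrinks the first factor, and for large j both factors
   are still nonnegative. *)
have : (A - tj j * pj j) * (B - tj j * qj j) <= A * B.
  apply: le_trans gm; apply: ler_pM; rewrite ?subr_ge0 ?(ltW h1') ?(ltW h2')//.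
  - by have := PPj j; rewrite e1 /A; lra.
  - by rewrite e2 /B; lra.
move: (tj j) (pj j) (qj j) tp => t' x y tp hh.
rewrite -(ler_pM2l tp); lra.
Unshelve. all: by end_near. Qed.

End EulerLagrange.

(** * Test functions and even measures *)

Section DistFun.
Variables (R : realType) (n : nat).
Local Notation V := 'rV[R]_n.

(* The distance to the complement of U. *)
Lemma open_level_set (U : set V) : open U -> exists f : V -> R,
  [/\ continuous f, forall x, 0 <= f x & forall x, U x <-> 0 < f x].
Proof.
move=> oU; have [C0|/set0P[c0 Cc0]] := eqVneq (~` U) set0.
  exists (fun=> 1); split => // [x|x]; first exact: cst_continuous.
  by split => // _; rewrite -(setCK U) C0 setC0.
pose D x := [set enorm (x - y) | y in ~` U]; pose f x := inf (D x).
have lbD x : has_lbound (D x) by exists 0 => _ [y _ <-]; exact: enorm_ge0.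
have D0 x : D x !=set0 by exists (enorm (x - c0)), c0.
have f0 x : 0 <= f x by apply: lb_le_inf => // _ [y _ <-]; exact: enorm_ge0.
have fle x y : (~` U) y -> f x <= enorm (x - y) by move=> Cy; apply: ge_inf => //; exists y.
have lip x y : f x <= f y + enorm (x - y).
  rewrite -lerBlDr; apply: lb_le_inf => // _ [z Cz <-]; rewrite lerBlDr.
  apply: le_trans (fle x z Cz) _; have := enormD (x - y) (y - z); rewrite addrA subrK; lra.
exists f; split => // [|x].
  apply: continuous_enormP => x e e0; exists e => // y yx.
  have := lip x y; have := lip y x; rewrite (enormB x y) => h1 h2.
  by rewrite ltr_norml; apply/andP; split; lra.
split=> [Ux|fx]; last first.
  by apply: contrapT => nUx; have := fle x x nUx; rewrite subrr enorm0 leNgt fx.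
have /open_enormP/(_ x Ux)[e e0 he] := oU.
apply: lt_le_trans e0 _; apply: lb_le_inf => // _ [y Cy <-].
by rewrite leNgt; apply/negP => yx; apply: Cy; apply: he; rewrite enormB.
Qed.

End DistFun.

Section EvenMeasure.
Variables (R : realType) (n : nat).
Local Notation V := 'rV[R]_n.
Variable nu : {measure set (Rn R n) -> \bar R}.
Hypothesis nueven : even_meas nu.

Lemma measurable_opp : measurable_fun [set: Rn R n] ((fun x : V => - x) : Rn R n -> Rn R n).
Proof.
apply: (@measurability _ _ (Rn R n) (Rn R n) setT (fun x : V => - x) (@open V) erefl).
move=> _ [U oU <-]; rewrite setTI; apply: open_Rn.
by apply: open_comp => // x _; exact: oppr_continuous.
Qed.

Lemma even_Rintegral (D : set (Rn R n)) (f : V -> R) : measurable D ->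
  (forall x : V, D x -> D (- x)) -> nu.-integrable D (EFin \o (f : Rn R n -> R)) ->
  \int[nu]_(x in D) f (- (x : V)) = \int[nu]_(x in D) f x.
Proof.
move=> mD DN fi; rewrite /Rintegral; congr fine.
pose N : Rn R n -> Rn R n := fun x : V => - x.
have mf := measurable_int _ fi.
(* Extension by 0 makes the integrand measurable on the whole space, as the change of variables
   requires. *)
pose F := (EFin \o (f : Rn R n -> R)) \_ D.
have mF : measurable_fun [set: Rn R n] F by apply/(measurable_restrictT _ mD).
have ND : N @^-1` D = D.
  by apply/seteqP; split=> x /= Dx; [rewrite -(opprK (x : V)); exact: DN|exact: DN].
have pE (A : set (Rn R n)) : measurable A -> pushforward nu N A = nu A.
  move=> mA; rewrite /pushforward -[RHS]nueven//; congr (nu _).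
  apply/seteqP; split=> x /=; first by move=> Ax; exists (- (x : V)); rewrite ?opprK.
  by move=> [y Ay <-]; rewrite /N opprK.
have E1 : (\int[pushforward nu N]_(x in D) F x = \int[nu]_(x in D) F x)%E.
  apply: eq_measure_integral; first exact: measurable_opp.
  by move=> ? A mA _; exact: pE.
have iF : nu.-integrable D F.
  by apply: eq_integrable fi => // x xD; rewrite /F patchE xD.
rewrite (eq_integral (F \o N)); last first.
  by move=> x /set_mem Dx; rewrite /F/= patchE mem_set//; exact: DN.
rewrite [RHS](eq_integral F); last by move=> x xD; rewrite /F patchE xD.
rewrite -E1 (integral_pushforward measurable_opp mF) ?ND//.
apply/integrableP; split.
  apply: measurable_funTS; exact: measurableT_comp mF measurable_opp.
have := @ge0_integral_pushforward _ _ _ _ _ N measurable_opp nu D (abse \o F) mD.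
rewrite ND => <-; first 1 last.
- by apply: measurable_funTS; apply: measurableT_comp.
- by move=> x _; exact: abse_ge0.
have -> : (\int[pushforward nu N]_(x in D) (abse \o F) x = \int[nu]_(x in D) (abse \o F) x)%E.
  apply: eq_measure_integral; first exact: measurable_opp.
  by move=> ? A mA _; exact: pE.
by case/integrableP : iF.
Qed.

End EvenMeasure.

(** * The equality of measures *)

Section MeasureIdentity.
Variables (R : realType) (n : nat).
Local Notation V := 'rV[R]_n.
Local Notation S := (@sphere R n).
Local Notation SB := (@sphere R n : set (Rn R n)).
Implicit Types (x y z u v w : V) (s t : R).
Variables lam mu : {measure set (Rn R n) -> \bar R}.
Hypothesis lamfin : finite_meas lam.
Hypothesis mufin : finite_meas mu.
Hypothesis lamac : abs_cont_sph lam.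
Hypothesis lameven : even_meas lam.
Hypothesis mueven : even_meas mu.
Variables psi psi' gam gam' : V -> R -> R.
Hypothesis psiC : incr_C1 psi psi'.
Hypothesis gamC : incr_C1 gam gam'.
Hypothesis psi'N : forall u t, S u -> psi' (- u) t = psi' u t.
Hypothesis gam'N : forall u t, S u -> gam' (- u) t = gam' u t.
Variables (c1 c2 : R) (g : V -> R).
Hypothesis gN : is_norm c1 c2 g.

Let h := dual g.
Let hN : is_norm c2^-1 c1^-1 h. Proof. exact: dual_norm gN. Qed.
Let mreg := measurable_regular gN.
Let mS := @measurable_sphere R n.

Definition gamln x := gam' x (ln (g x)).
Definition psiln u := psi' u (ln (dual g u)).
Definition density x := gamln x / psiln (gauss g x).

Lemma gamln_cont : sph_cont gamln.
Proof. by case: gamC => _ c _ _; apply: jcont_comp c (sph_cont_ln_norm gN). Qed.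

Lemma psiln_cont : sph_cont psiln.
Proof. by case: psiC => _ c _ _; apply: jcont_comp c (sph_cont_ln_norm hN). Qed.

Lemma gamln_gt0 x : S x -> 0 < gamln x.
Proof. by case: gamC => _ _ _ p; exact: p. Qed.

Lemma psiln_gt0 x : S x -> 0 < psiln x.
Proof. by case: psiC => _ _ _ p; exact: p. Qed.

Lemma density_gt0 x : S x -> 0 < density x.
Proof. by move=> Sx; rewrite divr_gt0 ?gamln_gt0 ?psiln_gt0//; exact: gauss_sphere gN _ Sx. Qed.

Lemma psiln_inv_cont : sph_cont (fun u => (psiln u)^-1).
Proof. by apply: sph_cont_inv psiln_cont _ => x Sx; rewrite gt_eqF// psiln_gt0. Qed.

Lemma gauss_comp_measurable (f : V -> R) : sph_cont f ->
  measurable_fun (regular g) ((fun x => f (gauss g x)) : Rn R n -> R).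
Proof.
move=> fc; apply: (@measurable_comp _ _ _ (Rn R n) (Rn R n) _ SB (f : Rn R n -> R) (regular g)
  (gauss g : Rn R n -> Rn R n)) => //.
- by move=> _ [x [Sx _] <-]; exact: (gauss_sphere gN).
- exact: sph_cont_measurable.
- exact: (measurable_gauss gN).
Qed.

Lemma gauss_comp_int (f f' : V -> R) : sph_cont f -> sph_cont f' ->
  lam.-integrable (regular g) (EFin \o ((fun x => f' x * f (gauss g x)) : Rn R n -> R)).
Proof.
move=> fc f'c; have [B B0 hB] := sph_cont_bounded fc; have [B' B'0 hB'] := sph_cont_bounded f'c.
have rS : regular g `<=` SB by move=> x [].
apply: (@bounded_int _ _ _ lamfin _ _ (B' * B)) => //.
  apply: measurable_funM; last exact: gauss_comp_measurable.
  exact: measurable_funS mS rS (sph_cont_measurable f'c).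
move=> x /rS Sx; rewrite normrM; apply: ler_pM => //; first exact: hB'.
by apply: hB; exact: (gauss_sphere gN).
Qed.

Variables (a b : R).
Hypotheses (ga : dual_energy mu psi g < a) (gb : radial_energy lam gam g < b).
Hypothesis gmax : forall d1 d2 f, is_norm d1 d2 f -> dual_energy mu psi f < a ->
  radial_energy lam gam f < b ->
  (a - dual_energy mu psi f) * (b - radial_energy lam gam f) <=
  (a - dual_energy mu psi g) * (b - radial_energy lam gam g).

Let A := a - dual_energy mu psi g.
Let B := b - radial_energy lam gam g.

(** [first_variation] for [phi] and for [- phi] gives the two inequalities. *)
Lemma euler_lagrange_even (phi : V -> R) : sph_cont phi ->
  (forall u, S u -> phi (- u) = phi u) ->
  B * \int[mu]_(u in SB) (psiln u * phi u) =
  A * \int[lam]_(x in regular g) (gamln x * phi (gauss g x)).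
Proof.
move=> phic phiN.
have phi1 : sph_cont (fun u => - phi u).
  move=> x e Sx e0; have [d d0 hd] := phic x e Sx e0.
  by exists d => // y Sy yx; rewrite -opprD normrN hd.
have h1 := first_variation lamfin mufin lamac psiC gamC gN ga gb gmax phic phiN.
have h2 : forall u, S u -> - phi (- u) = - phi u by move=> u Su; rewrite phiN.
have {}h2 := first_variation lamfin mufin lamac psiC gamC gN ga gb gmax phi1 h2.
have i1 := sph_cont_int mufin mS (@subset_refl _ _) (sph_cont_mul psiln_cont phic).
have i2 := gauss_comp_int phic gamln_cont.
move: h1 h2; rewrite -/A -/B.
rewrite (@eq_Rintegral _ _ _ mu _ (fun u => (-1) * (psiln u * phi u)) (fun u => _ * - phi u)); last first.
  by move=> x _; rewrite mulN1r mulrN.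
rewrite RintegralZl// mulN1r.
rewrite (@eq_Rintegral _ _ _ lam _ (fun u => (-1) * (gamln u * phi (gauss g u)))
  (fun u => _ * - phi _)); last first.
  by move=> x _; rewrite mulN1r mulrN.
rewrite RintegralZl// mulN1r.
rewrite (@eq_Rintegral _ _ _ lam _ (fun u => (gamln u * phi (gauss g u)))
  (fun u => _ * - - phi _)); last first.
  by move=> x _; rewrite opprK.
rewrite -/(psiln _).
set p := Rintegral _ _ _; set q := Rintegral _ _ _.
rewrite !mulrN subr_ge0 addrC subr_ge0 => h1 h2.
by apply/eqP; rewrite eq_le h1 h2.
Qed.

(** The even case is applied to the even part of [chi] divided by [psiln], which is even because
    [psi'] and the dual norm are. Evenness of [mu] and of [lam], with [gaussN], then replaces the
    even part by [chi] on both sides. *)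
Lemma euler_lagrange (chi : V -> R) : sph_cont chi ->
  B * \int[mu]_(u in SB) chi u = A * \int[lam]_(x in regular g) (density x * chi (gauss g x)).
Proof.
move=> chic.
have chi1 : sph_cont (fun u => chi (- u)).
  move=> x e Sx e0; have [d d0 hd] := chic (- x) e (sphereN Sx) e0.
  exists d => // y Sy yx; apply: hd; first exact: sphereN.
  by rewrite -opprD enormN.
pose ev u := (chi u + chi (- u)) / 2.
have evc : sph_cont ev by apply: sph_cont_mul (sph_cont_add chic chi1) (sph_cont_cst _).
pose phi u := (psiln u)^-1 * ev u.
have phic : sph_cont phi by apply: sph_cont_mul psiln_inv_cont evc.
have phiN u : S u -> phi (- u) = phi u.
  by move=> Su; rewrite /phi /ev /psiln opprK (is_normN (dual_norm gN)) psi'N// [chi (- u) + _]addrC.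
have := euler_lagrange_even phic phiN.
have i1 := sph_cont_int mufin mS (@subset_refl _ _) chic.
have i1' := sph_cont_int mufin mS (@subset_refl _ _) chi1.
have E1 : \int[mu]_(u in SB) (psiln u * phi u) = \int[mu]_(u in SB) chi u.
  transitivity (\int[mu]_(u in SB) ((chi u + chi (- (u : V))) / 2)).
    apply: eq_Rintegral => u /set_mem Su; rewrite /phi mulrA divff ?mul1r//.
    by rewrite gt_eqF// psiln_gt0.
  rewrite RintegralZr//; last exact: (integrableD mS i1 i1').
  rewrite RintegralD// (even_Rintegral mueven mS _ i1); first lra.
  by move=> x; exact: sphereN.
have k1 := sph_cont_mul psiln_inv_cont chic.
have k2 := sph_cont_mul psiln_inv_cont chi1.
have j1 := gauss_comp_int k1 gamln_cont.
have j1' := gauss_comp_int k2 gamln_cont.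
have E2 : \int[lam]_(x in regular g) (gamln x * phi (gauss g x)) =
          \int[lam]_(x in regular g) (density x * chi (gauss g x)).
  transitivity (\int[lam]_(x in regular g)
    ((gamln x * ((psiln (gauss g x))^-1 * chi (gauss g x)) +
      gamln x * ((psiln (gauss g x))^-1 * chi (- gauss g x))) / 2)).
    by apply: eq_Rintegral => x _; rewrite /phi /ev; ring.
  rewrite RintegralZr//; last exact: (integrableD mreg j1 j1').
  rewrite RintegralD//.
  have -> : \int[lam]_(x in regular g) (gamln x * ((psiln (gauss g x))^-1 * chi (- gauss g x))) =
            \int[lam]_(x in regular g) (gamln x * ((psiln (gauss g x))^-1 * chi (gauss g x))).
    rewrite -(even_Rintegral lameven mreg (regularN gN) j1).
    apply: eq_Rintegral => x /set_mem rx; have [Sx _] := rx.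
    rewrite (gaussN gN rx) /gamln gam'N// (is_normN gN) /psiln (is_normN (dual_norm gN)) psi'N//.
    exact: (gauss_sphere gN).
  transitivity (\int[lam]_(x in regular g) (gamln x * ((psiln (gauss g x))^-1 * chi (gauss g x)))).
    lra.
  by apply: eq_Rintegral => x _; rewrite /density mulrA.
by rewrite E1 E2.
Qed.

Lemma density_int : lam.-integrable (regular g) (EFin \o (density : Rn R n -> R)).
Proof. exact: gauss_comp_int psiln_inv_cont gamln_cont. Qed.

(** Takes the place of [alpha_star], from which it differs only inside [singular_set]; it is Borel
    whenever [w] is. *)
Definition gauss_preimage (w : set V) : set (Rn R n) := regular g `&` gauss g @^-1` w.

Lemma measurable_gauss_preimage (w : set (Rn R n)) : measurable w ->
  measurable (gauss_preimage w).
Proof. by move=> mw; exact: (measurable_gauss gN mreg mw). Qed.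

Let ident (w : set (Rn R n)) :=
  (B%:E * mu (SB `&` w) = A%:E * \int[lam]_(x in gauss_preimage w) (density x)%:E)%E.

(** The indicator of U is the limit of min(j f, 1) with f from [open_level_set]; both sides pass to
    the limit by dominated convergence. *)
Lemma ident_open (U : set V) : open U -> ident U.
Proof.
move=> oU; have [f [fc f0 fU]] := open_level_set oU.
pose chi (j : nat) u := Num.min (j%:R * f u) 1.
have chic j : sph_cont (chi j).
  have jfc := sph_cont_mul (sph_cont_cst j%:R) (continuous_sph fc).
  move=> x e Sx e0; have [d d0 hd] := jfc x e Sx e0; exists d => // y Sy yx.
  apply: le_lt_trans (hd y Sy yx); rewrite /chi.
  move: (j%:R * f y) (j%:R * f x) => p q.
  by rewrite /Num.min; case: ltP => ?; case: ltP => ?; rewrite ?subrr// ler_norml;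
    case: (ler0P (p - q)) => ?; apply/andP; split; lra.
have chi1 j u : `|chi j u| <= 1.
  have p : 0 <= j%:R * f u by rewrite mulr_ge0.
  by rewrite ger0_norm /chi; [rewrite ge_min lexx orbT|rewrite le_min p ler01].
have chil u : chi j u @[j --> \oo] --> (\1_U u : R).
  rewrite indicE; have [/set_mem uU|/negP uU] := boolP (u \in U).
    have fu : 0 < f u by apply/fU.
    apply: cvg_near_cst; exists (Num.trunc (f u)^-1).+1 => // j /= jN.
    rewrite /chi; apply/min_idPr; rewrite -ler_pdivrMr// mul1r.
    have /andP[_ /ltW p] := truncn_itv (ltW (etrans (invr_gt0 (f u)) fu)).
    by apply: le_trans p _; rewrite ler_nat.
  have fu : f u = 0.
    apply/eqP; rewrite eq_le f0 andbT leNgt; apply/negP => /fU uU'.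
    by apply: uU; rewrite inE.
  apply: cvg_near_cst; apply: nearW => j; rewrite /chi fu mulr0; apply/min_idPl.
  exact: ler01.
have mU : measurable (U : set (Rn R n)) by exact: open_Rn.
have L1 : (\int[mu]_(u in SB) (chi j u)%:E)%E @[j --> \oo] --> mu (SB `&` U).
  have -> : mu (SB `&` U) = (\int[mu]_(u in SB) (\1_U u)%:E)%E by rewrite integral_indic// setIC.
  apply: (@dominated_cvg _ _ _ mu SB mS _ _ (fun=> 1%E)) => //.
  - by move=> j; apply/measurable_EFinP; exact: sph_cont_measurable.
  - by move=> x _; apply: cvg_EFin; [exact: nearW|exact: chil].
  - by apply: (@bounded_int _ _ _ mufin _ (fun=> 1) 1) => // x _; rewrite normr1.
  - by move=> j x _; rewrite lee_fin.
have L2 : (\int[lam]_(x in regular g) (density x * chi j (gauss g x))%:E)%E @[j --> \oo] -->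
    (\int[lam]_(x in gauss_preimage U) (density x)%:E)%E.
  have -> : (\int[lam]_(x in gauss_preimage U) (density x)%:E)%E =
     (\int[lam]_(x in regular g) (density x * \1_U (gauss g x))%:E)%E.
    rewrite integral_mkcond [RHS]integral_mkcond; apply: eq_integral => x _.
    rewrite !patchE indicE /gauss_preimage in_setI.
    case: (x \in regular g) => //=.
    have -> : (x \in gauss g @^-1` U) = (gauss g x \in U) by apply/idP/idP; rewrite !inE.
    by case: (gauss g x \in U); rewrite ?mulr1 ?mulr0.
  have [/measurable_EFinP md _] := integrableP _ _ _ density_int.
  apply: (@dominated_cvg _ _ _ lam _ mreg _ _ (fun x => (density x)%:E)) => //.
  - by move=> j; apply/measurable_EFinP; apply: measurable_funM => //; exact: gauss_comp_measurable.
  - move=> x _; apply: cvg_EFin; first exact: nearW.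
    by apply: cvgM; [exact: cvg_cst|exact: chil].
  - exact: density_int.
  - move=> j x [Sx _]; rewrite lee_fin normrM ger0_norm ?ler_piMr// ltW//; exact: density_gt0.
have cA : (A%:E * \int[lam]_(x in regular g) (density x * chi j (gauss g x))%:E)%E @[j --> \oo] -->
    (A%:E * \int[lam]_(x in gauss_preimage U) (density x)%:E)%E by apply: cvgeZl.
have cB : (B%:E * \int[mu]_(u in SB) (chi j u)%:E)%E @[j --> \oo] --> (B%:E * mu (SB `&` U))%E.
  by apply: cvgeZl.
have E j : (B%:E * \int[mu]_(u in SB) (chi j u)%:E =
    A%:E * \int[lam]_(x in regular g) (density x * chi j (gauss g x))%:E)%E.
  have := euler_lagrange (chic j); rewrite /Rintegral => h0.
  rewrite -[X in (B%:E * X)%E]fineK; last first.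
    apply: integrable_fin_num => //; exact: sph_cont_int.
  rewrite -[X in (A%:E * X)%E]fineK; last first.
    apply: integrable_fin_num => //.
    have := gauss_comp_int (sph_cont_mul psiln_inv_cont (chic j)) gamln_cont.
    by apply: eq_integrable => // x _ /=; rewrite /density mulrA.
  by rewrite -!EFinM h0.
rewrite /ident; move: cB; under eq_cvg do rewrite E; move=> cB.
exact: (cvg_unique _ cB cA).
Qed.

(** Dynkin's theorem on the pi-system of open sets. The complement step subtracts from the identity
    on the whole sphere and so relies on both sides being finite. *)
Lemma ident_measurable (w : set (Rn R n)) : measurable w -> ident w.
Proof.
have finmu (X : set (Rn R n)) : measurable X -> mu X \is a fin_num.
  by move=> mX; rewrite ge0_fin_numE// finite_meas_lty.
have pS X : gauss_preimage X `<=` regular g by move=> x [].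
have [/measurable_EFinP md _] := integrableP _ _ _ density_int.
have finlam (X : set (Rn R n)) : measurable X ->
    (\int[lam]_(x in gauss_preimage X) (density x)%:E)%E \is a fin_num.
  move=> mX; apply: integrable_fin_num; first exact: measurable_gauss_preimage.
  apply: (integrableS mreg _ (pS X) density_int); exact: measurable_gauss_preimage.
have identT : ident setT by exact: ident_open openT.
move=> mw; apply: (@dynkin_induction _ (Rn R n) (@open V) ident erefl) => //.
- by move=> X Y; exact: openI.
- exact: ident_open.
- move=> X mX iX; rewrite /ident in identT iX *.
  have -> : SB `&` ~` X = SB `\` (SB `&` X) by rewrite setDIr setDv set0U.
  have mSX : measurable (SB `&` X) by exact: measurableI.
  rewrite measureD//; last exact: finite_meas_lty.
  rewrite setIA setIid muleBr; [|by []|by apply: fin_num_adde_defr; exact: finmu].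
  rewrite iX; move: identT; rewrite setIT => ->.
  have e : gauss_preimage setT = gauss_preimage X `|` gauss_preimage (~` X).
    by rewrite /gauss_preimage preimage_setT setIT -setIUr preimage_setC setUv setIT.
  rewrite e integral_setU//; [|exact: measurable_gauss_preimage| | |].
  - rewrite muleDr//; last by apply: fin_num_adde_defr; exact: finlam.
    rewrite addeAC subee ?add0e// fin_numM// finlam//.
  - by apply: measurable_gauss_preimage; exact: measurableC.
  - have pSS : gauss_preimage X `|` gauss_preimage (~` X) `<=` regular g by move=> x [[]|[]].
    by apply/measurable_EFinP; exact: (measurable_funS mreg pSS md).
  - by apply/disj_setPS => x [[_ a1] [_ a2]]; exact: a2.
- move=> F mF tF iF; rewrite /ident setI_bigcupr.
  have tF' : trivIset setT (fun k => SB `&` F k) by exact: trivIset_setIl.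
  rewrite measure_bigcup//; last by move=> k _; exact: measurableI.
  have Eb : gauss_preimage (\bigcup_k F k) = \bigcup_k gauss_preimage (F k).
    by rewrite /gauss_preimage preimage_bigcup setI_bigcupr.
  have mgp k : measurable (gauss_preimage (F k)) by exact: measurable_gauss_preimage.
  have sub : \bigcup_k gauss_preimage (F k) `<=` regular g by move=> x [k _ []].
  have d0 x : (\bigcup_k gauss_preimage (F k)) x -> (0 <= (density x)%:E)%E.
    by move=> /sub[Sx _]; rewrite lee_fin ltW//; exact: density_gt0.
  have tG : trivIset setT (fun k => gauss_preimage (F k)).
    by apply: trivIset_setIl => j k _ _ [x [/= xj xk]]; apply: tF => //; exists (gauss g x).
  rewrite Eb ge0_integral_bigcup//; last first.
    by apply/measurable_EFinP; exact: (measurable_funS mreg sub md).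
  rewrite -nneseriesZl => [|k _]; last exact: measure_ge0.
  rewrite -nneseriesZl => [|k _]; last first.
    by apply: integral_ge0 => x kx; apply: d0; exists k.
  rewrite eseries_mkcond; apply: eq_eseriesr => k _.
  by rewrite in_setT; exact: iF.
Qed.

End MeasureIdentity.

(** * Convex bodies as unit balls *)

Section Bodies.
Variables (R : realType) (n : nat).
Local Notation V := 'rV[R]_n.
Local Notation S := (@sphere R n).
Local Notation SB := (@sphere R n : set (Rn R n)).
Implicit Types (x y z u v w : V) (s t : R).

Section NormBody.
Variables (c1 c2 : R) (g : V -> R).
Hypothesis gN : is_norm c1 c2 g.

Lemma convex_body_unit_ball : convex_body_e (unit_ball g : set (vec R n)).
Proof.
split; last by move=> x; rewrite /unit_ball/= (is_normN gN).
split; last split.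
- move=> x y l; rewrite !inE => gx gy.
  apply: (convex_unit_ball gN gx gy); apply/andP; split.
    exact: (ge0 l).
  exact: (le1 l).
- exact: (compact_unit_ball gN).
- have [c10 B _ _] := ball_between_unit gN.
  apply/nbhs_enormP; exists c2^-1; first by case/andP: c10.
  by move=> y; rewrite subr0 => /ltW; exact: B.
Qed.

Lemma radial_unit_ball x : x != 0 -> radial (unit_ball g) x = (g x)^-1.
Proof.
move=> x0; have gx := is_norm_pos gN x0.
have E t : 0 <= t -> (g (t *: x) <= 1) = (t <= (g x)^-1).
  by move=> t0; rewrite (is_normZ gN) ger0_norm// -ler_pdivlMr// mul1r.
have r0 : 0 <= (g x)^-1 by rewrite invr_ge0 ltW.
apply/eqP; rewrite eq_le; apply/andP; split.
  apply: ge_sup; first by exists 0; split => //; rewrite /unit_ball/= E.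
  by move=> t [t0]; rewrite /unit_ball/= E.
apply: ub_le_sup; last by split => //; rewrite /unit_ball/= E.
by exists (g x)^-1 => t [t0]; rewrite /unit_ball/= E.
Qed.

Lemma polar_unit_ball : polar (unit_ball g : set (vec R n)) = unit_ball (dual g).
Proof.
apply/seteqP; split=> x h.
  by apply: (support_le (ball_between_unit gN)) => y /h.
move=> y gy; apply: le_trans (ler_norm _) _; apply: le_trans (abs_dot_dual gN x y) _.
have d0 := is_norm_ge0 (dual_norm gN) x; have g0 := is_norm_ge0 gN y.
by rewrite mulr_ile1.
Qed.

Lemma alpha_set_unit_ball x : S x -> alpha_set (unit_ball g : set (vec R n)) x = norming g x.
Proof.
move=> Sx; have gx := is_norm_sphere_gt0 gN Sx.
rewrite /alpha_set /normals radial_unit_ball ?sphere_neq0//.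
have gn : unit_ball g ((g x)^-1 *: x).
  by rewrite /unit_ball/= (is_normZ gN) gtr0_norm ?invr_gt0// mulVf// gt_eqF.
apply/seteqP; split=> v [Sv h]; split => //.
  apply/eqP; rewrite eq_le (le_trans (ler_norm _) (abs_dot_dual gN v x))/=.
  rewrite mulrC -ler_pdivlMl//; apply: (support_le (ball_between_unit gN)) => y /h.
  by rewrite dotZr.
move=> y gy; rewrite dotZr h mulrCA mulVf ?gt_eqF// mulr1.
exact: (support_ge (ball_between_unit gN)).
Qed.

Lemma alpha_unit_ball x : S x -> alpha (unit_ball g : set (vec R n)) x = gauss g x.
Proof. by move=> Sx; rewrite /alpha alpha_set_unit_ball. Qed.

Lemma radial_polar_unit_ball u : u != 0 ->
  radial (polar (unit_ball g : set (vec R n))) u = (dual g u)^-1.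
Proof.
move=> u0; rewrite polar_unit_ball /radial.
have hN := dual_norm gN; have gu := is_norm_pos hN u0.
have E t : 0 <= t -> (dual g (t *: u) <= 1) = (t <= (dual g u)^-1).
  by move=> t0; rewrite (is_normZ hN) ger0_norm// -ler_pdivlMr// mul1r.
have r0 : 0 <= (dual g u)^-1 by rewrite invr_ge0 ltW.
apply/eqP; rewrite eq_le; apply/andP; split.
  apply: ge_sup; first by exists 0; split => //; rewrite /unit_ball/= E.
  by move=> t [t0]; rewrite /unit_ball/= E.
apply: ub_le_sup; last by split => //; rewrite /unit_ball/= E.
by exists (dual g u)^-1 => t [t0]; rewrite /unit_ball/= E.
Qed.

Lemma alpha_star_unit_ball (w : set V) :
  alpha_star (unit_ball g : set (vec R n)) w =
  [set x | S x /\ exists2 v, norming g x v & w v].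
Proof.
by apply/seteqP; split=> x [Sx h]; split => //; move: h; rewrite alpha_set_unit_ball.
Qed.

Lemma alpha_star_gauss_preimage (w : set V) :
  gauss_preimage g w `<=` alpha_star (unit_ball g : set (vec R n)) w /\
  alpha_star (unit_ball g : set (vec R n)) w `<=` gauss_preimage g w `|` singular_set g.
Proof.
rewrite alpha_star_unit_ball; split=> x.
  move=> [[Sx nx] wx]; split => //; exists (gauss g x) => //.
  by apply: (norming_gauss gN); exact: sphere_neq0.
move=> [Sx [v xv wv]]; have [sx|nx] := pselect (singular_set g x); [by right|left].
have rx : regular g x by split.
by split => //=; rewrite -(gauss_uniq gN rx xv).
Qed.

End NormBody.

(* alpha_star need not send Borel sets to Borel sets, but it does so up to a null set. *)
Lemma integral_up_to_null (lam : {measure set (Rn R n) -> \bar R}) (D E N : set (Rn R n))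
    (f : Rn R n -> \bar R) :
  measurable E -> measurable N -> lam N = 0%E -> E `<=` D -> D `<=` E `|` N ->
  measurable_fun E f -> (forall x, D x -> 0 <= f x)%E ->
  (\int[lam]_(x in D) f x = \int[lam]_(x in E) f x)%E.
Proof.
move=> mE mN N0 ED DEN mf f0; apply/eqP; rewrite eq_le; apply/andP; split; last first.
  apply: le_integral_nonmeasurable => x; rewrite !patchE.
    by case: ifPn => // /set_mem/ED/f0.
  case: ifPn => [/set_mem xE|_]; first by rewrite mem_set//; exact: ED.
  by case: ifPn => // /set_mem/f0.
(* The value [+oo] on the null set dominates [f] there whatever it is; [F] is measurable and has the
   same integral as [f] over [E]. *)
pose F (x : Rn R n) := if x \in N then +oo%E else (f \_ E) x.
have mfE : measurable_fun [set: Rn R n] (f \_ E) by apply/(measurable_restrictT _ mE).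
have mF : measurable_fun setT F.
  apply: measurable_fun_ifT => //.
  by apply: (measurable_fun_bool true); rewrite setTI preimage_mem_true.
have fE0 x : (0 <= (f \_ E) x)%E by rewrite patchE; case: ifPn => // /set_mem/ED/f0.
have F0 x : (0 <= F x)%E by rewrite /F; case: ifPn => // _; exact: leey.
apply: (@le_trans _ _ (\int[lam]_x F x)%E).
  apply: le_integral_nonmeasurable => x; rewrite ?patch_setT patchE.
    by case: ifPn => // /set_mem/f0.
  rewrite /F; case: ifPn => [xD|_]; last by case: ifPn => // _; exact: leey.
  case: ifPn => [_|xN]; first exact: leey.
  rewrite patchE; case: ifPn => // /negP xE.
  by have [/mem_set h|/mem_set h] := DEN x (set_mem xD); [case: (xE h)|rewrite h in xN].
rewrite (ge0_negligible_integral mN)//.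
rewrite [leRHS]integral_mkcond [leRHS](ge0_negligible_integral mN)//.
rewrite le_eqVlt; apply/orP; left; apply/eqP; apply: eq_integral => x.
by rewrite inE => -[_ xN]; rewrite /F ifN//; apply/negP; rewrite inE.
Qed.

(** The factors [A] and [B] and the sign [s] cancel in the normalised quotient, so a negative
    [C_Theta] is covered as well. *)
Lemma normalized_eq_of_proportional (mu : {measure set (Rn R n) -> \bar R})
    (nu : set (vec R n) -> \bar R) (m : set (Rn R n) -> \bar R) (A B s : R) :
  finite_meas mu -> 0 < fine (mu SB) -> 0 < A -> 0 < B -> s != 0 ->
  (forall w : set (Rn R n), measurable w -> B%:E * mu (SB `&` w) = A%:E * m w)%E ->
  (forall w : set (Rn R n), measurable w -> w `<=` SB -> nu w = s%:E * m w)%E ->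
  normalized_eq mu nu.
Proof.
move=> mufin mS0 A0 B0 s0 Bm nus.
have mE (w : set (Rn R n)) : measurable w -> w `<=` SB -> m w = (A^-1 * B * fine (mu w))%:E.
  move=> mw wS; have := Bm w mw; rewrite setIidr// (finite_measE mufin mw) => e.
  rewrite -mulrA EFinM [X in (_ * X)%E]EFinM /= e muleA -EFinM mulVf ?gt_eqF// mul1e//.
have nuE (w : set (Rn R n)) : measurable w -> w `<=` SB -> nu w = (s * (A^-1 * B * fine (mu w)))%:E.
  by move=> mw wS; rewrite nus// mE.
have mS := @measurable_sphere R n.
have k0 : s * (A^-1 * B * fine (mu SB)) != 0.
  by rewrite mulf_neq0// gt_eqF// !mulr_gt0// invr_gt0.
split; [|split].
- by rewrite nuE.
- by rewrite nuE//; rewrite eqe.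
- move=> w mw wS; rewrite !nuE// -EFinM/=; congr EFin.
  by field; rewrite s0 !gt_eqF.
Qed.

End Bodies.

(** * The substitution of e^{-t} for t *)

Section Transform.
Variables (R : realType) (n : nat).
Local Notation V := 'rV[R]_n.
Local Notation S := (@sphere R n).
Local Notation SB := (@sphere R n : set (Rn R n)).
Implicit Types (x y z u v w : V) (s t : R).

(* G is rewritten as a function of -ln t, which turns the radial function into the logarithm of
   the norm. The sign s is -1 when G increases in t. *)
Definition log_arg (s : R) (G : V -> R -> R) u t := s * G u (expR (- t)).
Definition log_arg' (s : R) (G : V -> R -> R) u t := - s * (Gt G u (expR (- t)) * expR (- t)).

Lemma jcont_log (F : V -> R -> R) : joint_cont F -> jcont (fun u t => F u (expR (- t))).
Proof.
move=> Fc u t e Su e0; have [d d0 hd] := Fc u (expR (- t)) Su (expR_gt0 _) e e0.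
have ec : {for t, continuous (fun t => expR (- t))}.
  by apply: continuous_comp; [exact: oppr_continuous|exact: continuous_expR].
have /cvgrPdist_lt/(_ d d0)/nbhs_ballP[d' /= d'0 hd'] := ec.
exists (Num.min d d') => [|v s Sv]; first by rewrite lt_min d0.
rewrite !lt_min => /andP[vu _] /andP[_ st]; apply: hd => //; first exact: expR_gt0.
by rewrite distrC; apply: hd'; rewrite /ball/= distrC.
Qed.

Lemma jcont_mul (F F1 : V -> R -> R) : jcont F -> jcont F1 -> jcont (fun u t => F u t * F1 u t).
Proof.
move=> Fc F1c u t e Su e0.
pose C := `|F u t| + `|F1 u t| + 1; have C0 : 0 < C by rewrite ltr_wpDl// addr_ge0.
(* [r <= 1] absorbs the product of the two errors into a linear term. *)
pose r := Num.min 1 (e / C).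
have r0 : 0 < r by rewrite lt_min ltr01 divr_gt0.
have [d d0 hd] := Fc u t r Su r0; have [d1 d10 hd1] := F1c u t r Su r0.
exists (Num.min d d1) => [|v s Sv]; first by rewrite lt_min d0.
rewrite !lt_min => /andP[vu vu1] /andP[st st1].
have h := hd v s Sv vu st; have h1 := hd1 v s Sv vu1 st1.
have r1 : r <= 1 by rewrite ge_min lexx.
have rC : r * C <= e by rewrite -ler_pdivlMr// ge_min lexx orbT.
rewrite (_ : _ - _ = (F v s - F u t) * (F1 v s - F1 u t) + F u t * (F1 v s - F1 u t) +
  (F v s - F u t) * F1 u t); last by ring.
apply: le_lt_trans (ler_normD _ _) _.
apply: le_lt_trans (lerD (ler_normD _ _) (lexx _)) _; rewrite !normrM.
have a0 := normr_ge0 (F u t); have a1 := normr_ge0 (F1 u t).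
have b0 := normr_ge0 (F v s - F u t); have b1 := normr_ge0 (F1 v s - F1 u t).
apply: lt_le_trans rC; rewrite /C.
have key (p q x y k : R) : 0 <= p -> 0 <= q -> 0 <= x -> 0 <= y -> x < k -> y < k -> k <= 1 ->
    0 < k -> x * y + p * y + x * q < k * (p + q + 1).
  move=> p0 q0 x0 y0 xk yk k1 k0.
  have : x * y < k * 1 by apply: ltr_pM => //; exact: lt_le_trans yk k1.
  have : p * y <= p * k by rewrite ler_wpM2l// ltW.
  have : x * q <= k * q by rewrite ler_wpM2r// ltW.
  lra.
exact: key.
Qed.

Lemma jcont_cst (c : R) : jcont (fun (_ : V) _ => c).
Proof. by move=> u t e Su e0; exists 1 => // v s _ _ _; rewrite subrr normr0. Qed.

Lemma log_arg_C1 (s : R) (G : V -> R -> R) : class_C G ->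
  (forall u t, S u -> 0 < t -> s * Gt G u t < 0) -> incr_C1 (log_arg s G) (log_arg' s G).
Proof.
move=> [dG [Gc Gtc]] sG.
have ec : jcont (fun (_ : V) t => expR (- t)).
  apply: (@jcont_log (fun _ t => t)) => u t _ _ e e0.
  by exists e => // v t' _ _ _.
split.
- exact: jcont_mul (jcont_cst s) (jcont_log Gc).
- exact: jcont_mul (jcont_cst (- s)) (jcont_mul (jcont_log Gtc) ec).
- move=> u t Su; rewrite /log_arg /log_arg'.
  have h1 : is_derive t 1 (fun t : R => expR (- t)) (- expR (- t)).
    have := @is_derive1_comp R (@expR R) -%R t (expR (- t)) (-1) (is_derive_expR _) _.
    by rewrite mulrN1; apply; exact: is_deriveNid.
  have h2 : is_derive (expR (- t)) 1 (G u) (Gt G u (expR (- t))).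
    by rewrite /Gt derive1E; apply: DeriveDef => //; apply: dG => //; exact: expR_gt0.
  have h3 := @is_derive1_comp R (G u) (fun t => expR (- t)) t _ _ h2 h1.
  have h4 := @is_deriveZ R R R _ s t 1 _ h3.
  apply: is_derive_eq h4 _.
  by rewrite /GRing.scale/=; ring.
- move=> u t Su; rewrite /log_arg' mulrA mulNr -mulNr.
  by rewrite mulr_gt0 ?expR_gt0// mulNr oppr_gt0 sG ?expR_gt0.
Qed.

Lemma log_argN (s : R) (G : V -> R -> R) : even_fun G ->
  forall u t, S u -> log_arg' s G (- u) t = log_arg' s G u t.
Proof.
move=> Ge u t Su; rewrite /log_arg' /Gt !derive1E; congr (_ * (_ * _)).
apply: near_eq_derive; have e0 := expR_gt0 (- t).
near=> r; apply/esym; apply: Ge => //; near: r.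
exact: lt_nbhsr.
Unshelve. all: by end_near. Qed.

End Transform.

Section BodyIntegral.
Variables (R : realType) (n : nat).
Local Notation V := 'rV[R]_n.
Local Notation S := (@sphere R n).
Local Notation SB := (@sphere R n : set (Rn R n)).
Variable lam : {measure set (Rn R n) -> \bar R}.
Hypothesis lamfin : finite_meas lam.
Hypothesis lamac : abs_cont_sph lam.
Variables psi psi' gam gam' : V -> R -> R.
Hypothesis psiC : incr_C1 psi psi'.
Hypothesis gamC : incr_C1 gam gam'.
Variables (c1 c2 : R) (g : V -> R).
Hypothesis gN : is_norm c1 c2 g.
Local Notation K := (unit_ball g : set (vec R n)).
Local Notation dens := (density psi' gam' g).

Lemma integral_alpha_star (f : V -> R) (s : R) (w : set (Rn R n)) : measurable w ->
  s = 1 \/ s = -1 -> (forall x, S x -> f x = s * dens x) ->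
  (\int[lam]_(x in (alpha_star K w : set (Rn R n))) (f x)%:E =
   s%:E * \int[lam]_(x in gauss_preimage g w) (dens x)%:E)%E.
Proof.
move=> mw s1 fd.
have [sub1 sub2] := alpha_star_gauss_preimage gN w.
have aS : alpha_star K w `<=` S by move=> x [].
have d0 x : alpha_star K w x -> (0 <= (dens x)%:E)%E.
  by move=> /aS Sx; rewrite lee_fin ltW// (density_gt0 psiC gamC gN).
have mE : measurable (gauss_preimage g w) by exact: (measurable_gauss_preimage gN).
have key : (\int[lam]_(x in (alpha_star K w : set (Rn R n))) (dens x)%:E =
    \int[lam]_(x in gauss_preimage g w) (dens x)%:E)%E.
  apply: (integral_up_to_null mE (measurable_singular_set gN)) => //.
    exact: (singular_set_null gN lamac).
  have pS : gauss_preimage g w `<=` regular g by move=> x [].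
  have [md _] := integrableP _ _ _ (density_int lamfin psiC gamC gN).
  exact: measurable_funS (measurable_regular gN) pS md.
rewrite -key; case: s1 fd => -> fd.
  rewrite mul1e; apply: eq_integral => x /set_mem/aS Sx.
  by rewrite fd// mul1r.
rewrite EFinN mulN1e -integral_ge0N//; apply: eq_integral => x /set_mem/aS Sx.
by rewrite fd// mulN1r EFinN.
Qed.

End BodyIntegral.

(** * The theorem *)

Section Bounds.
Variables (R : realType) (n : nat).
Local Notation V := 'rV[R]_n.
Local Notation S := (@sphere R n).
Local Notation SB := (@sphere R n : set (Rn R n)).
Implicit Types (x y z u v w : V) (s t : R).

Lemma enorm_is_norm : is_norm 1 1 (@enorm R n).
Proof.
split; first by rewrite ltr01 lexx.
- exact: enormD.
- exact: enormZ.
- by move=> x; rewrite mul1r lexx.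
Qed.

Lemma dual_enorm u : S u -> dual (@enorm R n) u = 1.
Proof.
by move=> /(is_norm_sphere (dual_norm enorm_is_norm)); rewrite invr1 -eq_le => /eqP.
Qed.

Section Norm.
Variables (d1 d2 : R) (g : V -> R).
Hypothesis gN : is_norm d1 d2 g.

(** For w normal at x0 one has h(w) g(x0) = w.x0 <= 1, so |w.u| <= h(w) g(u) gives |w.u| g(x0) <=
    g(u). *)
Lemma ln_norm_slab x0 : S x0 -> exists2 w, S w & forall u, S u -> dot w u != 0 ->
  ln `|dot w u| + ln (g x0) <= ln (g u).
Proof.
move=> Sx0; have [w Sw e] := dual_attained gN (sphere_neq0 Sx0).
have g0 := is_norm_sphere_gt0 gN Sx0; have dw := is_norm_sphere_gt0 (dual_norm gN) Sw.
have hw : dual g w * g x0 <= 1.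
  by rewrite -e (le_trans (ler_norm _))// (le_trans (abs_dot_sphere _ Sw))//; move/sphere_enorm : Sx0 => ->.
exists w => // u Su wu; have gu := is_norm_sphere_gt0 gN Su.
rewrite -lnM ?posrE ?normr_gt0// ler_ln ?posrE ?mulr_gt0 ?normr_gt0//.
apply: (@le_trans _ _ (dual g w * g u * g x0)).
  by rewrite ler_pM2r//; exact: (abs_dot_dual gN).
by rewrite mulrAC ler_piMl// ltW.
Qed.

Lemma ln_dual_slab x0 : S x0 -> forall u, S u -> dot x0 u != 0 ->
  ln `|dot x0 u| + - ln (g x0) <= ln (dual g u).
Proof.
move=> Sx0 u Su wu; have g0 := is_norm_sphere_gt0 gN Sx0.
have du := is_norm_sphere_gt0 (dual_norm gN) Su.
rewrite lerBlDr -lnM ?posrE// ler_ln ?posrE ?mulr_gt0 ?normr_gt0//.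
by rewrite dotC; exact: (abs_dot_dual gN).
Qed.

Lemma norm_le_of_coercive (nu : {measure set (Rn R n) -> \bar R}) (F : V -> R -> R) (b T : R)
    (C : (V -> R) -> Prop) :
  (forall w (l : V -> R), S w -> sph_cont l ->
    (forall u, S u -> dot w u != 0 -> ln `|dot w u| + T <= l u) -> C l -> b <= energy nu F l) ->
  C (fun x => ln (g x)) -> energy nu F (fun x => ln (g x)) < b -> forall x, S x -> ln (g x) <= T.
Proof.
move=> h Cl lb x Sx; rewrite leNgt; apply/negP => Tx.
have [w Sw hw] := ln_norm_slab Sx; move: lb; rewrite ltNge => /negP; apply.
apply: (h w) => //; first exact: sph_cont_ln_norm gN.
by move=> u Su wu; apply: le_trans (hw u Su wu); rewrite lerD2l ltW.
Qed.

Lemma norm_ge_of_coercive (nu : {measure set (Rn R n) -> \bar R}) (F : V -> R -> R) (b T : R)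
    (C : (V -> R) -> Prop) :
  (forall w (l : V -> R), S w -> sph_cont l ->
    (forall u, S u -> dot w u != 0 -> ln `|dot w u| + T <= l u) -> C l -> b <= energy nu F l) ->
  C (fun x => ln (dual g x)) -> energy nu F (fun x => ln (dual g x)) < b ->
  forall x, S x -> - T <= ln (g x).
Proof.
move=> h Cl lb x Sx; rewrite leNgt; apply/negP => Tx.
move: lb; rewrite ltNge => /negP; apply.
apply: (h x) => //; first exact: sph_cont_ln_norm (dual_norm gN).
by move=> u Su wu; apply: le_trans (ln_dual_slab Sx Su wu); rewrite lerD2l; lra.
Qed.

Lemma ln_dual_ge T : (forall x, S x -> ln (g x) <= T) -> forall u, S u -> - T <= ln (dual g u).
Proof.
move=> gT u Su; have := ln_dual_slab Su Su; have := gT u Su.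
rewrite (_ : dot u u = 1)// normr1 ln1 oner_neq0 => h1 /(_ isT); lra.
Qed.

Lemma is_norm_of_ln T1 T2 : S !=set0 ->
  (forall x, S x -> ln (g x) <= T1) -> (forall x, S x -> - T2 <= ln (g x)) ->
  is_norm (expR (- T2)) (expR T1) g.
Proof.
move=> [x0 Sx0] h1 h2; split.
- rewrite expR_gt0 ler_expR; exact: le_trans (h2 _ Sx0) (h1 _ Sx0).
- exact: is_normD gN.
- exact: is_normZ gN.
- move=> x; have [->|xn] := eqVneq x 0; first by rewrite enorm0 (is_norm0 gN) !mulr0 lexx.
  have Sx := sphere_normalize xn; have ex := enorm_gt0 xn.
  have e : g x = g ((enorm x)^-1 *: x) * enorm x.
    by rewrite (is_normZ gN) gtr0_norm ?invr_gt0// mulrAC mulVf ?mul1r// gt_eqF.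
  have g0 := is_norm_sphere_gt0 gN Sx.
  rewrite e !ler_pM2r//; apply/andP; split.
    by rewrite -[leRHS]lnK ?posrE// ler_expR h2.
  by rewrite -[leLHS]lnK ?posrE// ler_expR h1.
Qed.

End Norm.
End Bounds.

(** * Solutions from coercive energies *)

Section Existence.
Variables (R : realType) (n : nat).
Local Notation V := 'rV[R]_n.
Local Notation S := (@sphere R n).
Local Notation SB := (@sphere R n : set (Rn R n)).
Variables lam mu : {measure set (Rn R n) -> \bar R}.
Hypothesis lamM : class_M lam.
Hypothesis lameven : even_meas lam.
Hypotheses (muS : on_sphere mu) (mu0 : nonzero_meas mu) (mufin : finite_meas mu).
Hypothesis mueven : even_meas mu.
Variables psi psi' gam gam' : V -> R -> R.
Hypothesis psiC : incr_C1 psi psi'.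
Hypothesis gamC : incr_C1 gam gam'.
Hypothesis psi'N : forall u t, S u -> psi' (- u) t = psi' u t.
Hypothesis gam'N : forall u t, S u -> gam' (- u) t = gam' u t.
Let lamfin : finite_meas lam. Proof. by case: lamM => _ [_ []]. Qed.
Let lamac : abs_cont_sph lam. Proof. by case: lamM => _ [_ []]. Qed.

Let S0 : S !=set0.
Proof.
have := sphere_meas_gt0 mufin muS mu0; apply: contraPP => /set0P/negP; rewrite negbK => /eqP ->.
by rewrite measure0 ltxx.
Qed.

(** The side condition [C] is trivial for an energy that is coercive by itself, and a lower bound on
    [l] for one that needs the estimate obtained from the other energy. *)
Definition slab_coercive (nu : {measure set (Rn R n) -> \bar R}) (F : V -> R -> R) (b T : R)
    (C : (V -> R) -> Prop) := forall w (l : V -> R), S w -> sph_cont l ->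
  (forall u, S u -> dot w u != 0 -> ln `|dot w u| + T <= l u) -> C l -> b <= energy nu F l.

Definition solution (g : V -> R) := exists c1 c2 A B,
  [/\ is_norm c1 c2 g, 0 < A, 0 < B & forall w : set (Rn R n), measurable w ->
    (B%:E * mu (SB `&` w) = A%:E * \int[lam]_(x in gauss_preimage g w) (density psi' gam' g x)%:E)%E].

(** The Euclidean norm is the feasible starting point: its logarithm and that of its dual vanish on
    the sphere, hence the conditions on the energies at 0. *)
Lemma solution_of_bounds (a b c1 c2 : R) :
  energy mu psi (fun=> 0) < a -> energy lam gam (fun=> 0) < b ->
  (forall d1 d2 g, is_norm d1 d2 g -> dual_energy mu psi g < a -> radial_energy lam gam g < b ->
    is_norm c1 c2 g) -> exists g, solution g.
Proof.
move=> Pa Qb bnd; have eN := @enorm_is_norm R n.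
have Pe : dual_energy mu psi (@enorm R n) < a.
  rewrite (_ : dual_energy _ _ _ = energy mu psi (fun=> 0))//.
  by apply: eq_Rintegral => u /set_mem Su; rewrite dual_enorm// ln1.
have Qe : radial_energy lam gam (@enorm R n) < b.
  rewrite (_ : radial_energy _ _ _ = energy lam gam (fun=> 0))//.
  by apply: eq_Rintegral => u /set_mem /sphere_enorm ->; rewrite ln1.
have [g [gN ga gb gmax]] := maximiser_exists lamfin mufin psiC gamC bnd eN Pe Qe.
exists g, c1, c2, (a - dual_energy mu psi g), (b - radial_energy lam gam g); split => //.
- by rewrite subr_gt0.
- by rewrite subr_gt0.
- move=> w mw.
  exact: (ident_measurable lamfin mufin lamac lameven mueven psiC gamC psi'N gam'N gN ga gb gmax).
Qed.

(* When the radial energy is coercive by itself it bounds K from below, and that bound makes the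
   dual energy coercive. *)
Lemma solution_radial_first :
  (forall b, exists T, slab_coercive lam gam b T (fun=> True)) ->
  (forall m, exists a T, energy mu psi (fun=> 0) < a /\
    slab_coercive mu psi a T (fun l => forall u, S u -> m <= l u)) ->
  exists g, solution g.
Proof.
move=> Qc Pc; pose b := energy lam gam (fun=> 0) + 1.
have [T1 h1] := Qc b; have [a [T2 [Pa h2]]] := Pc (- T1).
apply: (@solution_of_bounds a b (expR (- T2)) (expR T1)) => //; first by rewrite ltrDl.
move=> d1 d2 g gN Pg Qg.
have u1 := norm_le_of_coercive gN h1 I Qg.
have u2 := norm_ge_of_coercive gN h2 (ln_dual_ge gN u1) Pg.
exact: (is_norm_of_ln gN S0 u1 u2).
Qed.

(** The mirror image of the previous case: the dual energy bounds [g] from below, and that bound is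
    the side condition under which the radial energy is coercive. *)
Lemma solution_dual_first :
  (forall a, exists T, slab_coercive mu psi a T (fun=> True)) ->
  (forall m b, exists T, slab_coercive lam gam b T (fun l => forall u, S u -> m <= l u)) ->
  exists g, solution g.
Proof.
move=> Pc Qc; pose b := energy lam gam (fun=> 0) + 1; pose a := energy mu psi (fun=> 0) + 1.
have [T2 h2] := Pc a; have [T1 h1] := Qc (- T2) b.
apply: (@solution_of_bounds a b (expR (- T2)) (expR T1)); [by rewrite ltrDl|by rewrite ltrDl|].
move=> d1 d2 g gN Pg Qg.
have u2 := norm_ge_of_coercive gN h2 I Pg.
have u1 := norm_le_of_coercive gN h1 u2 Qg.
exact: (is_norm_of_ln gN S0 u1 u2).
Qed.

(** By monotonicity [m <= l] gives F(u, l(u)) >= F(u, m), which is bounded below on the sphere. *)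
Lemma slab_coercive_blowup (nu : {measure set (Rn R n) -> \bar R}) (F F' : V -> R -> R) (b m : R) :
  not_concentrated nu -> finite_meas nu -> incr_C1 F F' ->
  (forall u, S u -> forall A, exists T, A <= F u T) ->
  exists T, slab_coercive nu F b T (fun l => forall u, S u -> m <= l u).
Proof.
move=> nuc nufin FC Finf; have [Fc _ _ _] := FC.
have [B _ hB] := jcont_bounded `|m| Fc.
have [T h] := coercive_of_blowup nufin FC B nuc Finf b.
exists T => w l Sw lc lT lm; apply: (h w) => // u Su.
have := hB u m Su (lexx _); rewrite ler_norml => /andP[h1 _].
by apply: le_trans h1 _; apply: (incr_le FC) => //; exact: lm.
Qed.

(** Positivity of [F] replaces the lower bound on [l]; this is what membership in [class_Gd]
    contributes. *)
Lemma slab_coercive_blowup_pos (nu : {measure set (Rn R n) -> \bar R}) (F F' : V -> R -> R) (b : R) :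
  not_concentrated nu -> finite_meas nu -> incr_C1 F F' ->
  (forall u, S u -> forall A, exists T, A <= F u T) -> (forall u t, S u -> 0 <= F u t) ->
  exists T, slab_coercive nu F b T (fun=> True).
Proof.
move=> nuc nufin FC Finf F0.
have [T h] := coercive_of_blowup nufin FC 0 nuc Finf b.
by exists T => w l Sw lc lT _; apply: (h w) => // u Su; rewrite oppr0 F0.
Qed.

End Existence.

(** * The functionals on unit balls, and necessity *)

Section Assembly.
Variables (R : realType) (n : nat).
Local Notation V := 'rV[R]_n.
Local Notation S := (@sphere R n).
Local Notation SB := (@sphere R n : set (Rn R n)).
Implicit Types (x y z u v w : V) (s t : R).

Lemma log_arg'_ln (s r : R) (G : V -> R -> R) u : 0 < r ->
  log_arg' s G u (ln r) = - s * (Gt G u r^-1 * r^-1).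
Proof. by move=> r0; rewrite /log_arg' expRN lnK. Qed.

Lemma log_arg_blowup (G : V -> R -> R) : blows_up_at0 G ->
  forall u, S u -> forall A, exists T, A <= log_arg 1 G u T.
Proof.
move=> Gb u Su A; have /cvgryPge/(_ A) := Gb u Su.
rewrite near_withinE => /nbhs_ballP[d /= d0 hd].
have d2 : 0 < d / 2 by rewrite divr_gt0.
exists (- ln (d / 2)); rewrite /log_arg mul1r opprK lnK//; apply: hd => //.
by rewrite /ball/= sub0r normrN gtr0_norm// ltr_pdivrMr// ltr_pMr// ltr1n.
Qed.

Section Values.
Variables (lam : {measure set (Rn R n) -> \bar R}) (G Psi : V -> R -> R) (s : R).
Hypothesis lamM : class_M lam.
Hypothesis s1 : s = 1 \/ s = -1.
Hypothesis psiC : incr_C1 (log_arg s Psi) (log_arg' s Psi).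
Variables (c1 c2 : R) (g : V -> R).
Hypothesis gN : is_norm c1 c2 g.
Local Notation K := (unit_ball g : set (vec R n)).

Let lamfin : finite_meas lam. Proof. by case: lamM => _ [_ []]. Qed.
Let lamac : abs_cont_sph lam. Proof. by case: lamM => _ [_ []]. Qed.

Let psiE u : S u -> log_arg' s Psi u (ln (dual g u)) =
  - s * (Gt Psi u (dual g u)^-1 * (dual g u)^-1) /\ Gt Psi u (dual g u)^-1 != 0.
Proof.
move=> Su; have du := is_norm_sphere_gt0 (dual_norm gN) Su.
split; first exact: log_arg'_ln.
have [_ _ _ /(_ u (ln (dual g u)) Su)] := psiC; rewrite log_arg'_ln//.
by apply: contraTneq => ->; rewrite mul0r mulr0 ltxx.
Qed.

Lemma C_Theta_unit_ball (w : set (Rn R n)) : incr_C1 (log_arg 1 G) (log_arg' 1 G) ->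
  measurable w -> C_Theta G Psi lam K w =
  (s%:E * \int[lam]_(x in gauss_preimage g w)
    (density (log_arg' s Psi) (log_arg' 1 G) g x)%:E)%E.
Proof.
move=> gamC mw; apply: (integral_alpha_star lamfin lamac psiC gamC gN) => // x Sx.
have gx := is_norm_sphere_gt0 gN Sx; have Su := gauss_sphere gN Sx.
rewrite (radial_unit_ball gN) ?sphere_neq0// (alpha_unit_ball gN)//.
rewrite (radial_polar_unit_ball gN) ?sphere_neq0//.
rewrite /density /gamln /psiln log_arg'_ln//.
have [-> p0] := psiE Su; have du := is_norm_sphere_gt0 (dual_norm gN) Su.
by case: s1 => ->; field; rewrite p0 !gt_eqF.
Qed.

Lemma J_Psi_unit_ball (w : set (Rn R n)) : s = -1 ->
  incr_C1 (fun=> id) (fun (_ : V) (_ : R) => 1 : R) -> measurable w ->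
  J_Psi Psi lam K w = (1%:E * \int[lam]_(x in gauss_preimage g w)
    (density (log_arg' s Psi) (fun _ _ => 1%R) g x)%:E)%E.
Proof.
move=> sE idC mw; apply: (integral_alpha_star lamfin lamac psiC idC gN) => //; first by left.
move=> x Sx; have gx := is_norm_sphere_gt0 gN Sx; have Su := gauss_sphere gN Sx.
rewrite (alpha_unit_ball gN)// (radial_polar_unit_ball gN) ?sphere_neq0//.
rewrite /density /gamln /psiln.
have [-> p0] := psiE Su; have du := is_norm_sphere_gt0 (dual_norm gN) Su.
by rewrite sE; field; rewrite p0 gt_eqF.
Qed.

End Values.

(** The gauge is produced as the Wulff norm of the support function, so that [wulff_support]
    identifies its unit ball with K. *)
Lemma body_norm (K : set (vec R n)) : convex_body_e K ->
  exists c1 c2 g, is_norm c1 c2 g /\ K = unit_ball g.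
Proof.
move=> [[convK [cK iK]] KN].
have /nbhs_enormP[e e0 he] := iK.
have ec : {within (K : set V), continuous (@enorm R n)}.
  exact: continuous_subspaceT (@enorm_continuous R n).
have K0 : (K : set V) !=set0 by exists 0; apply: he; rewrite subrr enorm0.
have [x0 _ hx0] := @compact_EVT_max _ R (@enorm R n) K K0 cK ec.
(* [e / 2] because the inner ball must be closed; the maximum in the outer radius secures
   [r1 <= r2]. *)
have Kr : ball_between (e / 2) (Num.max (e / 2) (enorm x0)) K.
  split => //.
  - by rewrite divr_gt0//= le_max lexx.
  - move=> x xe; apply: he; rewrite subr0; apply: le_lt_trans xe _.
    by rewrite ltr_pdivrMr// ltr_pMr// ltr1n.
  - by move=> x Kx; rewrite le_max hx0 ?orbT// inE.
have cc : convex_closed K.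
  move=> x y t Kx Ky /andP[t0 t1].
  by have := convK x y (Itv01 t0 t1) (mem_set Kx) (mem_set Ky); rewrite inE.
have hN := support_norm Kr.
have r0 : 0 < e / 2 <= Num.max (e / 2) (enorm x0) by case: Kr.
have gN := wulff_norm r0 (fun u Su => is_norm_sphere hN Su).
exists (Num.max (e / 2) (enorm x0))^-1, (e / 2)^-1, (wulff (support K)); split => //.
by apply/seteqP; split=> x /(wulff_support x Kr cK cc).
Qed.

(** At x on the sphere a normal u satisfies u.x = h(u) g(x) >= c1 / c2, so no normal at a point
    within c1 / c2 of v is orthogonal to v. Up to a null set, the preimage of the complement of
    v^perp therefore contains an open cap, and the density has a positive lower bound. *)
Lemma not_concentrated_of_solution (lam nu : {measure set (Rn R n) -> \bar R})
    (G Psi : V -> R -> R) (K : set (vec R n)) :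
  class_M lam -> pos_on_open lam -> finite_meas nu ->
  incr_C1 (log_arg 1 Psi) (log_arg' 1 Psi) -> incr_C1 (log_arg 1 G) (log_arg' 1 G) ->
  convex_body_e K -> normalized_eq nu (C_Theta G Psi lam K) -> not_concentrated nu.
Proof.
move=> lamM lampos nufin psiC gamC bK [Cfin [C0 Ceq]] v Sv.
have lamfin : finite_meas lam by case: lamM => _ [_ []].
have lamac : abs_cont_sph lam by case: lamM => _ [_ []].
have [c1 [c2 [g [gN KE]]]] := body_norm bK.
have c10 := is_norm_gt0 gN; have c20 := is_norm_gt0r gN.
pose w : set (Rn R n) := SB `\` perp v.
have mS := @measurable_sphere R n.
have pcl : closed (perp v : set V).
  rewrite (_ : perp v = dot v @^-1` [set 0]); last by [].
  by apply: closed_comp => [x _|]; [exact: dot_continuous|exact: closed_eq].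
have mw : measurable w by apply: measurableD => //; exact: closed_Rn.
have wS : w `<=` SB by move=> x [].
pose dens := density (log_arg' 1 Psi) (log_arg' 1 G) g.
pose m (X : set (Rn R n)) := (\int[lam]_(x in gauss_preimage g X) (dens x)%:E)%E.
have CE (X : set (Rn R n)) : measurable X -> C_Theta G Psi lam K X = m X.
  move=> mX; rewrite KE (C_Theta_unit_ball lamM _ psiC gN gamC mX) ?mul1e//; by left.
have kap0 : 0 < c1 / c2 by rewrite divr_gt0.
pose O : set V := [set x | enorm (x - v) < c1 / c2].
have oO : open O.
  apply/open_enormP => x xO; exists (c1 / c2 - enorm (x - v)); first by rewrite subr_gt0.
  move=> y; rewrite ltrBrDr => h; rewrite /O/=; apply: le_lt_trans h.
  by rewrite (le_trans _ (enormD _ _))// addrA subrK.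
have mO : measurable (SB `&` O) by apply: measurableI => //; exact: open_Rn.
have Opos : (0 < lam (SB `&` O))%E.
  by apply: lampos => //; exists v; split => //; rewrite /O/= subrr enorm0.
have sub : (SB `&` O) `\` singular_set g `<=` gauss_preimage g w.
  move=> x [[Sx Ox] nx]; split; first by split.
  have [Su ux] := norming_gauss gN (sphere_neq0 Sx); split => //.
  rewrite /perp/= dotC => uv.
  have k1 : c1 / c2 <= dot (gauss g x) x.
    rewrite ux mulrC; have /andP[a _] := is_norm_sphere gN Sx.
    have /andP[b _] := is_norm_sphere (dual_norm gN) Su.
    by apply: ler_pM => //; rewrite ?invr_ge0 ltW.
  have := abs_dot_sphere (x - v) Su; rewrite dotDr dotNr uv subr0 => k2.
  have := le_trans (ler_norm _) k2; move: Ox; rewrite /O/=; lra.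
have mgp : measurable (gauss_preimage g w) by exact: (measurable_gauss_preimage gN).
have gppos : (0 < lam (gauss_preimage g w))%E.
  apply: lt_le_trans Opos _.
  rewrite (measureDI lam mO (measurable_singular_set gN)).
  rewrite [X in (_ + X <= _)%E](_ : _ = 0%E); last first.
    apply: (subset_measure0 (measurableI _ _ mO (measurable_singular_set gN))
      (measurable_singular_set gN)); first by move=> x [].
    exact: (singular_set_null gN lamac).
  rewrite adde0; apply: le_measure => //; rewrite inE//.
  exact: measurableD mO (measurable_singular_set gN).
have [x1 Sx1 h1] := sph_cont_min (gamln_cont gamC gN) (@closed_sphere R n) (@subset_refl _ _)
  (ex_intro _ v Sv).
have [x2 Sx2 h2] := sph_cont_min (psiln_inv_cont psiC gN) (@closed_sphere R n) (@subset_refl _ _)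
  (ex_intro _ v Sv).
pose k := gamln (log_arg' 1 G) g x1 * (psiln (log_arg' 1 Psi) g x2)^-1.
have k0 : 0 < k by rewrite mulr_gt0 ?invr_gt0 ?(gamln_gt0 gamC)// (psiln_gt0 psiC).
have kd x : S x -> k <= dens x.
  move=> Sx; apply: ler_pM.
  - by rewrite ltW// (gamln_gt0 gamC).
  - by rewrite invr_ge0 ltW// (psiln_gt0 psiC).
  - exact: h1.
  - by apply: h2; exact: (gauss_sphere gN).
have dpos x : S x -> (0 <= (dens x)%:E)%E by move=> /kd; rewrite lee_fin; apply: le_trans; exact: ltW.
have mpos : (0 < m w)%E.
  apply: (@lt_le_trans _ _ (\int[lam]_(x in gauss_preimage g w) k%:E)%E).
    by rewrite integral_cst//= mule_gt0.
  apply: le_integral_nonmeasurable => x; rewrite !patchE; case: ifPn => // /set_mem[[Sx _] _].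
    by rewrite lee_fin ltW.
  by rewrite lee_fin kd.
have mmono : (m w <= m SB)%E.
  apply: le_integral_nonmeasurable => x; rewrite !patchE.
    by case: ifPn => // /set_mem[[Sx _] _]; exact: dpos.
  case: ifPn => [/set_mem[rx [Su _]]|_]; first by rewrite mem_set.
  by case: ifPn => // /set_mem[[Sx _] _]; exact: dpos.
have := Ceq w mw wS; rewrite !CE// in Cfin *.
have mSpos : 0 < fine (m SB).
  by rewrite fine_gt0// (lt_le_trans mpos mmono)/= ltey_eq Cfin.
move=> e; have : (0 < (fine (nu w) / fine (nu SB))%:E)%E.
  by rewrite e mule_gt0// lte_fin invr_gt0.
rewrite lte_fin => q; rewrite lt_neqAle measure_ge0 andbT eq_sym.
by apply: contraTneq q => ->; rewrite /= mul0r ltxx.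
Qed.

End Assembly.

(** * The cases of the theorem *)

Section Cases.
Variables (R : realType) (n : nat).
Local Notation V := 'rV[R]_n.
Local Notation S := (@sphere R n).
Local Notation SB := (@sphere R n : set (Rn R n)).
Variables lam mu : {measure set (Rn R n) -> \bar R}.
Hypothesis lamM : class_M lam.
Hypotheses (muS : on_sphere mu) (mu0 : nonzero_meas mu) (mufin : finite_meas mu).
Variables G Psi : V -> R -> R.

Lemma log_arg_Cd : class_Cd G -> incr_C1 (log_arg 1 G) (log_arg' 1 G).
Proof. by move=> [GC Gd]; apply: log_arg_C1 => // u t Su t0; rewrite mul1r Gd. Qed.

Lemma log_arg_CI : class_CI G -> incr_C1 (log_arg (-1) G) (log_arg' (-1) G).
Proof. by move=> [GC GI]; apply: log_arg_C1 => // u t Su t0; rewrite mulN1r oppr_lt0 GI. Qed.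

Lemma class_Gd_Cd : class_Gd G -> class_Cd G.
Proof. by move=> [GC [_ [Gd _]]]. Qed.

Lemma class_Gd_ge0 : class_Gd G -> forall u t, S u -> 0 <= log_arg 1 G u t.
Proof. by move=> [_ [G0 _]] u t Su; rewrite /log_arg mul1r ltW// G0 ?expR_gt0. Qed.

Lemma class_Gd_blowup : class_Gd G -> blows_up_at0 G.
Proof. by move=> [_ [_ [_ []]]]. Qed.

Lemma C_Theta_solution (s : R) (g : V -> R) : s = 1 \/ s = -1 ->
  incr_C1 (log_arg s Psi) (log_arg' s Psi) -> incr_C1 (log_arg 1 G) (log_arg' 1 G) ->
  solution lam mu (log_arg' s Psi) (log_arg' 1 G) g ->
  exists K0, convex_body_e K0 /\ normalized_eq mu (C_Theta G Psi lam K0).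
Proof.
move=> s1 psiC gamC [c1 [c2 [A [B [gN A0 B0 h]]]]].
exists (unit_ball g); split; first exact: (convex_body_unit_ball gN).
apply: (normalized_eq_of_proportional (s := s) mufin _ A0 B0 _ h).
- exact: sphere_meas_gt0.
- by case: s1 => ->; rewrite ?oppr_eq0 oner_neq0.
- by move=> w mw _; exact: (C_Theta_unit_ball lamM s1 psiC gN gamC mw).
Qed.

Lemma vanishing_coercive (psi psi' : V -> R -> R) : vanishes_great mu -> incr_C1 psi psi' ->
  forall m, exists a T, energy mu psi (fun=> 0) < a /\
    slab_coercive mu psi a T (fun l => forall u, S u -> m <= l u).
Proof.
move=> muv psiC m; have [a [T [Pa h]]] := coercive_of_vanishing mufin psiC m muS mu0 muv.
by exists a, T; split => // w l Sw lc lT lm; exact: (h w).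
Qed.

End Cases.

Unset Implicit Arguments.

Theorem theorem6p2 (R : realType) (n : nat)
  (lam mu : {measure set (Rn R n) -> \bar R}) (G Psi : vec R n -> R -> R) :
  (2 <= n)%N ->
  class_M lam -> even_meas lam -> not_concentrated lam ->
  on_sphere mu -> nonzero_meas mu -> finite_meas mu -> even_meas mu ->
  not_concentrated mu ->
  class_C G -> class_C Psi -> even_fun G -> even_fun Psi ->
  (* (i) *)
  ((class_Cd Psi /\ blows_up_at0 Psi /\ class_Gd G) \/
   (class_Cd G /\ blows_up_at0 G /\ class_Gd Psi) ->
     (exists K0, convex_body_e K0 /\ normalized_eq mu (C_Theta G Psi lam K0)) /\
     (pos_on_open lam ->
       forall nu : {measure set (Rn R n) -> \bar R},
         on_sphere nu -> nonzero_meas nu -> finite_meas nu -> even_meas nu ->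
         (exists K0, convex_body_e K0 /\ normalized_eq nu (C_Theta G Psi lam K0)) ->
         not_concentrated nu)) /\
  (* (ii) *)
  (vanishes_great mu -> class_CI Psi -> class_Gd G ->
     exists K0, convex_body_e K0 /\ normalized_eq mu (C_Theta G Psi lam K0)) /\
  (* (iii) *)
  (vanishes_great mu ->
   (exists C : R,
      (C%:E < ereal_inf [set (\int[lam]_(xi in (sphere (n:=n) : set (Rn R n)))
                                 log_abs_dot v xi)%E | v in sphere (n:=n)])%E) ->
   class_CI Psi ->
     exists K, convex_body_e K /\ normalized_eq mu (J_Psi Psi lam K)).
Proof.
move=> _ lamM lame lamnc muS mu0 muf mue munc GC PsiC Ge Pe.
have lamS : on_sphere lam by case: lamM.
have lam0 : nonzero_meas lam by case: lamM => _ [].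
have lamf : finite_meas lam by case: lamM => _ [_ []].
have GN s := log_argN s Ge; have PN s := log_argN s Pe.
split; [move=> cases; split|split].
- case: cases => [[PCd [Pb GGd]]|[GCd [Gb PGd]]].
  + have psiC := log_arg_Cd PCd; have gamC := log_arg_Cd (class_Gd_Cd GGd).
    (* [G] is positive, so the radial energy is coercive by itself and comes first. *)
    have [||g hg] := solution_radial_first lamM lame muS mu0 muf mue psiC gamC (PN 1) (GN 1).
    * move=> b; apply: (slab_coercive_blowup_pos b lamnc lamf gamC).
        exact: log_arg_blowup (class_Gd_blowup GGd).
      exact: class_Gd_ge0 GGd.
    * move=> m; exists (energy mu (log_arg 1 Psi) (fun=> 0) + 1).
      have [T hT] := slab_coercive_blowup (energy mu (log_arg 1 Psi) (fun=> 0) + 1) m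
        munc muf psiC (log_arg_blowup Pb).
      by exists T; split => //; rewrite ltrDl.
    * by apply: (C_Theta_solution lamM muS mu0 muf _ psiC gamC hg); left.
  + have psiC := log_arg_Cd (class_Gd_Cd PGd); have gamC := log_arg_Cd GCd.
    (* Here [Psi] is the positive function, so the order of the two estimates is reversed. *)
    have [||g hg] := solution_dual_first lamM lame muS mu0 muf mue psiC gamC (PN 1) (GN 1).
    * move=> a; apply: (slab_coercive_blowup_pos a munc muf psiC).
        exact: log_arg_blowup (class_Gd_blowup PGd).
      exact: class_Gd_ge0 PGd.
    * move=> m b; exact: (slab_coercive_blowup b m lamnc lamf gamC (log_arg_blowup Gb)).
    * by apply: (C_Theta_solution lamM muS mu0 muf _ psiC gamC hg); left.
- move=> lampos nu nuS nu0 nuf nue [K0 [bK eK]].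
  have [psiC gamC] : incr_C1 (log_arg 1 Psi) (log_arg' 1 Psi) /\ incr_C1 (log_arg 1 G) (log_arg' 1 G).
    by case: cases => [[PCd [_ /class_Gd_Cd GCd]]|[GCd [_ /class_Gd_Cd PCd]]];
      split; exact: log_arg_Cd.
  exact: (not_concentrated_of_solution lamM lampos nuf psiC gamC bK eK).
- move=> muv PCI GGd.
  have psiC := log_arg_CI PCI; have gamC := log_arg_Cd (class_Gd_Cd GGd).
  have [||g hg] := solution_radial_first lamM lame muS mu0 muf mue psiC gamC (PN (-1)) (GN 1).
  + move=> b; apply: (slab_coercive_blowup_pos b lamnc lamf gamC).
      exact: log_arg_blowup (class_Gd_blowup GGd).
    exact: class_Gd_ge0 GGd.
  (* [Psi] increases and may have a finite limit at 0, so the vanishing of [mu] on great subspheres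
     replaces the blow-up. *)
  + exact: (vanishing_coercive muS mu0 muf muv psiC).
  + by apply: (C_Theta_solution lamM muS mu0 muf _ psiC gamC hg); right.
- move=> muv [C hC] PCI.
  have psiC := log_arg_CI PCI.
  (* The integrand [t] has derivative 1, which turns the density into that of [J_Psi]. *)
  have idC : incr_C1 (fun (_ : 'rV[R]_n) => @id R) (fun _ _ => 1%R).
    split; [by move=> u t e _ e0; exists e|exact: jcont_cst| |by move=> *; exact: ltr01].
    by move=> u t _; exact: is_derive_id.
  have [||g hg] := solution_radial_first lamM lame muS mu0 muf mue psiC idC (PN (-1))
    (fun _ _ _ => erefl).
  + move=> b; have [T hT] := coercive_log lamf lamS lam0 hC b.
    by exists T => w l Sw lc lT _; exact: (hT w).
  + exact: (vanishing_coercive muS mu0 muf muv psiC).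
  + have [c1 [c2 [A [B [gN A0 B0 h]]]]] := hg.
    exists (unit_ball g); split; first exact: (convex_body_unit_ball gN).
    apply: (normalized_eq_of_proportional (s := 1) muf _ A0 B0 _ h).
    * exact: sphere_meas_gt0.
    * exact: oner_neq0.
    * move=> w mw _.
      exact: (J_Psi_unit_ball lamM psiC gN erefl idC mw).
Qed.
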